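(* Let $g^{\alpha\beta}$ and $G$ be as in the context. The equation $g^{\alpha\beta}(u)\partial_\alpha\partial_\beta u=0$ in $\mathbb{R}^{1+2}$ satisfies the geometric weak null condition if and only if $G(\omega)\ge0$ for all $\omega\in\mathbb{S}^1$.
   Context: Coefficients: $g^{\alpha\beta}=g^{\beta\alpha}$ ($\alpha,\beta\in\{0,1,2\}$) are smooth functions of $u\in\mathbb{R}$ with $g^{00}\equiv-1$ and $g^{\alpha\beta}(u)=m^{\alpha\beta}+g_0^{\alpha\beta}u^2+O(|u|^3)$ for $|u|\le1$, $(m^{\alpha\beta})=\mathrm{diag}(-1,1,1)$, $g_0^{\alpha\beta}$ real constants. For $\omega\in\mathbb{S}^1$, $\widehat\omega=(-1,\omega)$ and $G(\omega):=g_0^{\alpha\beta}\widehat\omega_\alpha\widehat\omega_\beta$ (sum over $\alpha,\beta$). Geometric reduced system of this equation, for real-valued unknowns $(\mu,U)(s,q,\omega)$, $(q,\omega)\in\mathbb{R}\times\mathbb{S}^1$: $$\partial_s(\mu U_q)=0,\qquad \partial_s\mu=\tfrac12G(\omega)\mu^2UU_q.$$ Geometric weak null condition (for this equation): for any initial data with $\mu|_{s=0}\equiv-2$ and $U|_{s=0}\in C_c^\infty(\mathbb{R}\times\mathbb{S}^1)$, the geometric reduced system has a global solution $(\mu,U)$ for all $s\ge0$ satisfying $\lim_{q\to\infty}U(s,q,\omega)=0$ for all $(s,\omega)\in[0,\infty)\times\mathbb{S}^1$ and, for every integer $N\ge1$, $$|\mu|+|\mu|^{-1}+\sum_{1\le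 a+b+c\le N}|\partial_s^a\partial_q^b\partial_\omega^c\mu|+\sum_{a+b+c\le N}|\partial_s^a\partial_q^b\partial_\omega^cU|\le C_N'e^{C_Ns}\quad\forall s\ge0,\ (q,\omega)\in\mathbb{R}\times\mathbb{S}^1,$$ where $C_N,C_N'$ may depend on the initial data. Here $\partial_\omega=\omega_1\partial_{\omega_2}-\omega_2\partial_{\omega_1}$ is the angular derivative on $\mathbb{S}^1$. *)

(* Defs.v *)
From Stdlib Require Export Reals.
From Coquelicot Require Export Coquelicot.

Open Scope R_scope.

(** ** Coefficients of the equation [g^{ab}(u) d_a d_b u = 0] in R^{1+2} *)

(** Spacetime indices are the naturals 0, 1, 2; values at larger indices are
    never used. *)
Definition minkowski (a b : nat) : R :=
  if Nat.eqb a b then (if Nat.eqb a 0 then -1 else 1) else 0.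

(** [g0 a b] is the coefficient of [u^2] in the expansion of [g a b] at 0; it
    is determined by [g]. *)
Record wave_coefficients (g : nat -> nat -> R -> R) (g0 : nat -> nat -> R)
    : Prop := {
  coef_smooth : forall a b, (a <= 2)%nat -> (b <= 2)%nat ->
    forall n u, ex_derive_n (g a b) n u;
  coef_sym : forall a b, (a <= 2)%nat -> (b <= 2)%nat ->
    forall u, g a b u = g b a u;
  coef_00 : forall u, g 0%nat 0%nat u = -1;
  coef_expansion : forall a b, (a <= 2)%nat -> (b <= 2)%nat ->
    exists C : R, forall u, Rabs u <= 1 ->
      Rabs (g a b u - (minkowski a b + g0 a b * u ^ 2)) <= C * Rabs u ^ 3
}.

(** ** The unit circle

    Functions on the circle are functions on [R * R] of which only the values
    on the circle are ever used. *)
Definition circle (w : R * R) : Prop := fst w ^ 2 + snd w ^ 2 = 1.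

(** Rotation by the angle [t]: the flow of [w_1 d_{w_2} - w_2 d_{w_1}]. *)
Definition rot (t : R) (w : R * R) : R * R :=
  (cos t * fst w - sin t * snd w, sin t * fst w + cos t * snd w).

(** [(w_1 d_{w_2} - w_2 d_{w_1}) f = l] at the point [w]. *)
Definition is_derive_ang (f : R * R -> R) (w : R * R) (l : R) : Prop :=
  is_derive (fun t => f (rot t w)) 0 l.

Definition hat (w : R * R) (a : nat) : R :=
  match a with
  | O => -1
  | S O => fst w
  | _ => snd w
  end.

Definition G (g0 : nat -> nat -> R) (w : R * R) : R :=
  sum_f_R0 (fun a => sum_f_R0 (fun b => g0 a b * hat w a * hat w b) 2) 2.

(** ** Smooth functions on [0,oo) x R x S^1 and on R x S^1 *)

(** Derivative relative to the half-line [0,oo): two-sided for [0 < s],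
    one-sided at [s = 0]. *)
Definition is_derive_halfline (f : R -> R) (s l : R) : Prop :=
  filterdiff f (within (fun t => 0 <= t) (locally s)) (fun h => scal h l).

(** [f] is smooth on [0,oo) x R x S^1 (up to [s = 0]), and
    [D a b c = d_s^a d_q^b d_w^c f] there.  As [D] depends only on the numbers
    of derivatives of each kind, the derivatives commute. *)
Record smooth_with_partials (f : R -> R -> R * R -> R)
    (D : nat -> nat -> nat -> R -> R -> R * R -> R) : Prop := {
  partials_0 : forall s q w, 0 <= s -> circle w ->
    D 0%nat 0%nat 0%nat s q w = f s q w;
  partials_s : forall a b c s q w, 0 <= s -> circle w ->
    is_derive_halfline (fun s' => D a b c s' q w) s (D (S a) b c s q w);
  partials_q : forall a b c s q w, 0 <= s -> circle w ->
    is_derive (fun q' => D a b c s q' w) q (D a (S b) c s q w);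
  partials_w : forall a b c s q w, 0 <= s -> circle w ->
    is_derive_ang (fun w' => D a b c s q w') w (D a b (S c) s q w);
  partials_cont : forall a b c,
    continuous_on
      (fun p : R * R * (R * R) => 0 <= fst (fst p) /\ circle (snd p))
      (fun p : R * R * (R * R) => D a b c (fst (fst p)) (snd (fst p)) (snd p))
}.

(** The same on R x S^1, with [D b c = d_q^b d_w^c f]. *)
Record smooth_data_with_partials (f : R -> R * R -> R)
    (D : nat -> nat -> R -> R * R -> R) : Prop := {
  data_partials_0 : forall q w, circle w -> D 0%nat 0%nat q w = f q w;
  data_partials_q : forall b c q w, circle w ->
    is_derive (fun q' => D b c q' w) q (D (S b) c q w);
  data_partials_w : forall b c q w, circle w ->
    is_derive_ang (fun w' => D b c q w') w (D b (S c) q w);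
  data_partials_cont : forall b c,
    continuous_on (fun p : R * (R * R) => circle (snd p))
      (fun p : R * (R * R) => D b c (fst p) (snd p))
}.

(** [C_c^oo (R x S^1)]; since the circle is compact, the support is compact
    iff it is bounded in [q]. *)
Definition test_function (f : R -> R * R -> R) : Prop :=
  (exists D, smooth_data_with_partials f D) /\
  (exists M : R, forall q w, circle w -> M < Rabs q -> f q w = 0).

(** ** Geometric reduced system and geometric weak null condition *)

(** [Dmu], [DU] are the families of partial derivatives of [mu], [U]. *)
Definition solves_reduced_system (g0 : nat -> nat -> R)
    (mu U : R -> R -> R * R -> R)
    (Dmu DU : nat -> nat -> nat -> R -> R -> R * R -> R) : Prop :=
  forall s q w, 0 <= s -> circle w ->
    is_derive_halfline (fun s' => mu s' q w * DU 0%nat 1%nat 0%nat s' q w) s 0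
    /\ Dmu 1%nat 0%nat 0%nat s q w
       = / 2 * G g0 w * mu s q w ^ 2 * U s q w * DU 0%nat 1%nat 0%nat s q w.

(** The sum of [F a b c] over [lo <= a + b + c <= N]. *)
Definition sum_orders (lo N : nat) (F : nat -> nat -> nat -> R) : R :=
  sum_f_R0 (fun a => sum_f_R0 (fun b => sum_f_R0 (fun c =>
    if andb (Nat.leb lo (a + b + c)) (Nat.leb (a + b + c) N)
    then F a b c else 0) N) N) N.

(** Since [/ 0] is a real number here, finiteness of [|mu|^{-1}] has to be
    stated as [mu <> 0]. *)
Definition exp_growth (mu : R -> R -> R * R -> R)
    (Dmu DU : nat -> nat -> nat -> R -> R -> R * R -> R) : Prop :=
  forall N : nat, (1 <= N)%nat ->
  exists C C' : R, forall s q w, 0 <= s -> circle w ->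
    mu s q w <> 0 /\
    Rabs (mu s q w) + / Rabs (mu s q w)
      + sum_orders 1 N (fun a b c => Rabs (Dmu a b c s q w))
      + sum_orders 0 N (fun a b c => Rabs (DU a b c s q w))
    <= C' * exp (C * s).

Definition geometric_weak_null_condition (g0 : nat -> nat -> R) : Prop :=
  forall U0 : R -> R * R -> R, test_function U0 ->
  exists (mu U : R -> R -> R * R -> R)
         (Dmu DU : nat -> nat -> nat -> R -> R -> R * R -> R),
    smooth_with_partials mu Dmu /\
    smooth_with_partials U DU /\
    solves_reduced_system g0 mu U Dmu DU /\
    (forall q w, circle w -> mu 0 q w = -2) /\
    (forall q w, circle w -> U 0 q w = U0 q w) /\
    (forall s w, 0 <= s -> circle w ->
       is_lim (fun q => U s q w) p_infty 0) /\
    exp_growth mu Dmu DU.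

(* Main.v *)
Require Import Defs.
From Stdlib Require Import Lra Lia Psatz ClassicalEpsilon FunctionalExtensionality.

(** Put [B = d_q U|_{s=0}], supported in [|q| <= M], and [mu = -2 / h]. The first equation gives
    [U_q = B h], the second [h_s = G B U h = (G / 2) d_q (U^2)], so [h = exp (G B Phi)] where
    [Phi] is the primitive of [U] in [s] and solves [Phi_s = int_M^q B exp (G B Phi)].

    If [G >= 0], the mass of [h] on [[-M, M]] has derivative [- (G / 2) U(-M)^2 <= 0], so [|U|]
    stays below [K = 2 M sup |B|]. Picard iteration therefore suffices for the equation in which
    [U] and [Phi] are truncated at [K] and [K s]; the mass bound survives the truncation and
    shows that it is inactive. Regularity is measured by quadratic Taylor bounds with
    exponentially growing constants, which pass through integrals without differentiation under
    the integral sign. Derivatives of [Phi] solve linear equations [k_s = int_M^q e k + f] in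
    which [int |e|] is bounded uniformly in [s], so their growth is exponential.

    If [G(w) < 0], take for [U|_{s=0}] a bump which is nonincreasing in [q >= 0]. There [U >= 0],
    [U_q <= 0], and [d_q (U_s - c U^2) <= 0] for some [c > 0] on [[1/4, 1/2]], so
    [Y = U(1/4) - U(1/2)] satisfies [Y_s >= c Y^2] and blows up. *)

(* The obstacle is the rate. Since [|Phi| <= K s], the weight [h] is only known to grow at most
   exponentially in [s]; Gronwall with the supremum of the coefficient [e = G B ^ 2 h] of the
   linearised equation would give doubly exponential bounds for the derivatives of [Phi]. What stays
   bounded is the integral of [h] in [q], and the unknown enters only through an integral in [q];
   hence Gronwall is run with the supremum of the unknown against the [L^1] norm of [e]. Taking
   [Phi] rather than [U] as unknown gives an ordinary differential equation in [s] whose nonlocal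
   right-hand side contains no derivative of the unknown, solvable angle by angle. Nothing is then
   known in [w], so a derivative in [w] is found by solving the differentiated equation and showing
   that its solution matches the increment up to second order. The base point [M] of the integrals
   encodes [U -> 0] as [q -> oo]; to the left of the support [U] is constant in [q] but in general
   not zero. The two-sided bound on the exponent [G B Phi] controls [mu] and [1 / mu] together. *)
Tactic Notation "rle" uconstr(H) := eapply Rle_trans; [apply H |].

(** * Inequalities for the exponential and for truncation *)

Lemma exp_le (x y : R) : x <= y -> exp x <= exp y.
Proof. intros [H | ->]; [left; now apply exp_increasing | right; easy]. Qed.

Lemma exp_ge_1 (x : R) : 0 <= x -> 1 <= exp x.
Proof. intros H. rewrite <- exp_0. now apply exp_le. Qed.

Lemma exp_tangent (x : R) : 1 + x <= exp x.
Proof.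
destruct (Req_dec x 0) as [-> | H]; [rewrite exp_0; lra |].
now left; apply exp_ineq1.
Qed.

(** The tangent inequality at both points gives it. The symmetric factor avoids an intermediate
    point, and for the weight [h] it becomes the sum of its values at two angles, whose integral the
    mass bound controls. *)
Lemma exp_increment (x y : R) :
  Rabs (exp y - exp x) <= (exp x + exp y) * Rabs (y - x).
Proof.
assert (Hx := exp_tangent (y - x)).
assert (Hy := exp_tangent (x - y)).
assert (Ex := exp_pos x). assert (Ey := exp_pos y).
assert (H1 : exp y = exp x * exp (y - x)) by (rewrite <- exp_plus; f_equal; ring).
assert (H2 : exp x = exp y * exp (x - y)) by (rewrite <- exp_plus; f_equal; ring).
assert (L1 : exp x * (y - x) <= exp y - exp x) by nra.
assert (L2 : exp y * (x - y) <= exp x - exp y) by nra.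
unfold Rabs; destruct Rcase_abs; destruct Rcase_abs; nra.
Qed.

(** By convexity the remainder lies between [0] and [(exp y - exp x) * (y - x)]; then
    [exp_increment] applies. *)
Lemma exp_taylor (x y : R) :
  Rabs (exp y - exp x - exp x * (y - x)) <= (exp x + exp y) * (y - x) ^ 2.
Proof.
assert (Hx := exp_tangent (y - x)).
assert (Hy := exp_tangent (x - y)).
assert (Ex := exp_pos x). assert (Ey := exp_pos y).
assert (H1 : exp y = exp x * exp (y - x)) by (rewrite <- exp_plus; f_equal; ring).
assert (H2 : exp x = exp y * exp (x - y)) by (rewrite <- exp_plus; f_equal; ring).
assert (L1 : exp x * (y - x) <= exp y - exp x) by nra.
assert (L2 : exp y * (x - y) <= exp x - exp y) by nra.
rewrite Rabs_pos_eq by lra.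
assert (H := exp_increment x y).
replace ((y - x) ^ 2) with (Rabs (y - x) * Rabs (y - x)) by
  (rewrite <- (pow2_abs (y - x)); ring).
apply Rle_trans with ((exp y - exp x) * (y - x)); [nra |].
apply Rle_trans with (Rabs (exp y - exp x) * Rabs (y - x)).
{ rewrite <- Rabs_mult. apply Rle_abs. }
rewrite <- Rmult_assoc. apply Rmult_le_compat_r; [apply Rabs_pos | exact H].
Qed.

Definition clamp (c y : R) : R := Rmax (- c) (Rmin c y).

Lemma clamp_bound (c y : R) : 0 <= c -> Rabs (clamp c y) <= c.
Proof.
intros Hc. unfold clamp, Rmax, Rmin.
repeat destruct Rle_dec; apply Rabs_le; lra.
Qed.

Lemma clamp_id (c y : R) : Rabs y <= c -> clamp c y = y.
Proof.
intros H. apply Rabs_le_between in H. unfold clamp, Rmax, Rmin.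
repeat destruct Rle_dec; lra.
Qed.

(** The level varies as well because [Phi] is truncated at [K s], which moves with [s]. *)
Lemma clamp_lip (c c' y y' : R) :
  Rabs (clamp c y - clamp c' y') <= Rabs (c - c') + Rabs (y - y').
Proof.
unfold clamp, Rmax, Rmin, Rabs.
repeat destruct Rle_dec; repeat destruct Rcase_abs; lra.
Qed.

Lemma clamp_sign (c y : R) : 0 <= c -> 0 <= y * clamp c y.
Proof.
intros H. unfold clamp, Rmax, Rmin.
repeat destruct Rle_dec; nra.
Qed.

(** * Riemann integrals of Lipschitz functions *)

Definition lip_between (f : R -> R) (a b L : R) : Prop :=
  forall x y, Rmin a b <= x <= Rmax a b -> Rmin a b <= y <= Rmax a b ->
  Rabs (f x - f y) <= L * Rabs (x - y).

Lemma lip_continuous (f : R -> R) (L x : R) :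
  (forall y, Rabs (y - x) <= 1 -> Rabs (f y - f x) <= L * Rabs (y - x)) -> continuous f x.
Proof.
intros H.
apply (proj2 (filterlim_locally f (f x))). intros eps.
assert (HL : 0 < Rmax L 1) by (apply Rlt_le_trans with 1; [lra | apply Rmax_r]).
assert (Hd : 0 < eps / Rmax L 1) by (apply Rdiv_lt_0_compat; [apply cond_pos | easy]).
exists (mkposreal _ (Rmin_pos _ _ Hd Rlt_0_1)). intros y Hy. simpl in Hy.
change (Rabs (y - x) < Rmin (eps / Rmax L 1) 1) in Hy.
assert (H1 := Rmin_l (eps / Rmax L 1) 1). assert (H2 := Rmin_r (eps / Rmax L 1) 1).
change (Rabs (f y - f x) < eps).
apply Rle_lt_trans with (Rmax L 1 * Rabs (y - x)).
{ eapply Rle_trans; [apply H; lra |]. apply Rmult_le_compat_r; [apply Rabs_pos | apply Rmax_l]. }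
apply Rmult_lt_reg_l with (/ Rmax L 1); [now apply Rinv_0_lt_compat |].
rewrite <- Rmult_assoc, Rinv_l, Rmult_1_l by lra.
rewrite Rmult_comm. lra.
Qed.

Lemma ex_RInt_lip (f : R -> R) (a b L : R) : lip_between f a b L -> ex_RInt f a b.
Proof.
intros H.
(* [cl] is the projection onto the interval. As [f] is controlled only there, [f (cl x)] is used
   instead: it is continuous on all of [R], end points included. *)
set (cl := fun x => Rmax (Rmin a b) (Rmin (Rmax a b) x)).
assert (Hm : Rmin a b <= Rmax a b) by (eapply Rle_trans; [apply Rmin_l | apply Rmax_l]).
assert (Hcl : forall x, Rmin a b <= cl x <= Rmax a b).
{ intros x. unfold cl. generalize dependent (Rmin a b); intros u.
  generalize dependent (Rmax a b); intros v. clear. intros.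
  unfold Rmax, Rmin. repeat destruct Rle_dec; lra. }
assert (Hcl2 : forall x y, Rabs (cl x - cl y) <= Rabs (x - y)).
{ intros x y. unfold cl. generalize dependent (Rmin a b); intros u.
  generalize dependent (Rmax a b); intros v. clear. intros.
  unfold Rmax, Rmin, Rabs. repeat destruct Rle_dec; repeat destruct Rcase_abs; lra. }
apply ex_RInt_ext with (fun x => f (cl x)).
{ intros x Hx. f_equal. unfold cl. unfold Rmin at 2, Rmax at 1.
  repeat destruct Rle_dec; lra. }
apply (ex_RInt_continuous (V := R_CompleteNormedModule)). intros z _.
apply (lip_continuous (fun x => f (cl x)) (Rmax L 0)). intros x _.
eapply Rle_trans; [apply H; apply Hcl |].
eapply Rle_trans with (Rmax L 0 * Rabs (cl x - cl z)).
- apply Rmult_le_compat_r; [apply Rabs_pos | apply Rmax_l].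
- apply Rmult_le_compat_l; [apply Rmax_r | apply Hcl2].
Qed.

Lemma ex_RInt_add (f g : R -> R) (a b : R) : ex_RInt f a b -> ex_RInt g a b ->
  ex_RInt (fun x => f x + g x) a b.
Proof. exact (ex_RInt_plus (V := R_NormedModule) f g a b). Qed.

Lemma ex_RInt_sub (f g : R -> R) (a b : R) : ex_RInt f a b -> ex_RInt g a b ->
  ex_RInt (fun x => f x - g x) a b.
Proof. exact (ex_RInt_minus (V := R_NormedModule) f g a b). Qed.

Lemma ex_RInt_mul (f : R -> R) (c a b : R) : ex_RInt f a b -> ex_RInt (fun x => c * f x) a b.
Proof. exact (ex_RInt_scal (V := R_NormedModule) f a b c). Qed.

Lemma RInt_add (f g : R -> R) (a b : R) : ex_RInt f a b -> ex_RInt g a b ->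
  RInt (fun x => f x + g x) a b = RInt f a b + RInt g a b :> R.
Proof. intros Hf Hg. exact (RInt_plus f g a b Hf Hg). Qed.

Lemma RInt_sub (f g : R -> R) (a b : R) : ex_RInt f a b -> ex_RInt g a b ->
  RInt (fun x => f x - g x) a b = RInt f a b - RInt g a b :> R.
Proof. intros Hf Hg. exact (RInt_minus f g a b Hf Hg). Qed.

Lemma RInt_mul (f : R -> R) (c a b : R) : ex_RInt f a b ->
  RInt (fun x => c * f x) a b = c * RInt f a b :> R.
Proof. intros Hf. exact (RInt_scal f a b c Hf). Qed.

Lemma RInt_cut (f : R -> R) (a b c : R) : ex_RInt f a b -> ex_RInt f b c ->
  RInt f a c = RInt f a b + RInt f b c :> R.
Proof. intros H1 H2. symmetry. exact (RInt_Chasles f a b c H1 H2). Qed.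

Lemma RInt_constant (c a b : R) : RInt (fun _ => c) a b = (b - a) * c :> R.
Proof. exact (RInt_const a b c). Qed.

Lemma RInt_flip (f : R -> R) (a b : R) : ex_RInt f b a -> RInt f a b = - RInt f b a :> R.
Proof. intros H. symmetry. exact (opp_RInt_swap f b a H). Qed.

Lemma abs_RInt_le_bound (f : R -> R) (a b C : R) : ex_RInt f a b ->
  (forall x, Rmin a b <= x <= Rmax a b -> Rabs (f x) <= C) ->
  Rabs (RInt f a b) <= C * Rabs (b - a).
Proof.
intros Hf H.
destruct (Rle_dec a b) as [Hab | Hab].
- rewrite (Rabs_pos_eq (b - a)) by lra. rewrite Rmult_comm.
  apply abs_RInt_le_const; auto. intros t Ht. apply H.
  rewrite Rmin_left, Rmax_right by lra. lra.
- rewrite RInt_flip by now apply ex_RInt_swap.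
  rewrite Rabs_Ropp, Rabs_minus_sym, (Rabs_pos_eq (a - b)) by lra. rewrite Rmult_comm.
  apply abs_RInt_le_const; [lra | now apply ex_RInt_swap |]. intros t Ht. apply H.
  rewrite Rmin_right, Rmax_left by lra. lra.
Qed.

Lemma abs_RInt_le_RInt (f g : R -> R) (a b : R) : a <= b ->
  ex_RInt f a b -> ex_RInt g a b ->
  (forall x, a <= x <= b -> Rabs (f x) <= g x) ->
  Rabs (RInt f a b) <= RInt g a b.
Proof.
intros Hab Hf Hg H. apply Rabs_le. split.
- assert (E : RInt (fun x => -1 * g x) a b = - RInt g a b :> R) by (rewrite RInt_mul by easy; ring).
  rewrite <- E.
  apply RInt_le; auto.
  { now apply ex_RInt_mul. }
  intros x Hx. specialize (H x ltac:(lra)). apply Rabs_le_between in H. lra.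
- apply RInt_le; auto.
  intros x Hx. specialize (H x ltac:(lra)). apply Rabs_le_between in H. lra.
Qed.

Lemma RInt_nonneg (f : R -> R) (a b : R) : a <= b -> ex_RInt f a b ->
  (forall x, a <= x <= b -> 0 <= f x) -> 0 <= RInt f a b.
Proof.
intros Hab Hf H. assert (E : RInt (fun _ => 0) a b = 0 :> R) by (rewrite RInt_constant; ring).
rewrite <- E.
apply RInt_le; auto. { apply ex_RInt_const. } intros x Hx. apply H; lra.
Qed.

Lemma RInt_vanish (f : R -> R) (a b : R) :
  (forall x, Rmin a b < x < Rmax a b -> f x = 0) -> RInt f a b = 0 :> R.
Proof.
intros H. rewrite (RInt_ext f (fun _ => 0)) by exact H. rewrite RInt_constant. ring.
Qed.

(** Only the part of the path from [M] to [q] inside [[-M, M]] counts, so the bound is uniform in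
    [q]. This turns a bound on the mass of [h] into a bound on the supremum of [U]. *)
Lemma abs_RInt_supp (f g : R -> R) (M q : R) : 0 <= M ->
  (forall a b, ex_RInt f a b) -> ex_RInt g (- M) M ->
  (forall x, M < Rabs x -> f x = 0) ->
  (forall x, Rabs x <= M -> Rabs (f x) <= g x) ->
  Rabs (RInt f M q) <= RInt g (- M) M.
Proof.
intros HM Hf Hg H0 H.
assert (Hgp : forall x, -M <= x <= M -> 0 <= g x).
{ intros x Hx. eapply Rle_trans; [apply Rabs_pos | apply H; now apply Rabs_le]. }
assert (H' : forall x, -M <= x <= M -> Rabs (f x) <= g x).
{ intros x Hx. apply H; now apply Rabs_le. }
assert (Hin : forall r, -M <= r <= M -> Rabs (RInt f M r) <= RInt g (- M) M).
{ intros r Hr.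
  assert (G1 : ex_RInt g (-M) r).
  { apply (ex_RInt_Chasles_1 (V := R_CompleteNormedModule) g (-M) r M); [lra | easy]. }
  assert (G2 : ex_RInt g r M).
  { apply (ex_RInt_Chasles_2 (V := R_CompleteNormedModule) g (-M) r M); [lra | easy]. }
  rewrite RInt_flip, Rabs_Ropp by apply Hf.
  rewrite (RInt_cut g (-M) r M G1 G2).
  assert (0 <= RInt g (-M) r) by (apply RInt_nonneg; [lra | easy | intros; apply Hgp; lra]).
  assert (Rabs (RInt f r M) <= RInt g r M).
  { apply abs_RInt_le_RInt; [lra | apply Hf | easy | intros; apply H'; lra]. }
  lra. }
destruct (Rle_dec q (-M)) as [Hq | Hq]; [| destruct (Rle_dec q M) as [Hq' | Hq']].
- rewrite (RInt_cut f M (-M) q (Hf _ _) (Hf _ _)).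
  rewrite (RInt_vanish f (-M) q), Rplus_0_r.
  + apply Hin; lra.
  + intros x Hx. rewrite Rmin_right, Rmax_left in Hx by lra.
    apply H0. unfold Rabs; destruct Rcase_abs; lra.
- apply Hin; lra.
- rewrite RInt_vanish, Rabs_R0.
  + apply RInt_nonneg; [lra | easy | intros; apply Hgp; lra].
  + intros x Hx. rewrite Rmin_left, Rmax_right in Hx by lra.
    apply H0. unfold Rabs; destruct Rcase_abs; lra.
Qed.

Lemma RInt_exp_le (L s : R) : 0 < L -> 0 <= s ->
  RInt (fun x => exp (L * x)) 0 s <= / L * exp (L * s).
Proof.
intros HL Hs.
assert (H : is_RInt (fun x => exp (L * x)) 0 s (/ L * exp (L * s) - / L * exp (L * 0))).
{ apply (is_RInt_derive (V := R_CompleteNormedModule) (fun x => / L * exp (L * x))).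
  - intros x _. auto_derive; [easy |]. field. lra.
  - intros x _. apply (ex_derive_continuous (fun x => exp (L * x))). auto_derive. easy. }
rewrite (is_RInt_unique _ _ _ _ H).
rewrite Rmult_0_r, exp_0. assert (0 < / L) by now apply Rinv_0_lt_compat. lra.
Qed.

Lemma ex_RInt_exp (L a b : R) : ex_RInt (fun x => exp (L * x)) a b.
Proof.
apply (ex_RInt_continuous (V := R_CompleteNormedModule)). intros x _.
apply (ex_derive_continuous (fun x => exp (L * x))). auto_derive. easy.
Qed.

(* Subdividing [a, b] makes the total of the quadratic errors arbitrarily small. *)
Lemma quadratic_increment_nonpos (phi : R -> R) (a b C : R) : a <= b ->
  (forall x y, a <= x -> x <= y -> y <= b -> phi y - phi x <= C * (y - x) ^ 2) ->
  phi b <= phi a.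
Proof.
intros Hab H.
apply Rnot_lt_le. intros Hlt.
set (l := b - a).
assert (Hn : forall n : nat, (0 < n)%nat -> phi b - phi a <= Rabs C * l ^ 2 / INR n).
{ intros n Hn.
  assert (Hn' : 0 < INR n) by now apply lt_0_INR.
  assert (Hk : forall k, (k <= n)%nat ->
     phi (a + INR k * (l / INR n)) - phi a <= INR k * (Rabs C * (l / INR n) ^ 2)).
  { induction k as [| k IH]; intros Hk.
    - simpl. rewrite !Rmult_0_l, Rplus_0_r. lra.
    - specialize (IH ltac:(lia)).
      assert (Hl : 0 <= l / INR n) by (apply Rdiv_le_0_compat; unfold l; lra).
      assert (Hkn : INR (S k) * (l / INR n) <= l).
      { apply Rle_trans with (INR n * (l / INR n)).
        - apply Rmult_le_compat_r; [easy | now apply le_INR].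
        - right. field. lra. }
      assert (Hk0 := pos_INR k).
      rewrite S_INR in *.
      specialize (H (a + INR k * (l / INR n)) (a + (INR k + 1) * (l / INR n))).
      assert (Hpos : 0 <= INR k * (l / INR n)) by now apply Rmult_le_pos.
      specialize (H ltac:(lra) ltac:(lra) ltac:(unfold l in *; lra)).
      replace (a + (INR k + 1) * (l / INR n) - (a + INR k * (l / INR n)))
        with (l / INR n) in H by ring.
      assert (C * (l / INR n) ^ 2 <= Rabs C * (l / INR n) ^ 2).
      { apply Rmult_le_compat_r; [apply pow2_ge_0 | apply Rle_abs]. }
      lra. }
  specialize (Hk n (le_n n)).
  replace (a + INR n * (l / INR n)) with b in Hk by (unfold l; field; lra).
  replace (INR n * (Rabs C * (l / INR n) ^ 2)) with (Rabs C * l ^ 2 / INR n) in Hk by (field; lra).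
  easy. }
set (A := Rabs C * l ^ 2) in *.
assert (HA : 0 <= A) by (apply Rmult_le_pos; [apply Rabs_pos | apply pow2_ge_0]).
destruct (INR_unbounded (A / (phi b - phi a) + 1)) as [n Hn2].
assert (Hq : 0 <= A / (phi b - phi a)) by (apply Rdiv_le_0_compat; lra).
assert (Hn0 : (0 < n)%nat) by (apply INR_lt; simpl; lra).
specialize (Hn n Hn0).
assert (Hn' : 0 < INR n) by now apply lt_0_INR.
apply (Rmult_le_compat_r (INR n)) in Hn; [| lra].
replace (A / INR n * INR n) with A in Hn by (field; lra).
assert (A < (phi b - phi a) * INR n).
{ apply Rmult_lt_reg_r with (/ (phi b - phi a)); [apply Rinv_0_lt_compat; lra |].
  replace ((phi b - phi a) * INR n * / (phi b - phi a)) with (INR n) by (field; lra).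
  unfold Rdiv in *. lra. }
lra.
Qed.

(** * Functions of [(s, q)] that are locally Lipschitz on [s >= 0] *)

(** One radius bounds both variables and one constant serves for size and slope. The class is closed
    under products, [exp], truncation and both integrations, and it ensures integrability in each
    variable. *)
Definition reg2 (f : R -> R -> R) : Prop :=
  forall T, exists L, 0 <= L /\
  (forall s q, 0 <= s <= T -> Rabs q <= T -> Rabs (f s q) <= L) /\
  (forall s s' q q', 0 <= s <= T -> 0 <= s' <= T -> Rabs q <= T -> Rabs q' <= T ->
    Rabs (f s q - f s' q') <= L * (Rabs (s - s') + Rabs (q - q'))).

(** The base point is the right end of the support: for [f] supported in [|q| <= M] the primitive
    vanishes for [q >= M], which is the condition at [q -> oo]. *)
Definition int_q (M : R) (f : R -> R -> R) (s q : R) : R := RInt (f s) M q.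
Definition int_s (f : R -> R -> R) (s q : R) : R := RInt (fun r => f r q) 0 s.

Lemma Rabs_between (a b x : R) : Rmin a b <= x <= Rmax a b ->
  Rabs x <= Rmax (Rabs a) (Rabs b).
Proof.
unfold Rmax, Rmin, Rabs.
repeat destruct Rle_dec; repeat destruct Rcase_abs; lra.
Qed.

Lemma reg2_ex_q (f : R -> R -> R) (s a b : R) : reg2 f -> 0 <= s -> ex_RInt (f s) a b.
Proof.
intros Hf Hs.
destruct (Hf (Rmax s (Rmax (Rabs a) (Rabs b)))) as (L & HL & _ & H).
apply ex_RInt_lip with L. intros x y Hx Hy.
apply Rabs_between in Hx, Hy.
assert (H1 := Rmax_l s (Rmax (Rabs a) (Rabs b))).
assert (H2 := Rmax_r s (Rmax (Rabs a) (Rabs b))).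
specialize (H s s x y). rewrite Rminus_diag, Rabs_R0, Rplus_0_l in H.
apply H; lra.
Qed.

Lemma reg2_ex_s (f : R -> R -> R) (q a b : R) : reg2 f -> 0 <= a -> 0 <= b ->
  ex_RInt (fun s => f s q) a b.
Proof.
intros Hf Ha Hb.
destruct (Hf (Rmax (Rabs q) (Rmax a b))) as (L & HL & _ & H).
apply ex_RInt_lip with L. intros x y Hx Hy.
assert (H1 := Rmax_l (Rabs q) (Rmax a b)).
assert (H2 := Rmax_r (Rabs q) (Rmax a b)).
assert (H3 : 0 <= Rmin a b) by now apply Rmin_glb.
specialize (H x y q q). rewrite (Rminus_diag q), Rabs_R0, Rplus_0_r in H.
apply H; lra.
Qed.

Lemma reg2_const (c : R) : reg2 (fun _ _ => c).
Proof.
intros T. exists (Rabs c). split; [apply Rabs_pos | split; [intros; lra |]].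
intros. rewrite Rminus_diag, Rabs_R0. apply Rmult_le_pos; [apply Rabs_pos |].
assert (H3 := Rabs_pos (s - s')). assert (H4 := Rabs_pos (q - q')). lra.
Qed.

Lemma reg2_ext (f g : R -> R -> R) :
  (forall s q, 0 <= s -> f s q = g s q) -> reg2 f -> reg2 g.
Proof.
intros E Hf T. destruct (Hf T) as (L & HL & H1 & H2). exists L. split; [easy | split].
- intros s q Hs Hq. rewrite <- E by lra. auto.
- intros. rewrite <- !E by lra. auto.
Qed.

Lemma reg2_plus (f g : R -> R -> R) : reg2 f -> reg2 g -> reg2 (fun s q => f s q + g s q).
Proof.
intros Hf Hg T. destruct (Hf T) as (L & HL & F1 & F2). destruct (Hg T) as (L' & HL' & G1 & G2).
exists (L + L'). split; [lra | split].
- intros s q Hs Hq. rle Rabs_triang.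
  apply Rplus_le_compat; auto.
- intros s s' q q' Hs Hs' Hq Hq'.
  replace (f s q + g s q - (f s' q' + g s' q'))
    with ((f s q - f s' q') + (g s q - g s' q')) by ring.
  rle Rabs_triang.
  specialize (F2 s s' q q' Hs Hs' Hq Hq'). specialize (G2 s s' q q' Hs Hs' Hq Hq'). lra.
Qed.

Lemma reg2_mult (f g : R -> R -> R) : reg2 f -> reg2 g -> reg2 (fun s q => f s q * g s q).
Proof.
intros Hf Hg T. destruct (Hf T) as (L & HL & F1 & F2). destruct (Hg T) as (L' & HL' & G1 & G2).
exists (2 * L * L' + L * L'). split; [nra | split].
- intros s q Hs Hq. rewrite Rabs_mult.
  apply Rle_trans with (L * L'); [| nra].
  apply Rmult_le_compat; auto using Rabs_pos.
- intros s s' q q' Hs Hs' Hq Hq'.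
  replace (f s q * g s q - f s' q' * g s' q')
    with ((f s q - f s' q') * g s q + f s' q' * (g s q - g s' q')) by ring.
  rle Rabs_triang. rewrite !Rabs_mult.
  specialize (F2 s s' q q' Hs Hs' Hq Hq'). specialize (G2 s s' q q' Hs Hs' Hq Hq').
  specialize (G1 s q Hs Hq). specialize (F1 s' q' Hs' Hq').
  set (d := Rabs (s - s') + Rabs (q - q')) in *.
  assert (Hd : 0 <= d).
  { assert (H3 := Rabs_pos (s - s')). assert (H4 := Rabs_pos (q - q')). unfold d; lra. }
  assert (Rabs (f s q - f s' q') * Rabs (g s q) <= (L * d) * L')
    by (apply Rmult_le_compat; auto using Rabs_pos).
  assert (Rabs (f s' q') * Rabs (g s q - g s' q') <= L * (L' * d))
    by (apply Rmult_le_compat; auto using Rabs_pos).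
  assert (0 <= L * L') by nra. assert (0 <= L * L' * d) by nra. lra.
Qed.

Lemma reg2_scal (c : R) (f : R -> R -> R) : reg2 f -> reg2 (fun s q => c * f s q).
Proof. intros Hf. apply (reg2_mult (fun _ _ => c)); [apply reg2_const | easy]. Qed.

Lemma reg2_minus (f g : R -> R -> R) : reg2 f -> reg2 g -> reg2 (fun s q => f s q - g s q).
Proof.
intros Hf Hg. apply reg2_ext with (fun s q => f s q + (-1) * g s q); [intros; ring |].
apply reg2_plus; [easy | now apply reg2_scal].
Qed.

Lemma reg2_exp (f : R -> R -> R) : reg2 f -> reg2 (fun s q => exp (f s q)).
Proof.
intros Hf T. destruct (Hf T) as (L & HL & F1 & F2).
assert (He := exp_pos L).
exists (exp L + 2 * exp L * L). split; [nra | split].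
- intros s q Hs Hq. rewrite Rabs_pos_eq by (left; apply exp_pos).
  apply Rle_trans with (exp L); [| nra]. apply exp_le.
  eapply Rle_trans; [apply Rle_abs | auto].
- intros s s' q q' Hs Hs' Hq Hq'.
  rle exp_increment.
  assert (exp (f s q) <= exp L) by (apply exp_le; eapply Rle_trans; [apply Rle_abs | auto]).
  assert (exp (f s' q') <= exp L) by (apply exp_le; eapply Rle_trans; [apply Rle_abs | auto]).
  specialize (F2 s s' q q' Hs Hs' Hq Hq').
  set (d := Rabs (s - s') + Rabs (q - q')) in *.
  assert (Hd : 0 <= d).
  { assert (H3 := Rabs_pos (s - s')). assert (H4 := Rabs_pos (q - q')). unfold d; lra. }
  apply Rle_trans with ((2 * exp L) * (L * d)); [| nra].
  apply Rmult_le_compat; auto using Rabs_pos; [| lra].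
  assert (H5 := exp_pos (f s q)). assert (H6 := exp_pos (f s' q')). lra.
Qed.

Lemma reg2_abs (f : R -> R -> R) : reg2 f -> reg2 (fun s q => Rabs (f s q)).
Proof.
intros Hf T. destruct (Hf T) as (L & HL & F1 & F2). exists L. split; [easy | split].
- intros. rewrite Rabs_Rabsolu. auto.
- intros. eapply Rle_trans; [apply Rabs_triang_inv2 | auto].
Qed.

(** The argument [k * s] allows a truncation level that grows with [s]; a fixed level is the case
    [k = 0] with a [chi] that ignores its first argument. *)
Lemma reg2_lip_comp (f : R -> R -> R) (chi : R -> R -> R) :
  (forall c c' y y', Rabs (chi c y - chi c' y') <= Rabs (c - c') + Rabs (y - y')) ->
  forall k, 0 <= k -> reg2 f -> reg2 (fun s q => chi (k * s) (f s q)).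
Proof.
intros Hchi k Hk Hf T. destruct (Hf T) as (L & HL & F1 & F2).
exists (Rabs (chi 0 0) + k * Rabs T + L + k).
assert (H0 := Rabs_pos (chi 0 0)). assert (HT := Rabs_pos T).
assert (HkT : 0 <= k * Rabs T) by nra.
split; [lra | split].
- intros s q Hs Hq.
  assert (H1 := Hchi (k * s) 0 (f s q) 0). rewrite !Rminus_0_r in H1.
  specialize (F1 s q Hs Hq).
  assert (Rabs (k * s) <= k * Rabs T).
  { rewrite Rabs_mult, (Rabs_pos_eq k) by easy. apply Rmult_le_compat_l; [easy |].
    rewrite !Rabs_pos_eq; lra. }
  assert (H2 := Rabs_triang (chi (k * s) (f s q) - chi 0 0) (chi 0 0)).
  replace (chi (k * s) (f s q) - chi 0 0 + chi 0 0) with (chi (k * s) (f s q)) in H2 by ring.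
  lra.
- intros s s' q q' Hs Hs' Hq Hq'.
  rle Hchi.
  specialize (F2 s s' q q' Hs Hs' Hq Hq').
  rewrite <- Rmult_minus_distr_l, Rabs_mult, (Rabs_pos_eq k) by easy.
  assert (H3 := Rabs_pos (s - s')). assert (H4 := Rabs_pos (q - q')). nra.
Qed.

Lemma reg2_clamp (f : R -> R -> R) (k : R) : 0 <= k -> reg2 f ->
  reg2 (fun s q => clamp (k * s) (f s q)).
Proof. intros Hk. apply reg2_lip_comp; [apply clamp_lip | easy]. Qed.

Lemma reg2_clamp_const (f : R -> R -> R) (k : R) : reg2 f -> reg2 (fun s q => clamp k (f s q)).
Proof.
intros Hf. apply (reg2_lip_comp f (fun _ y => clamp k y)) with 0; [| lra | easy].
intros. assert (H := clamp_lip k k y y'). rewrite Rminus_diag, Rabs_R0 in H.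
assert (H0 := Rabs_pos (c - c')). lra.
Qed.

Lemma reg2_of_q (b : R -> R) (L : R) : (forall q, Rabs (b q) <= L) ->
  (forall q q', Rabs (b q - b q') <= L * Rabs (q - q')) -> reg2 (fun _ q => b q).
Proof.
intros H1 H2 T. exists L. split; [| split; [auto |]].
- eapply Rle_trans; [apply Rabs_pos | apply (H1 0)].
- intros s s' q q' _ _ _ _. rle H2.
  assert (0 <= L) by (eapply Rle_trans; [apply Rabs_pos | apply (H1 0)]).
  assert (H3 := Rabs_pos (s - s')). assert (H4 := Rabs_pos (q - q')). nra.
Qed.

Lemma reg2_int_q (M : R) (f : R -> R -> R) : reg2 f -> reg2 (int_q M f).
Proof.
intros Hf T. set (T' := Rmax T (Rabs M)).
destruct (Hf T') as (L & HL & F1 & F2).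
assert (T1 := Rmax_l T (Rabs M)). assert (T2 := Rmax_r T (Rabs M)). fold T' in T1, T2.
assert (HM := Rabs_pos M).
assert (Hbt : forall a b x, Rabs a <= T' -> Rabs b <= T' -> Rmin a b <= x <= Rmax a b -> Rabs x <= T').
{ intros a b x Ha Hb Hx. rle (Rabs_between _ _ _ Hx). now apply Rmax_lub. }
exists (L + 2 * L * T'). split; [nra | split]; unfold int_q.
- intros s q Hs Hq. eapply Rle_trans.
  + apply abs_RInt_le_bound with (C := L); [apply reg2_ex_q; [easy | lra] |].
    intros x Hx. apply F1; [lra |]. apply (Hbt M q); auto; lra.
  + assert (Rabs (q - M) <= 2 * T').
    { rle Rabs_triang. rewrite Rabs_Ropp. lra. }
    nra.
- intros s s' q q' Hs Hs' Hq Hq'.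
  assert (X1 := reg2_ex_q f s M q Hf (proj1 Hs)).
  assert (X2 := reg2_ex_q f s' M q Hf (proj1 Hs')).
  assert (X3 := reg2_ex_q f s' q q' Hf (proj1 Hs')).
  rewrite (RInt_cut (f s') M q q') by easy.
  replace (RInt (f s) M q - (RInt (f s') M q + RInt (f s') q q'))
    with ((RInt (f s) M q - RInt (f s') M q) - RInt (f s') q q') by ring.
  rewrite <- RInt_sub by easy.
  rle Rabs_triang. rewrite Rabs_Ropp.
  assert (B1 : Rabs (RInt (fun x => f s x - f s' x) M q) <= (L * Rabs (s - s')) * Rabs (q - M)).
  { apply abs_RInt_le_bound; [now apply ex_RInt_sub |].
    intros x Hx. specialize (F2 s s' x x). rewrite (Rminus_diag x), Rabs_R0, Rplus_0_r in F2.
    assert (Rabs x <= T') by (apply (Hbt M q); auto; lra). apply F2; lra. }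
  assert (B2 : Rabs (RInt (f s') q q') <= L * Rabs (q' - q)).
  { apply abs_RInt_le_bound; [easy |].
    intros x Hx. apply F1; [lra |]. apply (Hbt q q'); auto; lra. }
  rewrite (Rabs_minus_sym q' q) in B2.
  assert (Rabs (q - M) <= 2 * T').
  { rle Rabs_triang. rewrite Rabs_Ropp. lra. }
  assert (H3 := Rabs_pos (s - s')). assert (H4 := Rabs_pos (q - q')).
  assert (0 <= L * Rabs (s - s')) by nra.
  assert (0 <= L * Rabs (q - q')) by nra.
  assert (L * Rabs (s - s') * Rabs (q - M) <= L * Rabs (s - s') * (2 * T')) by
    (apply Rmult_le_compat_l; lra).
  assert (0 <= 2 * T' * (L * Rabs (q - q'))) by nra.
  lra.
Qed.

(** The constants [b] and [c] concern the integrand only, so the estimate can be made uniform along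
    the Picard iterates. *)
Lemma int_s_lip (F : R -> R -> R) (T b c s s' q q' : R) : reg2 F -> 0 <= b -> 0 <= c ->
  0 <= s <= T -> 0 <= s' <= T ->
  (forall r, 0 <= r <= T -> Rabs (F r q') <= b) ->
  (forall r, 0 <= r <= T -> Rabs (F r q - F r q') <= c * Rabs (q - q')) ->
  Rabs (int_s F s q - int_s F s' q') <= b * Rabs (s - s') + T * c * Rabs (q - q').
Proof.
intros HF Hb Hc Hs Hs' H1 H2. unfold int_s.
assert (X1 := reg2_ex_s F q 0 s HF ltac:(lra) (proj1 Hs)).
assert (X2 := reg2_ex_s F q' 0 s HF ltac:(lra) (proj1 Hs)).
assert (X3 := reg2_ex_s F q' s s' HF (proj1 Hs) (proj1 Hs')).
rewrite (RInt_cut (fun r => F r q') 0 s s') by easy.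
replace (RInt (fun r => F r q) 0 s - (RInt (fun r => F r q') 0 s + RInt (fun r => F r q') s s'))
  with ((RInt (fun r => F r q) 0 s - RInt (fun r => F r q') 0 s) - RInt (fun r => F r q') s s') by ring.
rewrite <- RInt_sub by easy.
rle Rabs_triang. rewrite Rabs_Ropp.
assert (B1 : Rabs (RInt (fun x => F x q - F x q') 0 s) <= (c * Rabs (q - q')) * Rabs (s - 0)).
{ apply abs_RInt_le_bound; [now apply ex_RInt_sub |].
  intros x Hx. rewrite Rmin_left, Rmax_right in Hx by lra. apply H2; lra. }
assert (B2 : Rabs (RInt (fun r => F r q') s s') <= b * Rabs (s' - s)).
{ apply abs_RInt_le_bound; [easy |].
  intros x Hx. apply H1.
  revert Hx. unfold Rmin, Rmax. repeat destruct Rle_dec; lra. }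
rewrite (Rabs_minus_sym s' s) in B2.
rewrite Rminus_0_r, (Rabs_pos_eq s) in B1 by lra.
assert (0 <= c * Rabs (q - q')) by (apply Rmult_le_pos; [easy | apply Rabs_pos]).
nra.
Qed.

Lemma reg2_int_s (f : R -> R -> R) : reg2 f -> reg2 (int_s f).
Proof.
intros Hf T.
destruct (Hf T) as (L & HL & F1 & F2).
assert (HT := Rabs_pos T). assert (0 <= L * Rabs T) by nra.
exists (L + L * Rabs T). split; [lra | split].
- intros s q Hs Hq. unfold int_s. eapply Rle_trans.
  + apply abs_RInt_le_bound with (C := L); [apply reg2_ex_s; lra || easy |].
    intros x Hx. rewrite Rmin_left, Rmax_right in Hx by lra. apply F1; lra.
  + rewrite Rminus_0_r, (Rabs_pos_eq s) by lra. assert (s <= Rabs T) by (rewrite Rabs_pos_eq; lra).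
    nra.
- intros s s' q q' Hs Hs' Hq Hq'.
  eapply Rle_trans; [apply (int_s_lip f T L L); auto |].
  + intros r Hr. specialize (F2 r r q q' Hr Hr Hq Hq').
    now rewrite Rminus_diag, Rabs_R0, Rplus_0_l in F2.
  + assert (H3 := Rabs_pos (s - s')). assert (H4 := Rabs_pos (q - q')).
    assert (T <= Rabs T) by apply Rle_abs.
    assert (0 <= L * Rabs (q - q')) by nra. nra.
Qed.

Lemma reg2_le_bound (f : R -> R -> R) (T : R) : reg2 f ->
  exists L, 0 <= L /\ forall s q, 0 <= s <= T -> Rabs q <= T -> Rabs (f s q) <= L.
Proof. intros Hf. destruct (Hf T) as (L & HL & H & _). now exists L. Qed.

(** * Picard iteration for a nonlocal equation *)

Lemma le_geometric_eq_0 (a C : R) : (forall n, Rabs a <= C * (/ 2) ^ n) -> a = 0.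
Proof.
intros H.
destruct (Req_dec a 0) as [E | E]; [easy | exfalso].
assert (Ha := Rabs_pos_lt a E).
assert (HC : 0 < C) by (specialize (H 0%nat); simpl in H; lra).
destruct (pow_lt_1_zero (/ 2) ltac:(rewrite Rabs_pos_eq; lra) (Rabs a / C)
  ltac:(now apply Rdiv_lt_0_compat)) as [N HN].
specialize (HN N (le_n N)). specialize (H N).
rewrite Rabs_pos_eq in HN by (apply pow_le; lra).
apply (Rmult_lt_compat_l C) in HN; [| easy].
replace (C * (Rabs a / C)) with (Rabs a) in HN by (field; lra). lra.
Qed.

Lemma geometric_cauchy (u : nat -> R) (D : R) :
  (forall n, Rabs (u (S n) - u n) <= D * (/ 2) ^ n) ->
  exists l, forall n, Rabs (l - u n) <= 2 * D * (/ 2) ^ n.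
Proof.
intros H.
assert (HD : 0 <= D).
{ rle Rabs_pos. specialize (H 0%nat). simpl in H. rewrite Rmult_1_r in H. exact H. }
(* The exact value of the finite geometric sum on the right makes the induction on [p] close. *)
assert (Hp : forall n p, Rabs (u (n + p)%nat - u n) <= 2 * D * (/ 2) ^ n - 2 * D * (/ 2) ^ (n + p)).
{ intros n. induction p as [| p IH].
  - rewrite Nat.add_0_r, Rminus_diag, Rabs_R0. lra.
  - rewrite Nat.add_succ_r.
    replace (u (S (n + p)) - u n) with ((u (S (n + p)) - u (n + p)%nat) + (u (n + p)%nat - u n)) by ring.
    rle Rabs_triang. specialize (H (n + p)%nat). simpl. lra. }
assert (Hp' : forall n p, Rabs (u (n + p)%nat - u n) <= 2 * D * (/ 2) ^ n).
{ intros n p. rle Hp.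
  assert (0 <= D * (/ 2) ^ (n + p)) by (apply Rmult_le_pos; [easy | apply pow_le; lra]). lra. }
assert (Hl : ex_finite_lim_seq u).
{ apply ex_lim_seq_cauchy_corr. intros eps.
  assert (He : 0 < eps / (4 * D + 1)) by (apply Rdiv_lt_0_compat; [apply cond_pos | lra]).
  destruct (pow_lt_1_zero (/ 2) ltac:(rewrite Rabs_pos_eq; lra) _ He) as [N HN].
  exists N.
  assert (HH : forall m, (N <= m)%nat -> Rabs (u m - u N) <= 2 * D * (/ 2) ^ N).
  { intros m Hm. replace m with (N + (m - N))%nat by lia. apply Hp'. }
  intros n m Hn Hm.
  replace (u n - u m) with ((u n - u N) - (u m - u N)) by ring.
  eapply Rle_lt_trans; [apply Rabs_triang |]. rewrite Rabs_Ropp.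
  apply HH in Hn, Hm. specialize (HN N (le_n N)).
  rewrite Rabs_pos_eq in HN by (apply pow_le; lra).
  assert ((4 * D + 1) * (/ 2) ^ N < eps).
  { apply (Rmult_lt_compat_l (4 * D + 1)) in HN; [| lra].
    replace ((4 * D + 1) * (eps / (4 * D + 1))) with (pos eps) in HN by (field; lra). easy. }
  assert (0 <= (/ 2) ^ N) by (apply pow_le; lra). lra. }
destruct Hl as [l Hl]. exists l. intros n.
assert (Hln : is_lim_seq (fun p => Rabs (u (p + n)%nat - u n)) (Rabs (l - u n))).
{ apply (is_lim_seq_abs (fun p => u (p + n)%nat - u n) (Finite (l - u n))).
  apply is_lim_seq_minus'; [now apply is_lim_seq_incr_n | apply is_lim_seq_const]. }
assert (Hle := is_lim_seq_le _ _ _ _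
  (fun p => eq_ind _ (fun m => Rabs (u m - u n) <= _) (Hp' n p) _ (Nat.add_comm n p))
  Hln (is_lim_seq_const _)).
exact Hle.
Qed.

(** Integration in [s] gains the factor [1 / L] in the norm weighted by [exp (- L s)]. A large [L]
    therefore yields a contraction on an interval of any length. *)
Lemma int_s_exp_bound (F : R -> R -> R) (C L s q : R) : reg2 F -> 0 < L -> 0 <= s ->
  (forall r, 0 <= r <= s -> Rabs (F r q) <= C * exp (L * r)) ->
  Rabs (int_s F s q) <= C / L * exp (L * s).
Proof.
intros HF HL Hs H. unfold int_s.
assert (HC : 0 <= C).
{ specialize (H 0 ltac:(lra)). rewrite Rmult_0_r, exp_0 in H. assert (H' := Rabs_pos (F 0 q)). lra. }
eapply Rle_trans.
- apply abs_RInt_le_RInt with (g := fun r => C * exp (L * r)); [easy | apply reg2_ex_s; lra || easy | | exact H].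
  apply ex_RInt_mul. apply ex_RInt_exp.
- rewrite RInt_mul by apply ex_RInt_exp. unfold Rdiv. rewrite Rmult_assoc.
  apply Rmult_le_compat_l; [easy |]. now apply RInt_exp_le.
Qed.

(** The right-hand side of [k_s = chi (int_M^q E (s, x, k) dx) + f]; [chi] is a truncation for the
    profile equation and the identity for linear equations. *)
Definition picard_op (M : R) (chi : R -> R) (E : R -> R -> R -> R) (f k : R -> R -> R)
    : R -> R -> R :=
  fun s q => chi (int_q M (fun s x => E s x (k s x)) s q) + f s q.

(** As [E] vanishes for [|x| > M], the integral in [q] costs only a factor [2 M], whatever [q] is,
    and the map is a contraction in a weighted supremum norm. The Lipschitz constant of [E] may
    depend on [T]: the estimates are made on each [[0, T]] for one and the same sequence of
    iterates. *)
Lemma picard (M : R) (chi : R -> R) (E : R -> R -> R -> R) (f : R -> R -> R) :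
  0 <= M ->
  (forall y y', Rabs (chi y - chi y') <= Rabs (y - y')) ->
  (forall k, reg2 k -> reg2 (fun s x => E s x (k s x))) ->
  (forall s x y, 0 <= s -> M < Rabs x -> E s x y = 0) ->
  (forall T, exists L, 0 <= L /\ forall s x y y', 0 <= s <= T -> Rabs x <= M ->
     Rabs (E s x y - E s x y') <= L * Rabs (y - y')) ->
  reg2 f ->
  exists k, reg2 k /\ forall s q, 0 <= s -> k s q = int_s (picard_op M chi E f k) s q.
Proof.
intros HM Hchi HE Hsupp HL Hf.
set (N := picard_op M chi E f).
assert (RN : forall k, reg2 k -> reg2 (N k)).
{ intros k Hk. apply reg2_plus; [| easy].
  apply (reg2_lip_comp (int_q M (fun s x => E s x (k s x))) (fun _ y => chi y)) with 0; [| lra |].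
  - intros c c' y y'. specialize (Hchi y y'). assert (H := Rabs_pos (c - c')). lra.
  - now apply reg2_int_q, HE. }
assert (Ib : forall k s q b, reg2 k -> 0 <= s ->
  (forall x, Rabs x <= M -> Rabs (E s x (k s x)) <= b) ->
  Rabs (int_q M (fun s x => E s x (k s x)) s q) <= 2 * M * b).
{ intros k s q b Hk Hs Hb. unfold int_q.
  rle (abs_RInt_supp _ (fun _ => b)); auto.
  - intros a c. now apply (reg2_ex_q (fun s x => E s x (k s x))); [apply HE |].
  - apply ex_RInt_const.
  - rewrite RInt_constant. lra. }
assert (Id : forall k k' s q b, reg2 k -> reg2 k' -> 0 <= s ->
  (forall x, Rabs x <= M -> Rabs (E s x (k s x) - E s x (k' s x)) <= b) ->
  Rabs (N k s q - N k' s q) <= 2 * M * b).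
{ intros k k' s q b Hk Hk' Hs Hb. unfold N, picard_op.
  match goal with |- Rabs (?a + ?c - (?b + ?c)) <= _ => replace (a + c - (b + c)) with (a - b) by ring end.
  rle Hchi. unfold int_q.
  rewrite <- RInt_sub by (apply (reg2_ex_q (fun s x => E s x (_ s x))); [now apply HE | easy]).
  rle (abs_RInt_supp _ (fun _ => b)); auto.
  - intros a c. apply (reg2_ex_q (fun s x => E s x (k s x) - E s x (k' s x))); [| easy].
    now apply reg2_minus; apply HE.
  - apply ex_RInt_const.
  - intros x Hx. rewrite !Hsupp by lra. ring.
  - rewrite RInt_constant. lra. }
assert (Hcon : forall T, exists L, 0 < L /\ forall k k' D, reg2 k -> reg2 k' ->
  (forall s x, 0 <= s <= T -> Rabs x <= M -> Rabs (k s x - k' s x) <= D * exp (L * s)) ->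
  forall s q, 0 <= s <= T ->
  Rabs (int_s (N k) s q - int_s (N k') s q) <= D * / 2 * exp (L * s)).
(* One step of the map costs [2 M L] and the integration in [s] gains [1 / (4 M L + 1)], so the
   factor is at most [1 / 2]. *)
{ intros T. destruct (HL T) as (L & HL0 & HLT). exists (4 * M * L + 1).
  assert (HML : 0 <= M * L) by nra.
  split; [lra |]. intros k k' D Hk Hk' HD s q Hs.
  assert (HD0 : 0 <= D).
  { specialize (HD 0 0 ltac:(lra) ltac:(rewrite Rabs_R0; lra)). rewrite Rmult_0_r, exp_0 in HD.
    assert (H := Rabs_pos (k 0 0 - k' 0 0)). lra. }
  unfold int_s. rewrite <- RInt_sub by (apply reg2_ex_s; lra || auto).
  eapply Rle_trans.
  - apply (int_s_exp_bound (fun r q => N k r q - N k' r q) (2 * M * L * D) (4 * M * L + 1)); try lra.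
    + apply reg2_minus; auto.
    + intros r Hr. replace (2 * M * L * D * exp ((4 * M * L + 1) * r))
        with (2 * M * (L * (D * exp ((4 * M * L + 1) * r)))) by ring.
      apply Id; auto; [lra |]. intros x Hx.
      eapply Rle_trans; [apply HLT; lra |].
      apply Rmult_le_compat_l; [easy |]. apply HD; lra.
  - apply Rmult_le_compat_r; [left; apply exp_pos |].
    apply Rmult_le_reg_r with (4 * M * L + 1); [lra |].
    unfold Rdiv. rewrite Rmult_assoc, Rinv_l, Rmult_1_r by lra.
    assert (0 <= M * L * D) by nra. lra. }
set (it := fix it n := match n with O => fun _ _ => 0 | S n => int_s (N (it n)) end).
assert (Rit : forall n, reg2 (it n)).
{ induction n; simpl; [apply reg2_const | now apply reg2_int_s, RN]. }
assert (Hit : forall T, M <= T -> exists D, forall n s q, 0 <= s <= T -> Rabs q <= T ->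
  Rabs (it (S n) s q - it n s q) <= D * (/ 2) ^ n).
{ intros T HT. destruct (Hcon T) as (L & HL0 & HC).
  destruct (reg2_le_bound (it 1%nat) T (Rit _)) as (D & HD0 & HD).
  assert (HH : forall n s q, 0 <= s <= T -> Rabs q <= T ->
    Rabs (it (S n) s q - it n s q) <= D * (/ 2) ^ n * exp (L * s)).
  { induction n as [| n IH]; intros s q Hs Hq.
    - replace (it 0%nat s q) with 0 by easy. rewrite Rminus_0_r, pow_O, Rmult_1_r.
      eapply Rle_trans; [now apply HD |].
      assert (1 <= exp (L * s)) by (apply exp_ge_1; nra). nra.
    - change (Rabs (int_s (N (it (S n))) s q - int_s (N (it n)) s q) <= D * (/ 2) ^ S n * exp (L * s)).
      replace (D * (/ 2) ^ S n) with (D * (/ 2) ^ n * / 2) by (simpl; ring).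
      apply HC; auto. intros; apply IH; lra. }
  exists (D * exp (L * T)). intros n s q Hs Hq.
  eapply Rle_trans; [now apply HH |].
  replace (D * exp (L * T) * (/ 2) ^ n) with (D * (/ 2) ^ n * exp (L * T)) by ring.
  apply Rmult_le_compat_l; [apply Rmult_le_pos; [easy | apply pow_le; lra] |].
  apply exp_le. nra. }
(* The limit is characterised for every admissible [D], so it does not depend on the region that
   produced it. *)
assert (Hlim : forall s q, 0 <= s -> exists l, forall n D,
  (forall n, Rabs (it (S n) s q - it n s q) <= D * (/ 2) ^ n) ->
  Rabs (l - it n s q) <= 2 * D * (/ 2) ^ n).
{ intros s q Hs. destruct (Hit (Rmax M (Rmax s (Rabs q))) (Rmax_l _ _)) as [D0 HD0].
  assert (A1 := Rmax_r M (Rmax s (Rabs q))).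
  assert (A2 := Rmax_l s (Rabs q)). assert (A3 := Rmax_r s (Rabs q)).
  destruct (geometric_cauchy (fun n => it n s q) D0) as [l Hl].
  { intros n. apply HD0; lra. }
  exists l. intros n D HD.
  destruct (geometric_cauchy (fun n => it n s q) D HD) as [l' Hl'].
  replace l with l'; [apply Hl' |].
  apply Rminus_diag_uniq, (le_geometric_eq_0 _ (2 * D + 2 * D0)). intros m.
  replace (l' - l) with ((l' - it m s q) - (l - it m s q)) by ring.
  rle Rabs_triang. rewrite Rabs_Ropp.
  specialize (Hl m). specialize (Hl' m). simpl in Hl, Hl'. lra. }
(* [Hlim] gives a limit only for [0 <= s]; the value [0] elsewhere makes [k] total. *)
set (k := fun s q => match excluded_middle_informative (0 <= s) with
  | left H => proj1_sig (constructive_indefinite_description _ (Hlim s q H))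
  | right _ => 0 end).
assert (Hk : forall T, M <= T -> exists D, 0 <= D /\ forall n s q, 0 <= s <= T -> Rabs q <= T ->
  Rabs (k s q - it n s q) <= D * (/ 2) ^ n).
{ intros T HT. destruct (Hit T HT) as [D HD]. exists (2 * D). split.
  { specialize (HD 0%nat 0 0 ltac:(lra) ltac:(rewrite Rabs_R0; lra)).
    rewrite pow_O, Rmult_1_r in HD. assert (X := Rabs_pos (it 1%nat 0 0 - it 0%nat 0 0)). lra. }
  intros n s q Hs Hq. unfold k.
  destruct excluded_middle_informative as [H | H]; [| lra].
  destruct constructive_indefinite_description as [l Hl]. simpl.
  apply Hl. intros m. now apply HD. }
(* A pointwise limit inherits size and slope bounds because those of the iterates, [b] and [e1 + Lf]
   below, do not depend on [n]. *)
assert (Rk : reg2 k).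
{ intros T0. set (T := Rmax M T0).
  assert (HTM : M <= T) by apply Rmax_l. assert (HT0 : T0 <= T) by apply Rmax_r.
  destruct (Hk T HTM) as (D & HD0 & HD).
  destruct (HL T) as (L & HL0 & HLT).
  destruct (Hf T) as (Lf & HLf & F1 & F2).
  destruct (reg2_le_bound _ T (HE _ (reg2_const 0))) as (e0 & He0 & HE0).
  assert (Hitb : forall n s q, 0 <= s <= T -> Rabs q <= T -> Rabs (it n s q) <= 2 * D).
  { intros n s q Hs Hq.
    assert (H1 := HD 0%nat s q Hs Hq). assert (H2 := HD n s q Hs Hq).
    replace (it 0%nat s q) with 0 in H1 by easy. rewrite Rminus_0_r, pow_O, Rmult_1_r in H1.
    replace (it n s q) with (k s q - (k s q - it n s q)) by ring.
    rle Rabs_triang. rewrite Rabs_Ropp.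
    assert ((/ 2) ^ n <= 1 ^ n) by (apply pow_incr; lra). rewrite pow1 in H. nra. }
  set (e1 := e0 + L * (2 * D)).
  assert (He1 : 0 <= e1) by (unfold e1; nra).
  assert (HEb : forall n s x, 0 <= s <= T -> Rabs x <= T -> Rabs (E s x (it n s x)) <= e1).
  { intros n s x Hs Hx. destruct (Rle_dec (Rabs x) M) as [HxM | HxM].
    - replace (E s x (it n s x)) with ((E s x (it n s x) - E s x 0) + E s x 0) by ring.
      rle Rabs_triang.
      assert (A1 := HLT s x (it n s x) 0 Hs HxM). rewrite Rminus_0_r in A1.
      assert (A2 := HE0 s x Hs Hx). simpl in A2.
      assert (A3 := Hitb n s x Hs Hx).
      assert (L * Rabs (it n s x) <= L * (2 * D)) by (apply Rmult_le_compat_l; lra).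
      unfold e1. lra.
    - rewrite Hsupp by lra. rewrite Rabs_R0. easy. }
  set (b := Rabs (chi 0) + 2 * M * e1 + Lf).
  assert (HMe : 0 <= M * e1) by nra.
  assert (Hb : 0 <= b) by (unfold b; assert (X := Rabs_pos (chi 0)); lra).
  assert (HNb : forall n s q, 0 <= s <= T -> Rabs q <= T -> Rabs (N (it n) s q) <= b).
  { intros n s q Hs Hq. unfold N, picard_op.
    rle Rabs_triang.
    specialize (F1 s q Hs Hq).
    assert (A := Ib (it n) s q e1 (Rit n) (proj1 Hs) (fun x Hx => HEb n s x Hs ltac:(lra))).
    set (y := int_q M (fun s x => E s x (it n s x)) s q) in *.
    assert (A1 := Hchi y 0). rewrite Rminus_0_r in A1.
    assert (A2 := Rabs_triang (chi y - chi 0) (chi 0)).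
    replace (chi y - chi 0 + chi 0) with (chi y) in A2 by ring. unfold b. lra. }
  assert (HNl : forall n s q q', 0 <= s <= T -> Rabs q <= T -> Rabs q' <= T ->
    Rabs (N (it n) s q - N (it n) s q') <= (e1 + Lf) * Rabs (q - q')).
  { intros n s q q' Hs Hq Hq'. unfold N, picard_op.
    specialize (F2 s s q q' Hs Hs Hq Hq'). rewrite Rminus_diag, Rabs_R0, Rplus_0_l in F2.
    match goal with |- Rabs (?a + ?c - (?b + ?d)) <= _ =>
      replace (a + c - (b + d)) with ((a - b) + (c - d)) by ring end.
    rle Rabs_triang.
    match goal with |- Rabs (chi ?a - chi ?b) + _ <= _ => assert (A := Hchi a b) end.
    assert (X : forall a c, ex_RInt (fun x => E s x (it n s x)) a c).
    { intros a c. apply (reg2_ex_q (fun s x => E s x (it n s x))); [now apply HE | lra]. }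
    assert (A1 : Rabs (int_q M (fun s x => E s x (it n s x)) s q -
       int_q M (fun s x => E s x (it n s x)) s q') <= e1 * Rabs (q - q')).
    { unfold int_q. rewrite (RInt_cut _ M q' q) by easy.
      rewrite (Rplus_comm (RInt _ M q')). unfold Rminus. rewrite Rplus_assoc, Rplus_opp_r, Rplus_0_r.
      apply abs_RInt_le_bound; [easy |]. intros x Hx. apply HEb; [easy |].
      rle (Rabs_between _ _ _ Hx). now apply Rmax_lub. }
    lra. }
  exists (D + D + b + T * (e1 + Lf)).
  assert (HTp : 0 <= T) by lra.
  assert (Hx : 0 <= T * (e1 + Lf)) by nra.
  split; [lra | split].
  - intros s q Hs Hq. assert (A1 := HD 0%nat s q ltac:(lra) ltac:(lra)).
    replace (it 0%nat s q) with 0 in A1 by easy. rewrite Rminus_0_r, pow_O, Rmult_1_r in A1. lra.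
  - intros s s' q q' Hs Hs' Hq Hq'.
    set (d := b * Rabs (s - s') + T * (e1 + Lf) * Rabs (q - q')).
    assert (Hkd : Rabs (k s q - k s' q') <= d).
    { apply Rnot_lt_le. intros Hlt.
      assert (Z : Rabs (k s q - k s' q') - d = 0); [| lra].
      apply (le_geometric_eq_0 _ (2 * D)). intros n.
      rewrite Rabs_pos_eq by lra.
      assert (A1 := HD (S n) s q ltac:(lra) ltac:(lra)).
      assert (A2 := HD (S n) s' q' ltac:(lra) ltac:(lra)).
      assert (A3 : Rabs (it (S n) s q - it (S n) s' q') <= d).
      { simpl. apply int_s_lip; try lra; auto.
        - intros r Hr. apply HNb; lra.
        - intros r Hr. apply HNl; lra. }
      assert (A4 : Rabs (k s q - k s' q') <= Rabs (k s q - it (S n) s q)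
         + Rabs (k s' q' - it (S n) s' q') + Rabs (it (S n) s q - it (S n) s' q')).
      { replace (k s q - k s' q') with ((k s q - it (S n) s q) - (k s' q' - it (S n) s' q')
          + (it (S n) s q - it (S n) s' q')) by ring.
        rle Rabs_triang. apply Rplus_le_compat_r.
        rle Rabs_triang. rewrite Rabs_Ropp. lra. }
      assert (0 <= (/ 2) ^ n) by (apply pow_le; lra).
      simpl pow in A1, A2. assert (0 <= D * (/ 2) ^ n) by nra. lra. }
    rle Hkd. unfold d.
    assert (H3 := Rabs_pos (s - s')). assert (H4 := Rabs_pos (q - q')).
    assert (0 <= b * Rabs (q - q')) by nra.
    assert (0 <= T * (e1 + Lf) * Rabs (s - s')) by nra.
    assert (0 <= D * Rabs (q - q')) by nra.
    assert (0 <= D * Rabs (s - s')) by nra. lra. }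
exists k. split; [easy |]. intros s q Hs.
set (T := Rmax M (Rmax s (Rabs q))).
assert (HTM : M <= T) by apply Rmax_l.
assert (HTs : s <= T) by (eapply Rle_trans; [apply (Rmax_l s (Rabs q)) | apply Rmax_r]).
assert (HTq : Rabs q <= T) by (eapply Rle_trans; [apply (Rmax_r s (Rabs q)) | apply Rmax_r]).
destruct (Hk T HTM) as (D & HD0 & HD).
destruct (Hcon T) as (L & HL0 & HC).
change (k s q = int_s (N k) s q).
apply Rminus_diag_uniq, (le_geometric_eq_0 _ (D + D * exp (L * s))). intros n.
assert (A1 := HD (S n) s q ltac:(lra) HTq).
assert (A2 := HC k (it n) (D * (/ 2) ^ n) Rk (Rit n)).
assert (Hpn : 0 <= (/ 2) ^ n) by (apply pow_le; lra).
assert (HDn : 0 <= D * (/ 2) ^ n) by nra.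
specialize (A2 ltac:(intros r x Hr Hx; eapply Rle_trans; [apply HD; lra |];
  assert (1 <= exp (L * r)) by (apply exp_ge_1; nra); nra) s q ltac:(lra)).
change (int_s (N (it n)) s q) with (it (S n) s q) in A2.
replace (k s q - int_s (N k) s q) with ((k s q - it (S n) s q) - (int_s (N k) s q - it (S n) s q)) by ring.
rle Rabs_triang. rewrite Rabs_Ropp.
simpl pow in A1. assert (He := exp_pos (L * s)).
assert (0 <= D * (/ 2) ^ n * exp (L * s)) by nra. lra.
Qed.

(** * The profile at a fixed angle: truncation and the mass bound *)

Lemma reg2_continuous (f : R -> R -> R) (s q : R) : reg2 f -> 0 <= s -> continuous (f s) q.
Proof.
intros Hf Hs. destruct (Hf (Rmax s (Rabs q + 1))) as (L & HL & _ & H).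
assert (H1 := Rmax_l s (Rabs q + 1)). assert (H2 := Rmax_r s (Rabs q + 1)).
apply lip_continuous with L. intros y Hy.
specialize (H s s y q). rewrite Rminus_diag, Rabs_R0, Rplus_0_l in H. apply H; try lra.
replace y with (q + (y - q)) by ring. eapply Rle_trans; [apply Rabs_triang | lra].
Qed.

Lemma ex_RInt_clamp (K a b : R) : ex_RInt (clamp K) a b.
Proof.
apply ex_RInt_lip with 1. intros x y _ _.
assert (H := clamp_lip K K x y). rewrite Rminus_diag, Rabs_R0 in H. lra.
Qed.

(** This primitive is the truncated counterpart of [y ^ 2 / 2]; its sign replaces that of [U(-M)^2]
    while the truncation is present. *)
Lemma RInt_clamp_nonneg (K y : R) : 0 <= K -> 0 <= RInt (clamp K) 0 y.
Proof.
intros HK. destruct (Rle_dec 0 y) as [Hy | Hy].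
- apply RInt_nonneg; [easy | apply ex_RInt_clamp |]. intros x Hx.
  destruct (Req_dec x 0) as [-> | Hx0].
  + rewrite clamp_id; [lra | rewrite Rabs_R0; easy].
  + assert (H := clamp_sign K x HK). nra.
- rewrite RInt_flip by apply ex_RInt_clamp.
  assert (E : - RInt (clamp K) y 0 = RInt (fun x => -1 * clamp K x) y 0 :> R).
  { rewrite RInt_mul by apply ex_RInt_clamp. ring. }
  rewrite E. apply RInt_nonneg; [lra | |].
  + apply ex_RInt_mul, ex_RInt_clamp.
  + intros x Hx. destruct (Req_dec x 0) as [-> | Hx0].
    * rewrite clamp_id; [lra | rewrite Rabs_R0; easy].
    * assert (H := clamp_sign K x HK). nra.
Qed.

(* The integrand is the exact q-derivative of the primitive of [clamp K] evaluated at
   [int_q M v], which vanishes at [q = M]. *)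
Lemma flux_nonpos (M K : R) (v : R -> R -> R) (s : R) : 0 <= M -> 0 <= K -> 0 <= s -> reg2 v ->
  RInt (fun q => clamp K (int_q M v s q) * v s q) (- M) M <= 0.
Proof.
intros HM HK Hs Hv.
assert (Hu : forall q, is_derive (int_q M v s) q (v s q)).
{ intros q. apply (is_derive_RInt (V := R_NormedModule) (v s) (int_q M v s) M q).
  - apply filter_forall. intros y. apply (RInt_correct (V := R_CompleteNormedModule)).
    now apply reg2_ex_q.
  - now apply reg2_continuous. }
assert (HX : forall y, is_derive (RInt (clamp K) 0) y (clamp K y)).
{ intros y. apply (is_derive_RInt (V := R_NormedModule) (clamp K) (RInt (clamp K) 0) 0 y).
  - apply filter_forall. intros z. apply (RInt_correct (V := R_CompleteNormedModule)).
    apply ex_RInt_clamp.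
  - apply lip_continuous with 1. intros z _.
    assert (H := clamp_lip K K z y). rewrite Rminus_diag, Rabs_R0 in H. lra. }
assert (HI : is_RInt (fun q => clamp K (int_q M v s q) * v s q) (- M) M
  (minus (RInt (clamp K) 0 (int_q M v s M)) (RInt (clamp K) 0 (int_q M v s (- M))))).
{ apply (is_RInt_derive (V := R_CompleteNormedModule) (fun q => RInt (clamp K) 0 (int_q M v s q))).
  - intros q _. rewrite Rmult_comm.
    apply (is_derive_comp (V := R_NormedModule) (RInt (clamp K) 0) (int_q M v s)); auto.
  - intros q _.
    apply (reg2_continuous (fun s q => clamp K (int_q M v s q) * v s q)); [| easy].
    apply reg2_mult; [| easy]. now apply reg2_clamp_const, reg2_int_q. }
rewrite (is_RInt_unique _ _ _ _ HI).
replace (int_q M v s M) with 0.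
- assert (E : RInt (clamp K) 0 0 = 0 :> R) by exact (RInt_point 0 (clamp K)).
  change (RInt (clamp K) 0 0 - RInt (clamp K) 0 (int_q M v s (- M)) <= 0).
  rewrite E. assert (H := RInt_clamp_nonneg K (int_q M v s (- M)) HK). lra.
- symmetry. exact (RInt_point M (v s)).
Qed.

(** The factor [h] in [U_q = B h] at a fixed angle, with [g] for [G(w)] and [k] for [Phi]. *)
Definition weight (g : R) (B : R -> R) (k : R -> R -> R) (s q : R) : R := exp (g * B q * k s q).

Lemma reg2_weight (g L : R) (B : R -> R) (k : R -> R -> R) :
  (forall q, Rabs (B q) <= L) -> (forall q q', Rabs (B q - B q') <= L * Rabs (q - q')) ->
  reg2 k -> reg2 (weight g B k).
Proof.
intros H1 H2 Hk. apply (reg2_exp (fun s q => g * B q * k s q)), reg2_mult; [| easy].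
apply (reg2_scal g (fun _ q => B q)). now apply reg2_of_q with L.
Qed.

(** Truncation replaces [h_s = g B U h] by [h_s = g B (clamp K U) h], so the mass has as derivative
    [g] times the integral in [flux_nonpos]. Its initial value is [2 M] since [h = 1] at [s = 0].
    The argument uses increments with quadratic errors instead of differentiating the integral. *)
Lemma mass_bound (M K b g : R) (B : R -> R) (k : R -> R -> R) :
  0 <= M -> 0 <= K -> 0 <= g -> 0 <= b ->
  (forall q, Rabs (B q) <= b) -> (forall q q', Rabs (B q - B q') <= b * Rabs (q - q')) ->
  reg2 k ->
  (forall s q, 0 <= s -> k s q = int_s (fun s q =>
     clamp K (int_q M (fun s x => B x * weight g B k s x) s q)) s q) ->
  forall s, 0 <= s -> RInt (weight g B k s) (- M) M <= 2 * M.
Proof.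
intros HM HK Hg Hb0 Hb HbL Rk Hk T HT.
set (h := weight g B k). assert (Rh : reg2 h) by now apply reg2_weight with b.
assert (RB : reg2 (fun _ q => B q)) by now apply reg2_of_q with b.
set (v := fun s x => B x * h s x). assert (Rv : reg2 v) by now apply reg2_mult.
set (V := fun s q => clamp K (int_q M v s q)).
assert (RV : reg2 V) by now apply reg2_clamp_const, reg2_int_q.
assert (HVK : forall s q, Rabs (V s q) <= K) by (intros; now apply clamp_bound).
destruct (RV (Rmax T M)) as (LV & HLV & _ & HV).
destruct (reg2_le_bound h (Rmax T M) Rh) as (H & HH0 & HH).
assert (TM1 := Rmax_l T M). assert (TM2 := Rmax_r T M).
(* The first summand bounds the error of replacing [V] on [[x, y]] by its value at [x], the second
   one the second-order remainder of [exp]. *)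
set (C := H * g * b * LV + 2 * H * (g * b * K) ^ 2).
assert (HT0 : RInt (h 0) (- M) M = 2 * M :> R).
{ rewrite (RInt_ext (h 0) (fun _ => 1)).
  - rewrite RInt_constant. ring.
  - intros x _. unfold h, weight. rewrite (Hk 0 x) by lra.
    replace (int_s _ 0 x) with 0; [rewrite Rmult_0_r; apply exp_0 |].
    symmetry. exact (RInt_point 0 _). }
change (RInt (h T) (- M) M <= 2 * M). rewrite <- HT0.
apply (quadratic_increment_nonpos (fun s => RInt (h s) (- M) M) 0 T (2 * M * C) HT).
intros x y Hx Hxy Hy.
rewrite <- RInt_sub by (apply reg2_ex_q; lra || easy).
assert (Hpt : forall q, - M <= q <= M ->
  h y q - h x q <= ((y - x) * g) * (clamp K (int_q M v x q) * v x q) + C * (y - x) ^ 2).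
{ intros q Hq. assert (Hq' : Rabs q <= Rmax T M) by (apply Rle_trans with M; [now apply Rabs_le | easy]).
  assert (D1 : k y q - k x q = RInt (fun r => V r q) x y :> R).
  { rewrite (Hk y), (Hk x) by lra. unfold int_s.
    change (RInt (fun r => V r q) 0 y - RInt (fun r => V r q) 0 x = RInt (fun r => V r q) x y :> R).
    rewrite (RInt_cut (fun r => V r q) 0 x y) by (apply reg2_ex_s; lra || easy).
    ring. }
  assert (D2 : Rabs (k y q - k x q) <= K * (y - x)).
  { rewrite D1, <- (Rabs_pos_eq (y - x)) by lra.
    apply abs_RInt_le_bound; [apply reg2_ex_s; lra || easy | auto]. }
  assert (D3 : Rabs (k y q - k x q - (y - x) * V x q) <= LV * (y - x) ^ 2).
  { rewrite D1, <- (RInt_constant (V x q) x y).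
    rewrite <- RInt_sub by (apply ex_RInt_const || (apply reg2_ex_s; lra || easy)).
    replace (LV * (y - x) ^ 2) with ((LV * (y - x)) * Rabs (y - x))
      by (rewrite (Rabs_pos_eq (y - x)) by lra; ring).
    apply abs_RInt_le_bound.
    - apply ex_RInt_sub; [apply reg2_ex_s; lra || easy | apply ex_RInt_const].
    - intros r Hr. rewrite Rmin_left, Rmax_right in Hr by lra.
      assert (A := HV r x q q). rewrite (Rminus_diag q), Rabs_R0, Rplus_0_r in A.
      specialize (A ltac:(lra) ltac:(lra) Hq' Hq').
      rewrite (Rabs_pos_eq (r - x)) in A by lra. nra. }
  assert (D4 := exp_taylor (g * B q * k x q) (g * B q * k y q)).
  change (exp (g * B q * k x q)) with (h x q) in D4.
  change (exp (g * B q * k y q)) with (h y q) in D4.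
  apply Rabs_le_between in D4. destruct D4 as [_ D4].
  assert (P1 : 0 < h x q) by apply exp_pos. assert (P2 : 0 < h y q) by apply exp_pos.
  assert (H1 := HH x q ltac:(lra) Hq'). assert (H2 := HH y q ltac:(lra) Hq').
  rewrite Rabs_pos_eq in H1, H2 by lra.
  assert (D5 : (g * B q * k y q - g * B q * k x q) ^ 2 <= (g * b * K) ^ 2 * (y - x) ^ 2).
  { rewrite <- Rmult_minus_distr_l, <- Rpow_mult_distr, <- pow2_abs.
    apply pow_incr. split; [apply Rabs_pos |].
    rewrite !Rabs_mult, (Rabs_pos_eq g) by easy.
    replace (g * b * K * (y - x)) with (g * b * (K * (y - x))) by ring.
    apply Rmult_le_compat; [apply Rmult_le_pos; [easy | apply Rabs_pos] | apply Rabs_pos | | easy].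
    now apply Rmult_le_compat_l. }
  set (r := k y q - k x q - (y - x) * V x q) in D3.
  assert (D6 : h x q * (g * B q * k y q - g * B q * k x q)
    = (y - x) * g * (clamp K (int_q M v x q) * v x q) + h x q * g * (B q * r)).
  { unfold r, V, v. ring. }
  assert (D7 : h x q * g * (B q * r) <= H * g * (b * (LV * (y - x) ^ 2))).
  { rle Rle_abs. rewrite !Rabs_mult, (Rabs_pos_eq g), (Rabs_pos_eq (h x q)) by lra.
    apply Rmult_le_compat.
    - apply Rmult_le_pos; lra.
    - apply Rmult_le_pos; apply Rabs_pos.
    - apply Rmult_le_compat_r; lra.
    - apply Rmult_le_compat; auto using Rabs_pos. }
  assert (D8 : (h x q + h y q) * (g * B q * k y q - g * B q * k x q) ^ 2
    <= (2 * H) * ((g * b * K) ^ 2 * (y - x) ^ 2)).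
  { apply Rmult_le_compat; [lra | apply pow2_ge_0 | lra | easy]. }
  unfold C. lra. }
assert (I1 : ex_RInt (fun q => clamp K (int_q M v x q) * v x q) (- M) M).
{ apply (reg2_ex_q (fun s q => clamp K (int_q M v s q) * v s q)); [| easy]. now apply reg2_mult. }
assert (I2 : ex_RInt (fun q => (y - x) * g * (clamp K (int_q M v x q) * v x q)) (- M) M).
{ now apply ex_RInt_mul. }
eapply Rle_trans.
- apply RInt_le with (g := fun q => ((y - x) * g) * (clamp K (int_q M v x q) * v x q) + C * (y - x) ^ 2).
  + lra.
  + apply ex_RInt_sub; apply reg2_ex_q; lra || easy.
  + apply ex_RInt_add; [easy | apply ex_RInt_const].
  + intros q Hq. apply Hpt; lra.
- rewrite RInt_add, RInt_mul, RInt_constant by (easy || apply ex_RInt_const).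
  assert (F := flux_nonpos M K v x HM HK Hx Rv).
  assert (0 <= (y - x) * g) by nra. nra.
Qed.

(** Truncating [Phi] at [K * s] makes the integrand Lipschitz in the unknown. This truncation is
    inactive at once, because the truncated [U] is bounded by [K]. Then [mass_bound] applies and
    gives [|U| <= b * 2 M = K], so the other one is inactive too. *)
Lemma profile_exists (M b g : R) (B : R -> R) :
  0 <= M -> 0 <= g -> 0 <= b ->
  (forall q, Rabs (B q) <= b) -> (forall q q', Rabs (B q - B q') <= b * Rabs (q - q')) ->
  (forall q, M < Rabs q -> B q = 0) ->
  exists k, reg2 k /\ forall s, 0 <= s ->
    (forall q, k s q = int_s (int_q M (fun s x => B x * weight g B k s x)) s q) /\
    RInt (weight g B k s) (- M) M <= 2 * M /\
    (forall q, Rabs (k s q) <= 2 * M * b * s).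
Proof.
intros HM Hg Hb0 Hb HbL Hsupp.
set (K := 2 * M * b). assert (HK : 0 <= K) by (unfold K; nra).
assert (RB : reg2 (fun _ q => B q)) by now apply reg2_of_q with b.
destruct (picard M (clamp K) (fun s x y => B x * exp (g * B x * clamp (K * s) y)) (fun _ _ => 0))
  as (k & Rk & Hk); auto.
- intros y y'. assert (H := clamp_lip K K y y'). rewrite Rminus_diag, Rabs_R0 in H. lra.
- intros k Hk. apply reg2_mult; [easy |].
  apply (reg2_exp (fun s x => g * B x * clamp (K * s) (k s x))).
  apply reg2_mult; [now apply (reg2_scal g (fun _ q => B q)) | now apply reg2_clamp].
- intros s x y _ Hx. rewrite Hsupp by easy. ring.
- intros T. exists (b * (2 * exp (g * b * (K * Rabs T)) * (g * b))).
  assert (He := exp_pos (g * b * (K * Rabs T))).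
  assert (Hgb : 0 <= g * b) by nra.
  split; [apply Rmult_le_pos; [easy | apply Rmult_le_pos; lra] |].
  intros s x y y' Hs Hx. rewrite <- Rmult_minus_distr_l, Rabs_mult, (Rmult_assoc b).
  apply Rmult_le_compat; auto using Rabs_pos.
  rle exp_increment.
  assert (HKs : 0 <= K * s) by nra.
  assert (HsT : s <= Rabs T) by (rewrite Rabs_pos_eq; lra).
  assert (Hexp : forall z, exp (g * B x * clamp (K * s) z) <= exp (g * b * (K * Rabs T))).
  { intros z. apply exp_le. rle Rle_abs.
    rewrite !Rabs_mult, (Rabs_pos_eq g) by easy.
    apply Rmult_le_compat; [apply Rmult_le_pos; auto using Rabs_pos | apply Rabs_pos | |].
    - now apply Rmult_le_compat_l.
    - eapply Rle_trans; [now apply clamp_bound | now apply Rmult_le_compat_l]. }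
  assert (X1 := Hexp y). assert (X2 := Hexp y').
  assert (Hc := clamp_lip (K * s) (K * s) y y'). rewrite Rminus_diag, Rabs_R0, Rplus_0_l in Hc.
  apply Rle_trans with (2 * exp (g * b * (K * Rabs T)) * Rabs (g * B x * clamp (K * s) y - g * B x * clamp (K * s) y')).
  { apply Rmult_le_compat_r; [apply Rabs_pos | lra]. }
  rewrite <- Rmult_minus_distr_l, !Rabs_mult, (Rabs_pos_eq g) by easy.
  rewrite (Rmult_assoc (2 * _)). apply Rmult_le_compat_l; [lra |].
  apply Rmult_le_compat; auto using Rabs_pos; [apply Rmult_le_pos; auto using Rabs_pos |].
  now apply Rmult_le_compat_l.
- apply reg2_const.
- exists k. split; [easy |].
  set (E := fun s x => B x * exp (g * B x * clamp (K * s) (k s x))).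
  assert (RE : reg2 E).
  { apply reg2_mult; [easy |].
    apply (reg2_exp (fun s x => g * B x * clamp (K * s) (k s x))).
    apply reg2_mult; [now apply (reg2_scal g (fun _ q => B q)) | now apply reg2_clamp]. }
  assert (Hkb : forall s q, 0 <= s -> Rabs (k s q) <= K * s).
  { intros s q Hs. rewrite Hk by easy. unfold int_s.
    replace (K * s) with (K * Rabs (s - 0)) by (rewrite Rminus_0_r, Rabs_pos_eq; easy).
    apply abs_RInt_le_bound.
    - apply (reg2_ex_s (picard_op M (clamp K) _ (fun _ _ => 0) k)); [| lra | easy].
      apply reg2_plus; [| apply reg2_const]. now apply reg2_clamp_const, reg2_int_q.
    - intros r _. unfold picard_op. rewrite Rplus_0_r. now apply clamp_bound. }
  set (v := fun s x => B x * weight g B k s x).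
  assert (HEv : forall s x, 0 <= s -> E s x = v s x).
  { intros s x Hs. unfold E, v, weight. rewrite clamp_id; [easy | now apply Hkb]. }
  assert (Rh : reg2 (weight g B k)) by now apply reg2_weight with b.
  assert (Rv : reg2 v) by now apply reg2_mult.
  assert (Hk' : forall s q, 0 <= s -> k s q = int_s (fun s q => clamp K (int_q M v s q)) s q).
  { intros s q Hs. rewrite Hk by easy. unfold int_s. apply RInt_ext.
    intros r Hr. rewrite Rmin_left, Rmax_right in Hr by easy.
    unfold picard_op. rewrite Rplus_0_r. f_equal. unfold int_q. apply RInt_ext.
    intros x _. apply HEv. lra. }
  assert (Hmass := mass_bound M K b g B k HM HK Hg Hb0 Hb HbL Rk Hk').
  intros s Hs. split; [| split; auto].
  intros q. rewrite Hk' by easy. unfold int_s. apply RInt_ext.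
  intros r Hr. rewrite Rmin_left, Rmax_right in Hr by easy.
  apply clamp_id. unfold int_q.
  eapply Rle_trans.
  + apply (abs_RInt_supp _ (fun x => b * weight g B k r x)); auto.
    * intros; apply reg2_ex_q; lra || easy.
    * apply ex_RInt_mul. apply reg2_ex_q; lra || easy.
    * intros x Hx. unfold v. rewrite Hsupp by easy. ring.
    * intros x _. unfold v. rewrite Rabs_mult, (Rabs_pos_eq (weight _ _ _ _ _)) by (left; apply exp_pos).
      apply Rmult_le_compat_r; [left; apply exp_pos | easy].
  + rewrite RInt_mul by (apply reg2_ex_q; lra || easy).
    assert (X := Hmass r ltac:(lra)). unfold K. nra.
Qed.

(** * Calculus of exponentially bounded smooth functions of [(s, q, w)] *)

Definition pt : Type := (R * R * (R * R))%type.
Definition ps (p : pt) : R := fst (fst p).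
Definition pq (p : pt) : R := snd (fst p).
Definition pw (p : pt) : R * R := snd p.

Inductive dir : Set := DS | DQ | DW.

Definition step (d : dir) (t : R) (p : pt) : pt :=
  match d with
  | DS => (ps p + t, pq p, pw p)
  | DQ => (ps p, pq p + t, pw p)
  | DW => (ps p, pq p, rot t (pw p))
  end.

Definition ok (p : pt) : Prop := 0 <= ps p /\ circle (pw p).

(** One constant is both factor and rate, so the bounds are ordered by [C] and stable under sums,
    products and integration in [s]. *)
Definition gr (C x : R) : R := C * exp (C * x).

(** Growth is measured at the sum of the two values of [s], which dominates either end point. The
    bound is asked for all admissible increments, not only for small ones. *)
Definition big_O (d : dir) (k : nat) (F : R -> pt -> R) : Prop :=
  exists C, 0 <= C /\ forall t p, ok p -> ok (step d t p) ->
    Rabs (F t p) <= gr C (ps p + ps (step d t p)) * Rabs t ^ k.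

Definition bnd (f : pt -> R) : Prop :=
  exists C, 0 <= C /\ forall p, ok p -> Rabs (f p) <= gr C (ps p).

Definition Lip (d : dir) (f : pt -> R) : Prop :=
  big_O d 1 (fun t p => f (step d t p) - f p).

(** A quantitative form of: [g] is the derivative of [f] in direction [d]. At [s = 0] the admissible
    increments in [s] are [t >= 0], so one-sided derivatives need no separate treatment. *)
Definition Tay (d : dir) (f g : pt -> R) : Prop :=
  big_O d 2 (fun t p => f (step d t p) - f p - t * g p).

(** The class [C^{n,1}] with exponentially growing constants. Lipschitz bounds belong to every level
    because the quadratic remainder of a product contains the product of the two increments. *)
Fixpoint CK (n : nat) (f : pt -> R) : Prop :=
  bnd f /\ (forall d, Lip d f) /\
  match n with
  | O => True
  | S n => exists g : dir -> pt -> R, forall d, Tay d f (g d) /\ CK n (g d)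
  end.

Lemma circle_rot (t : R) (w : R * R) : circle w -> circle (rot t w).
Proof.
unfold circle, rot. cbn [fst snd]. intros H. assert (X := sin2_cos2 t). unfold Rsqr in X.
transitivity ((sin t * sin t + cos t * cos t) * (fst w ^ 2 + snd w ^ 2)); [ring |].
rewrite X, H. ring.
Qed.

Lemma gr_nonneg (C x : R) : 0 <= C -> 0 <= gr C x.
Proof. intros H. apply Rmult_le_pos; [easy | left; apply exp_pos]. Qed.

Lemma gr_le (C C' x y : R) : 0 <= C -> C <= C' -> 0 <= x -> x <= y -> gr C x <= gr C' y.
Proof.
intros H1 H2 H3 H4. unfold gr.
apply Rmult_le_compat; [easy | left; apply exp_pos | easy |]. apply exp_le. nra.
Qed.

Lemma gr_plus (C C' x : R) : 0 <= C -> 0 <= C' -> 0 <= x -> gr C x + gr C' x <= gr (C + C') x.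
Proof.
intros H1 H2 H3. unfold gr at 3. rewrite Rmult_plus_distr_r.
apply Rplus_le_compat; unfold gr; (apply Rmult_le_compat_l; [easy | apply exp_le; nra]).
Qed.

Lemma gr_mult (C C' x : R) : 0 <= C -> 0 <= C' -> 0 <= x ->
  gr C x * gr C' x <= gr (C * C' + C + C') x.
Proof.
intros H1 H2 H3. unfold gr.
replace (C * exp (C * x) * (C' * exp (C' * x))) with (C * C' * exp (C * x + C' * x))
  by (rewrite exp_plus; ring).
assert (0 <= C * C') by nra.
apply Rmult_le_compat; [easy | left; apply exp_pos | lra |]. apply exp_le. nra.
Qed.

Lemma big_O_le (d : dir) (k : nat) (F G : R -> pt -> R) : big_O d k G ->
  (forall t p, ok p -> ok (step d t p) -> Rabs (F t p) <= Rabs (G t p)) -> big_O d k F.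
Proof.
intros (C & HC & H) E. exists C. split; [easy |]. intros t p Hp Hp'.
eapply Rle_trans; [apply E; easy | apply H; easy].
Qed.

Lemma big_O_ext (d : dir) (k : nat) (F G : R -> pt -> R) : big_O d k G ->
  (forall t p, ok p -> ok (step d t p) -> F t p = G t p) -> big_O d k F.
Proof. intros H E. apply (big_O_le d k F G H). intros t p H1 H2. rewrite E; auto. lra. Qed.

Lemma big_O_plus (d : dir) (k : nat) (F G : R -> pt -> R) : big_O d k F -> big_O d k G ->
  big_O d k (fun t p => F t p + G t p).
Proof.
intros (C & HC & H) (C' & HC' & H'). exists (C + C'). split; [lra |]. intros t p Hp Hp'.
specialize (H t p Hp Hp'). specialize (H' t p Hp Hp').
rle Rabs_triang.
assert (0 <= Rabs t ^ k) by apply pow_le, Rabs_pos.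
assert (G0 := gr_plus C C' (ps p + ps (step d t p)) HC HC' ltac:(destruct Hp, Hp'; lra)).
nra.
Qed.

Lemma big_O_mult (d : dir) (k l : nat) (F G : R -> pt -> R) : big_O d k F -> big_O d l G ->
  big_O d (k + l) (fun t p => F t p * G t p).
Proof.
intros (C & HC & H) (C' & HC' & H'). exists (C * C' + C + C'). split; [nra |]. intros t p Hp Hp'.
specialize (H t p Hp Hp'). specialize (H' t p Hp Hp').
rewrite Rabs_mult, pow_add.
assert (G0 := gr_mult C C' (ps p + ps (step d t p)) HC HC' ltac:(destruct Hp, Hp'; lra)).
eapply Rle_trans; [apply Rmult_le_compat; [apply Rabs_pos | apply Rabs_pos | apply H | apply H'] |].
set (a := gr C _) in *. set (b := gr C' _) in *.
replace (a * Rabs t ^ k * (b * Rabs t ^ l)) with (a * b * (Rabs t ^ k * Rabs t ^ l)) by ring.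
apply Rmult_le_compat_r; [| easy].
apply Rmult_le_pos; apply pow_le, Rabs_pos.
Qed.

Lemma big_O_abs (d : dir) (k : nat) (F : R -> pt -> R) : big_O d k F ->
  big_O d k (fun t p => Rabs (F t p)).
Proof. intros H. apply (big_O_le d k _ F H). intros. rewrite Rabs_Rabsolu. lra. Qed.

Lemma big_O_const (d : dir) (c : R) : big_O d 0 (fun _ _ => c).
Proof.
exists (Rabs c). split; [apply Rabs_pos |]. intros t p Hp Hp'. rewrite pow_O, Rmult_1_r.
unfold gr. rewrite <- (Rmult_1_r (Rabs c)) at 1. apply Rmult_le_compat_l; [apply Rabs_pos |].
apply exp_ge_1. apply Rmult_le_pos; [apply Rabs_pos | destruct Hp, Hp'; lra].
Qed.

Lemma big_O_scal (d : dir) (k : nat) (c : R) (F : R -> pt -> R) : big_O d k F ->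
  big_O d k (fun t p => c * F t p).
Proof. intros H. exact (big_O_mult d 0 k _ _ (big_O_const d c) H). Qed.

Lemma big_O_t (d : dir) : big_O d 1 (fun t _ => t).
Proof.
destruct (big_O_const d 1) as (C & HC & H). exists C. split; [easy |]. intros t p Hp Hp'.
specialize (H t p Hp Hp'). rewrite pow_O, Rmult_1_r, Rabs_R1 in H.
rewrite pow_1. assert (X := Rabs_pos t). nra.
Qed.

Lemma big_O_here (d : dir) (f : pt -> R) : bnd f -> big_O d 0 (fun _ p => f p).
Proof.
intros (C & HC & H). exists C. split; [easy |]. intros t p Hp Hp'. rewrite pow_O, Rmult_1_r.
eapply Rle_trans; [now apply H |]. destruct Hp, Hp'. apply gr_le; lra.
Qed.

Lemma big_O_there (d : dir) (f : pt -> R) : bnd f -> big_O d 0 (fun t p => f (step d t p)).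
Proof.
intros (C & HC & H). exists C. split; [easy |]. intros t p Hp Hp'. rewrite pow_O, Rmult_1_r.
eapply Rle_trans; [now apply H |]. destruct Hp, Hp'. apply gr_le; lra.
Qed.

Lemma ok_step (d : dir) (t : R) (p : pt) : d <> DS -> ok p -> ok (step d t p).
Proof.
intros Hd [H1 H2]. destruct d; [easy | now split | split; [easy | now apply circle_rot]].
Qed.

Lemma gr_double (C x : R) : 0 <= C -> 0 <= x -> gr C (2 * x) <= gr (2 * C) x.
Proof.
intros. unfold gr. replace (2 * C * x) with (C * (2 * x)) by ring.
apply Rmult_le_compat_r; [left; apply exp_pos | lra].
Qed.

(** The direction [DW] with [t = 0] leaves [s] fixed; in this way the closure rules for [big_O] of
    order [0] become closure rules for [bnd]. *)
Lemma bnd_of_big_O (f : pt -> R) : big_O DW 0 (fun _ p => f p) -> bnd f.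
Proof.
intros (C & HC & H). exists (2 * C). split; [lra |]. intros p Hp.
rle (H 0 p Hp); [now apply ok_step |].
rewrite pow_O, Rmult_1_r. change (ps (step DW 0 p)) with (ps p).
replace (ps p + ps p) with (2 * ps p) by ring. apply gr_double; [easy | apply Hp].
Qed.

Lemma bnd_le (f g : pt -> R) : bnd g -> (forall p, ok p -> Rabs (f p) <= Rabs (g p)) -> bnd f.
Proof. intros H E. apply bnd_of_big_O, (big_O_le _ _ _ _ (big_O_here DW g H)). auto. Qed.

Lemma bnd_ext (f g : pt -> R) : (forall p, ok p -> f p = g p) -> bnd f -> bnd g.
Proof. intros E H. apply (bnd_le g f H). intros p Hp. rewrite E; auto. lra. Qed.

Lemma bnd_const (c : R) : bnd (fun _ => c).
Proof. apply bnd_of_big_O, big_O_const. Qed.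

Lemma bnd_plus (f g : pt -> R) : bnd f -> bnd g -> bnd (fun p => f p + g p).
Proof.
intros Hf Hg. exact (bnd_of_big_O _ (big_O_plus _ _ _ _ (big_O_here DW f Hf) (big_O_here DW g Hg))).
Qed.

Lemma bnd_mult (f g : pt -> R) : bnd f -> bnd g -> bnd (fun p => f p * g p).
Proof.
intros Hf Hg. exact (bnd_of_big_O _ (big_O_mult _ 0 0 _ _ (big_O_here DW f Hf) (big_O_here DW g Hg))).
Qed.

Lemma Lip_plus (d : dir) (f g : pt -> R) : Lip d f -> Lip d g -> Lip d (fun p => f p + g p).
Proof.
intros Hf Hg. apply (big_O_ext _ _ _ _ (big_O_plus _ _ _ _ Hf Hg)). intros. ring.
Qed.

Lemma Lip_mult (d : dir) (f g : pt -> R) : bnd f -> bnd g -> Lip d f -> Lip d g ->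
  Lip d (fun p => f p * g p).
Proof.
intros Bf Bg Hf Hg.
apply (big_O_ext _ _ _ _ (big_O_plus _ _ _ _
  (big_O_mult _ 1 0 _ _ Hf (big_O_there d g Bg)) (big_O_mult _ 0 1 _ _ (big_O_here d f Bf) Hg))).
intros. ring.
Qed.

Lemma Lip_exp (d : dir) (f : pt -> R) : bnd (fun p => exp (f p)) -> Lip d f ->
  Lip d (fun p => exp (f p)).
Proof.
intros Be Hf.
apply (big_O_le _ _ _ _ (big_O_mult _ 0 1 _ _
  (big_O_plus _ _ _ _ (big_O_here d _ Be) (big_O_there d _ Be)) Hf)).
intros t p _ _. rewrite Rabs_mult.
assert (H1 := exp_pos (f p)). assert (H2 := exp_pos (f (step d t p))).
rewrite (Rabs_pos_eq (_ + _)) by lra. apply exp_increment.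
Qed.

Lemma Lip_ext (d : dir) (f g : pt -> R) : (forall p, ok p -> f p = g p) -> Lip d f -> Lip d g.
Proof.
intros E H. apply (big_O_ext _ _ _ _ H). intros t p H1 H2. rewrite !E; auto.
Qed.

Lemma Tay_ext (d : dir) (f f' g g' : pt -> R) : (forall p, ok p -> f p = f' p) ->
  (forall p, ok p -> g p = g' p) -> Tay d f g -> Tay d f' g'.
Proof.
intros E E' H. apply (big_O_ext _ _ _ _ H). intros t p H1 H2. rewrite !E, E'; auto.
Qed.

Lemma Tay_plus (d : dir) (f g f' g' : pt -> R) : Tay d f f' -> Tay d g g' ->
  Tay d (fun p => f p + g p) (fun p => f' p + g' p).
Proof.
intros Hf Hg. apply (big_O_ext _ _ _ _ (big_O_plus _ _ _ _ Hf Hg)). intros. ring.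
Qed.

Lemma Tay_mult (d : dir) (f g f' g' : pt -> R) : bnd f -> bnd g -> Lip d f -> Lip d g ->
  Tay d f f' -> Tay d g g' ->
  Tay d (fun p => f p * g p) (fun p => f' p * g p + f p * g' p).
Proof.
intros Bf Bg Lf Lg Hf Hg.
apply (big_O_ext _ _ _ _ (big_O_plus _ _ _ _
  (big_O_plus _ _ _ _
    (big_O_mult _ 2 0 _ _ Hf (big_O_here d g Bg)) (big_O_mult _ 0 2 _ _ (big_O_here d f Bf) Hg))
  (big_O_mult _ 1 1 _ _ Lf Lg))).
intros. ring.
Qed.

Lemma Tay_exp (d : dir) (f g : pt -> R) : bnd (fun p => exp (f p)) -> Lip d f -> Tay d f g ->
  Tay d (fun p => exp (f p)) (fun p => g p * exp (f p)).
Proof.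
intros Be Lf Hf.
assert (H1 : big_O d 2 (fun t p => exp (f (step d t p)) - exp (f p)
   - exp (f p) * (f (step d t p) - f p))).
{ apply (big_O_le _ _ _ _ (big_O_mult _ 0 2 _ _
    (big_O_plus _ _ _ _ (big_O_here d _ Be) (big_O_there d _ Be)) (big_O_mult _ 1 1 _ _ Lf Lf))).
  intros t p _ _. rewrite (Rabs_mult (_ + _)).
  assert (H1 := exp_pos (f p)). assert (H2 := exp_pos (f (step d t p))).
  rewrite (Rabs_pos_eq (_ + _)) by lra.
  rewrite (Rabs_pos_eq ((f (step d t p) - f p) * _)) by apply Rle_0_sqr.
  eapply Rle_trans; [apply exp_taylor | right; ring]. }
apply (big_O_ext _ _ _ _ (big_O_plus _ _ _ _ H1 (big_O_mult _ 0 2 _ _ (big_O_here d _ Be) Hf))).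
intros. ring.
Qed.

Lemma CK_bnd (n : nat) (f : pt -> R) : CK n f -> bnd f.
Proof. destruct n; intros H; apply H. Qed.

Lemma CK_Lip (n : nat) (f : pt -> R) (d : dir) : CK n f -> Lip d f.
Proof. destruct n; intros H; apply H. Qed.

Lemma CK_0 (n : nat) (f : pt -> R) : CK n f -> CK 0 f.
Proof. intros H. split; [now apply (CK_bnd n) | split; [| easy]]. intros d. now apply (CK_Lip n). Qed.

Lemma CK_down (n : nat) (f : pt -> R) : CK (S n) f -> CK n f.
Proof.
revert f. induction n as [| n IH]; intros f H; [now apply CK_0 in H |].
destruct H as (B & L & g & Hg). split; [easy | split; [easy |]].
exists g. intros d. split; [apply Hg |]. apply IH, Hg.
Qed.

Lemma CK_ext (n : nat) (f g : pt -> R) : (forall p, ok p -> f p = g p) -> CK n f -> CK n g.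
Proof.
intros E H. destruct n.
- split; [| split; [| easy]].
  + apply (bnd_ext f g E), H.
  + intros d. apply (Lip_ext d f g E), H.
- destruct H as (B & L & f' & Hf). split; [now apply (bnd_ext f g E) | split].
  + intros d. now apply (Lip_ext d f g E).
  + exists f'. intros d. split; [| apply Hf]. apply (Tay_ext d f g (f' d) (f' d)); auto. apply Hf.
Qed.

Lemma CK_const (n : nat) (c : R) : CK n (fun _ => c).
Proof.
revert c. induction n as [| n IH]; intros c.
all: split; [apply bnd_const | split].
- intros d. apply (big_O_ext _ _ _ _ (big_O_scal d 1 0 _ (big_O_t d))). intros; ring.
- easy.
- intros d. apply (big_O_ext _ _ _ _ (big_O_scal d 1 0 _ (big_O_t d))). intros; ring.
- exists (fun _ _ => 0). intros d. split; [| apply IH].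
  apply (big_O_ext _ _ _ _ (big_O_scal d 2 0 _ (big_O_mult d 1 1 _ _ (big_O_t d) (big_O_t d)))).
  intros; ring.
Qed.

Lemma CK_plus (n : nat) (f g : pt -> R) : CK n f -> CK n g -> CK n (fun p => f p + g p).
Proof.
revert f g. induction n as [| n IH]; intros f g Hf Hg.
- destruct Hf as (Bf & Lf & _), Hg as (Bg & Lg & _).
  split; [now apply bnd_plus | split; [intros; now apply Lip_plus | easy]].
- destruct Hf as (Bf & Lf & f' & Hf), Hg as (Bg & Lg & g' & Hg).
  split; [now apply bnd_plus | split; [intros; now apply Lip_plus |]].
  exists (fun d p => f' d p + g' d p). intros d. split; [apply Tay_plus | apply IH]; (apply Hf || apply Hg).
Qed.

Lemma CK_mult (n : nat) (f g : pt -> R) : CK n f -> CK n g -> CK n (fun p => f p * g p).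
Proof.
revert f g. induction n as [| n IH]; intros f g Hf Hg.
- destruct Hf as (Bf & Lf & _), Hg as (Bg & Lg & _).
  split; [now apply bnd_mult | split; [intros; now apply Lip_mult | easy]].
- assert (Hf1 := CK_down _ _ Hf). assert (Hg1 := CK_down _ _ Hg).
  destruct Hf as (Bf & Lf & f' & Hf), Hg as (Bg & Lg & g' & Hg).
  split; [now apply bnd_mult | split; [intros; now apply Lip_mult |]].
  exists (fun d p => f' d p * g p + f p * g' d p). intros d. split.
  + apply Tay_mult; auto; (apply Hf || apply Hg).
  + apply CK_plus; apply IH; auto; (apply Hf || apply Hg).
Qed.

Lemma CK_scal (n : nat) (c : R) (f : pt -> R) : CK n f -> CK n (fun p => c * f p).
Proof. apply (CK_mult n (fun _ => c)), CK_const. Qed.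

(** The bound on [exp f] is assumed separately: for [f] merely in [bnd] it could be doubly
    exponential. For [f = G B Phi] it comes from the linear growth of [Phi] in [s]. *)
Lemma CK_exp (n : nat) (f : pt -> R) : bnd (fun p => exp (f p)) -> CK n f ->
  CK n (fun p => exp (f p)).
Proof.
intros Be. induction n as [| n IH]; intros Hf.
- split; [easy | split; [| easy]]. intros d. apply Lip_exp; [easy | apply Hf].
- assert (Hf1 := CK_down _ _ Hf). destruct Hf as (Bf & Lf & f' & Hf).
  split; [easy | split; [intros d; now apply Lip_exp |]].
  exists (fun d p => f' d p * exp (f p)). intros d. split.
  + apply Tay_exp; auto. apply Hf.
  + apply CK_mult; [apply Hf | now apply IH].
Qed.

Lemma le_small_t_eq_0 (a C : R) : (forall t, 0 < t <= 1 -> Rabs (t * a) <= C * t ^ 2) -> a = 0.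
Proof.
intros H. apply (le_geometric_eq_0 a C). intros n.
assert (Hp : 0 < (/ 2) ^ n) by (apply pow_lt; lra).
assert (Hp1 : (/ 2) ^ n <= 1 ^ n) by (apply pow_incr; lra). rewrite pow1 in Hp1.
specialize (H ((/ 2) ^ n) (conj Hp Hp1)). rewrite Rabs_mult, Rabs_pos_eq in H by lra.
apply Rmult_le_reg_l with ((/ 2) ^ n); [easy |]. lra.
Qed.

Lemma ok_step_pos (d : dir) (t : R) (p : pt) : 0 <= t -> ok p -> ok (step d t p).
Proof.
intros Ht [H1 H2]. destruct d; split; simpl; auto.
- unfold ps in *; simpl; lra.
- now apply circle_rot.
Qed.

Lemma ps_step_le (d : dir) (t : R) (p : pt) : 0 <= t <= 1 -> ps (step d t p) <= ps p + 1.
Proof. intros Ht. destruct d; unfold step, ps; simpl; lra. Qed.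

Lemma ps_step (d : dir) (t : R) (p : pt) : d <> DS -> ps (step d t p) = ps p.
Proof. now destruct d. Qed.

Lemma pq_step (d : dir) (t : R) (p : pt) : d <> DQ -> pq (step d t p) = pq p.
Proof. now destruct d. Qed.

(** Steps [0 < t <= 1] are admissible also at [s = 0] and keep the growth factor bounded; letting
    [t] tend to [0] leaves only the linear coefficient. *)
Lemma big_O_2_linear (d : dir) (g : pt -> R) (p : pt) (F : R -> pt -> R) : big_O d 2 F -> ok p ->
  (forall t, 0 < t <= 1 -> F t p = t * g p) -> g p = 0.
Proof.
intros (C & HC & H) Hp E.
apply (le_small_t_eq_0 _ (gr C (2 * ps p + 1))). intros t Ht.
assert (Hs := ok_step_pos d t p ltac:(lra) Hp).
rewrite <- E by easy. eapply Rle_trans; [apply H; easy |].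
rewrite (Rabs_pos_eq t) by lra. apply Rmult_le_compat_r; [nra |].
assert (X := ps_step_le d t p ltac:(lra)). destruct Hp, Hs. apply gr_le; lra.
Qed.

Lemma Tay_unique (d : dir) (f g g' : pt -> R) (p : pt) : Tay d f g -> Tay d f g' -> ok p ->
  g p = g' p.
Proof.
intros H H' Hp. apply Rminus_diag_uniq.
apply (big_O_2_linear d (fun p => g p - g' p) p _
  (big_O_plus _ _ _ _ H' (big_O_scal _ _ (-1) _ H)) Hp).
intros t Ht. ring.
Qed.

(** * Supports, and integration in [q] and in [s] *)

Definition supp (M : R) (f : pt -> R) : Prop := forall p, ok p -> M < Rabs (pq p) -> f p = 0.

Lemma Tay_supp (M : R) (d : dir) (f g : pt -> R) : d <> DQ -> supp M f -> Tay d f g -> supp M g.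
Proof.
intros Hd Hf H p Hp Hq.
apply (big_O_2_linear d g p _ (big_O_scal _ _ (-1) _ H) Hp).
intros t Ht. rewrite !Hf; auto; [ring | | now rewrite pq_step].
apply ok_step_pos; [lra | easy].
Qed.

Lemma supp_mult_l (M : R) (f g : pt -> R) : supp M f -> supp M (fun p => f p * g p).
Proof. intros H p Hp Hq. rewrite H by easy. ring. Qed.

Lemma supp_plus (M : R) (f g : pt -> R) : supp M f -> supp M g -> supp M (fun p => f p + g p).
Proof. intros H H' p Hp Hq. rewrite H, H' by easy. ring. Qed.

Definition slice (f : pt -> R) (w : R * R) (s q : R) : R := f (s, q, w).
(** Nothing is asked in [w]: solutions are first built at each angle separately, and integrability
    in [s] and [q] needs no more. *)
Definition reg (f : pt -> R) : Prop := forall w, circle w -> reg2 (slice f w).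

Definition Iq (M : R) (f : pt -> R) (p : pt) : R := int_q M (slice f (pw p)) (ps p) (pq p).
Definition Js (f : pt -> R) (p : pt) : R := int_s (slice f (pw p)) (ps p) (pq p).

Lemma reg_of_Lip (f : pt -> R) : bnd f -> Lip DS f -> Lip DQ f -> reg f.
Proof.
intros (C & HC & H) (C1 & HC1 & H1) (C2 & HC2 & H2) w Hw T.
assert (HT := Rabs_pos T).
exists (gr C (Rabs T) + gr C1 (2 * Rabs T) + gr C2 (2 * Rabs T)).
assert (P0 := gr_nonneg C (Rabs T) HC). assert (P1 := gr_nonneg C1 (2 * Rabs T) HC1).
assert (P2 := gr_nonneg C2 (2 * Rabs T) HC2).
split; [lra | split].
- intros s q Hs Hq. unfold slice. eapply Rle_trans; [apply H; split; simpl; easy || apply Hs |].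
  apply Rle_trans with (gr C (Rabs T)); [| lra].
  apply gr_le; unfold ps; simpl; try lra. rewrite Rabs_pos_eq; lra.
- intros s s' q q' Hs Hs' Hq Hq'. unfold slice.
  assert (HTs : T = Rabs T) by (rewrite Rabs_pos_eq; lra).
  specialize (H1 (s - s') (s', q, w)). specialize (H2 (q - q') (s', q', w)).
  unfold step, ps, pq, pw in H1, H2. simpl in H1, H2.
  replace (s' + (s - s')) with s in H1 by ring. replace (q' + (q - q')) with q in H2 by ring.
  unfold ok, ps, pw in H1, H2. simpl in H1, H2.
  specialize (H1 ltac:(split; easy || lra) ltac:(split; easy || lra)).
  specialize (H2 ltac:(split; easy || lra) ltac:(split; easy || lra)).
  rewrite Rmult_1_r in H1, H2.
  replace (f (s, q, w) - f (s', q', w)) with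
    ((f (s, q, w) - f (s', q, w)) + (f (s', q, w) - f (s', q', w))) by ring.
  rle Rabs_triang.
  assert (G1 : gr C1 (s' + s) <= gr C1 (2 * Rabs T)) by (apply gr_le; lra).
  assert (G2 : gr C2 (s' + s') <= gr C2 (2 * Rabs T)) by (apply gr_le; lra).
  assert (H3 := Rabs_pos (s - s')). assert (H4 := Rabs_pos (q - q')).
  apply (Rmult_le_compat_r (Rabs (s - s'))) in G1; [| easy].
  apply (Rmult_le_compat_r (Rabs (q - q'))) in G2; [| easy].
  assert (0 <= gr C (Rabs T) * Rabs (s - s')) by nra.
  assert (0 <= gr C (Rabs T) * Rabs (q - q')) by nra.
  assert (0 <= gr C1 (2 * Rabs T) * Rabs (q - q')) by nra.
  assert (0 <= gr C2 (2 * Rabs T) * Rabs (s - s')) by nra.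
  lra.
Qed.

Lemma CK_reg (n : nat) (f : pt -> R) : CK n f -> reg f.
Proof.
intros H. apply reg_of_Lip; [now apply (CK_bnd n) | now apply (CK_Lip n) | now apply (CK_Lip n)].
Qed.

Lemma reg_plus (f g : pt -> R) : reg f -> reg g -> reg (fun p => f p + g p).
Proof. intros Hf Hg w Hw. exact (reg2_plus _ _ (Hf w Hw) (Hg w Hw)). Qed.

Lemma reg_minus (f g : pt -> R) : reg f -> reg g -> reg (fun p => f p - g p).
Proof. intros Hf Hg w Hw. exact (reg2_minus _ _ (Hf w Hw) (Hg w Hw)). Qed.

Lemma reg_mult (f g : pt -> R) : reg f -> reg g -> reg (fun p => f p * g p).
Proof. intros Hf Hg w Hw. exact (reg2_mult _ _ (Hf w Hw) (Hg w Hw)). Qed.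

Lemma reg_scal (c : R) (f : pt -> R) : reg f -> reg (fun p => c * f p).
Proof. intros Hf w Hw. exact (reg2_scal c _ (Hf w Hw)). Qed.

Lemma reg_exp (f : pt -> R) : reg f -> reg (fun p => exp (f p)).
Proof. intros Hf w Hw. exact (reg2_exp _ (Hf w Hw)). Qed.

Lemma reg_abs (f : pt -> R) : reg f -> reg (fun p => Rabs (f p)).
Proof. intros Hf w Hw. exact (reg2_abs _ (Hf w Hw)). Qed.

Lemma reg_Iq (M : R) (f : pt -> R) : reg f -> reg (Iq M f).
Proof. intros Hf w Hw. exact (reg2_int_q M _ (Hf w Hw)). Qed.

Lemma reg_step_w (t : R) (f : pt -> R) : reg f -> reg (fun p => f (step DW t p)).
Proof. intros Hf w Hw. exact (Hf (rot t w) (circle_rot t w Hw)). Qed.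

Lemma reg_ex_q (f : pt -> R) (p : pt) (a b : R) : reg f -> ok p ->
  ex_RInt (fun x => f (ps p, x, pw p)) a b.
Proof. intros Hf [H1 H2]. exact (reg2_ex_q _ _ a b (Hf _ H2) H1). Qed.

Lemma reg_ex_s (f : pt -> R) (p : pt) (a b : R) : reg f -> circle (pw p) -> 0 <= a -> 0 <= b ->
  ex_RInt (fun r => f (r, pq p, pw p)) a b.
Proof. intros Hf H2 Ha Hb. exact (reg2_ex_s _ (pq p) a b (Hf _ H2) Ha Hb). Qed.

Lemma Iq_RInt (M : R) (f : pt -> R) (p : pt) :
  Iq M f p = RInt (fun x => f (ps p, x, pw p)) M (pq p).
Proof. reflexivity. Qed.

Lemma Js_RInt (f : pt -> R) (p : pt) :
  Js f p = RInt (fun r => f (r, pq p, pw p)) 0 (ps p).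
Proof. reflexivity. Qed.

Lemma Js_ext (f g : pt -> R) (p : pt) : ok p -> (forall p, ok p -> f p = g p) -> Js f p = Js g p.
Proof.
intros [H1 H2] E. rewrite !Js_RInt. apply RInt_ext. intros r Hr.
rewrite Rmin_left, Rmax_right in Hr by easy. apply E. split; [unfold ps; simpl; lra | easy].
Qed.

Lemma Iq_plus (M : R) (f g : pt -> R) (p : pt) : ok p -> reg f -> reg g ->
  Iq M (fun p => f p + g p) p = Iq M f p + Iq M g p.
Proof. intros Hp Hf Hg. rewrite !Iq_RInt. apply RInt_add; now apply reg_ex_q. Qed.

Lemma Iq_scal (M c : R) (f : pt -> R) (p : pt) : ok p -> reg f ->
  Iq M (fun p => c * f p) p = c * Iq M f p.
Proof. intros Hp Hf. rewrite !Iq_RInt. apply RInt_mul; now apply reg_ex_q. Qed.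

Lemma Iq_minus (M : R) (f g : pt -> R) (p : pt) : ok p -> reg f -> reg g ->
  Iq M (fun p => f p - g p) p = Iq M f p - Iq M g p.
Proof. intros Hp Hf Hg. rewrite !Iq_RInt. apply RInt_sub; now apply reg_ex_q. Qed.

Lemma Js_scal (c : R) (f : pt -> R) (p : pt) : ok p -> reg f ->
  Js (fun p => c * f p) p = c * Js f p.
Proof. intros [H1 H2] Hf. rewrite !Js_RInt. apply RInt_mul; apply reg_ex_s; easy || lra. Qed.

Lemma Js_minus (f g : pt -> R) (p : pt) : ok p -> reg f -> reg g ->
  Js (fun p => f p - g p) p = Js f p - Js g p.
Proof. intros [H1 H2] Hf Hg. rewrite !Js_RInt. apply RInt_sub; apply reg_ex_s; easy || lra. Qed.

Lemma Iq_bound (M : R) (f : pt -> R) (e : R -> R) (p : pt) : 0 <= M -> ok p -> reg f -> supp M f ->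
  ex_RInt e (- M) M -> (forall x, Rabs x <= M -> Rabs (f (ps p, x, pw p)) <= e x) ->
  Rabs (Iq M f p) <= RInt e (- M) M.
Proof.
intros HM Hp Rf Hs He H. rewrite Iq_RInt. apply abs_RInt_supp; auto.
intros a b. now apply reg_ex_q.
Qed.

Lemma Iq_bound_const (M b : R) (f : pt -> R) (p : pt) : 0 <= M -> ok p -> reg f -> supp M f ->
  (forall x, Rabs x <= M -> Rabs (f (ps p, x, pw p)) <= b) ->
  Rabs (Iq M f p) <= 2 * M * b.
Proof.
intros HM Hp Rf Hs H. eapply Rle_trans.
- apply (Iq_bound M f (fun _ => b)); auto. apply ex_RInt_const.
- rewrite RInt_constant. lra.
Qed.

Lemma s_le_exp (s : R) : s <= exp s.
Proof. assert (H := exp_tangent s). lra. Qed.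

Lemma gr_2M (M C x : R) : 0 <= M -> 0 <= C -> 0 <= x -> 2 * M * gr C x <= gr (2 * M * C + C) x.
Proof.
intros. unfold gr. rewrite <- Rmult_assoc. assert (0 <= M * C) by nra.
apply Rmult_le_compat; [nra | left; apply exp_pos | lra | apply exp_le; nra].
Qed.

(** Integration over [[0, s]] costs a factor [s <= exp s], absorbed by raising the rate by one. *)
Lemma gr_s (C x y : R) : 0 <= C -> 0 <= x -> x <= y -> x * gr C y <= gr (C + 1) y.
Proof.
intros. unfold gr.
replace ((C + 1) * y) with (y + C * y) by ring. rewrite exp_plus.
assert (X := s_le_exp y). assert (Y := exp_pos (C * y)). assert (Z := exp_pos y).
replace (x * (C * exp (C * y))) with (C * (x * exp (C * y))) by ring.
apply Rmult_le_compat; [easy | nra | lra |].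
apply Rmult_le_compat_r; lra.
Qed.

Lemma big_O_Iq (M : R) (d : dir) (k : nat) (F : R -> pt -> R) : 0 <= M -> d <> DQ ->
  (forall t p, ok p -> ok (step d t p) -> M < Rabs (pq p) -> F t p = 0) ->
  (forall t p a b, ok p -> ok (step d t p) -> ex_RInt (fun x => F t (ps p, x, pw p)) a b) ->
  big_O d k F -> big_O d k (fun t p => RInt (fun x => F t (ps p, x, pw p)) M (pq p)).
Proof.
intros HM Hd Hs Hex (C & HC & H). exists (2 * M * C + C). assert (HMC : 0 <= M * C) by nra.
split; [lra |].
intros t p Hp Hp'.
assert (Hok : forall x, ok (ps p, x, pw p) /\ ok (step d t (ps p, x, pw p)) /\
  ps (step d t (ps p, x, pw p)) = ps (step d t p)) by (intros x; now destruct d).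
eapply Rle_trans.
- apply (abs_RInt_supp _ (fun _ => gr C (ps p + ps (step d t p)) * Rabs t ^ k) M (pq p) HM).
  + intros; now apply Hex.
  + apply ex_RInt_const.
  + intros x Hx. destruct (Hok x) as (H1 & H2 & H3). now apply Hs.
  + intros x _. destruct (Hok x) as (H1 & H2 & H3). rewrite <- H3. exact (H t _ H1 H2).
- rewrite RInt_constant.
  assert (X := gr_2M M C (ps p + ps (step d t p)) HM HC ltac:(destruct Hp, Hp'; lra)).
  assert (Y : 0 <= Rabs t ^ k) by apply pow_le, Rabs_pos. nra.
Qed.

Lemma big_O_Js (d : dir) (k : nat) (F : R -> pt -> R) : d <> DS ->
  (forall t p, ok p -> ex_RInt (fun r => F t (r, pq p, pw p)) 0 (ps p)) ->
  big_O d k F -> big_O d k (fun t p => RInt (fun r => F t (r, pq p, pw p)) 0 (ps p)).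
Proof.
intros Hd Hex (C & HC & H). exists (C + 1). split; [lra |].
intros t p Hp _. destruct Hp as [Hp1 Hp2].
rewrite ps_step by easy.
eapply Rle_trans.
- apply (abs_RInt_le_bound _ 0 (ps p) (gr C (ps p + ps p) * Rabs t ^ k)); [now apply Hex |].
  intros r Hr. rewrite Rmin_left, Rmax_right in Hr by easy.
  assert (Ho : ok (r, pq p, pw p)) by (split; [unfold ps; simpl; lra | easy]).
  eapply Rle_trans; [apply H; [easy | now apply ok_step] |].
  rewrite ps_step by easy.
  apply Rmult_le_compat_r; [apply pow_le, Rabs_pos |]. unfold ps at 1 2. simpl. apply gr_le; lra.
- rewrite Rminus_0_r, (Rabs_pos_eq (ps p)) by easy.
  assert (X := gr_s C (ps p) (ps p + ps p) HC Hp1 ltac:(lra)).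
  assert (Y : 0 <= Rabs t ^ k) by apply pow_le, Rabs_pos. nra.
Qed.

Lemma bnd_Iq (M : R) (f : pt -> R) : 0 <= M -> reg f -> supp M f -> bnd f -> bnd (Iq M f).
Proof.
intros HM Rf Hs (C & HC & H). exists (2 * M * C + C). assert (0 <= M * C) by nra.
split; [lra |]. intros p Hp.
eapply Rle_trans; [apply (Iq_bound_const M (gr C (ps p))); auto |].
- intros x _. apply (H (ps p, x, pw p)). exact Hp.
- apply gr_2M; auto. apply Hp.
Qed.

Lemma bnd_Js (f : pt -> R) : reg f -> bnd f -> bnd (Js f).
Proof.
intros Rf (C & HC & H). exists (C + 1). split; [lra |]. intros p [H1 H2]. rewrite Js_RInt.
eapply Rle_trans.
- apply abs_RInt_le_bound with (C := gr C (ps p)); [apply reg_ex_s; easy || lra |].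
  intros r Hr. rewrite Rmin_left, Rmax_right in Hr by easy.
  eapply Rle_trans; [apply H; split; [unfold ps; simpl; lra | easy] |].
  apply gr_le; unfold ps in *; simpl; lra.
- rewrite Rminus_0_r, Rabs_pos_eq, Rmult_comm by easy. apply gr_s; lra.
Qed.

(** Integration in [q] is linear and commutes with steps in [s] and [w]. With [k = 1] and [g = 0]
    this yields Lipschitz bounds, with [k = 2] Taylor bounds. *)
Lemma Iq_increment (M : R) (k : nat) (d : dir) (f g : pt -> R) : 0 <= M -> d <> DQ ->
  reg f -> reg g -> supp M f -> supp M g ->
  big_O d k (fun t p => f (step d t p) - f p - t * g p) ->
  big_O d k (fun t p => Iq M f (step d t p) - Iq M f p - t * Iq M g p).
Proof.
intros HM Hd Rf Rg Hs Hsg H.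
assert (Ex : forall t p a b, ok p -> ok (step d t p) ->
  ex_RInt (fun x => f (step d t (ps p, x, pw p))) a b).
{ intros t p a b Hp Hp'. destruct d; [| easy |];
  exact (reg_ex_q f _ a b Rf Hp'). }
assert (Ex2 : forall t p a b, ok p -> ok (step d t p) ->
  ex_RInt (fun x => f (step d t (ps p, x, pw p)) - f (ps p, x, pw p)) a b).
{ intros t p a b Hp Hp'.
  exact (ex_RInt_sub _ _ _ _ (Ex t p a b Hp Hp') (reg_ex_q f p a b Rf Hp)). }
assert (Ex3 : forall t p a b, ok p -> ex_RInt (fun x => t * g (ps p, x, pw p)) a b).
{ intros t p a b Hp. exact (ex_RInt_mul _ _ _ _ (reg_ex_q g p a b Rg Hp)). }
assert (X := big_O_Iq M d k (fun t p => f (step d t p) - f p - t * g p) HM Hd).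
simpl in X.
apply (big_O_ext _ _ _ _ (X ltac:(
  intros t p Hp Hp' Hq; rewrite !Hs, Hsg; auto; [ring | now rewrite pq_step])
  ltac:(intros t p a b Hp Hp';
    exact (ex_RInt_sub _ _ _ _ (Ex2 t p a b Hp Hp') (Ex3 t p a b Hp))) H)).
intros t p Hp Hp'.
rewrite (RInt_sub _ _ _ _ (Ex2 t p _ _ Hp Hp') (Ex3 t p _ _ Hp)).
rewrite (RInt_sub _ _ _ _ (Ex t p _ _ Hp Hp') (reg_ex_q f p _ _ Rf Hp)).
rewrite (RInt_mul _ _ _ _ (reg_ex_q g p _ _ Rg Hp)).
destruct d; easy.
Qed.

Lemma reg_const (c : R) : reg (fun _ => c).
Proof. intros w _. exact (reg2_const c). Qed.

Lemma Lip_Iq_other (M : R) (d : dir) (f : pt -> R) : 0 <= M -> d <> DQ -> reg f -> supp M f ->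
  Lip d f -> Lip d (Iq M f).
Proof.
intros HM Hd Rf Hs H.
apply big_O_ext with (fun t p => Iq M f (step d t p) - Iq M f p - t * Iq M (fun _ => 0) p).
- apply Iq_increment; auto using reg_const; [easy |].
  apply (big_O_ext _ _ _ _ H). intros; ring.
- intros t p _ _. rewrite (Iq_RInt M (fun _ => 0)), RInt_constant. ring.
Qed.

Lemma Tay_Iq_other (M : R) (d : dir) (f g : pt -> R) : 0 <= M -> d <> DQ -> reg f -> reg g ->
  supp M f -> Tay d f g -> Tay d (Iq M f) (Iq M g).
Proof.
intros HM Hd Rf Rg Hs H. apply Iq_increment; auto. now apply (Tay_supp M d f g).
Qed.

Lemma Lip_Iq_q (M : R) (f : pt -> R) : reg f -> bnd f -> Lip DQ (Iq M f).
Proof.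
intros Rf (C & HC & H). exists C. split; [easy |]. intros t p Hp _.
change (Rabs (RInt (fun x => f (ps p, x, pw p)) M (pq p + t) - RInt (fun x => f (ps p, x, pw p)) M (pq p))
  <= gr C (ps p + ps p) * Rabs t ^ 1).
rewrite (RInt_cut _ M (pq p) (pq p + t)) by now apply reg_ex_q.
rewrite Rplus_minus_l.
eapply Rle_trans.
- apply abs_RInt_le_bound with (C := gr C (ps p)); [now apply reg_ex_q |].
  intros x _. apply (H (ps p, x, pw p)). exact Hp.
- replace (pq p + t - pq p) with t by ring. rewrite pow_1.
  apply Rmult_le_compat_r; [apply Rabs_pos |]. destruct Hp. apply gr_le; lra.
Qed.

Lemma Tay_Iq_q (M : R) (f : pt -> R) : reg f -> Lip DQ f -> Tay DQ (Iq M f) f.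
Proof.
intros Rf (C & HC & H). exists C. split; [easy |]. intros t p Hp _.
change (Rabs (RInt (fun x => f (ps p, x, pw p)) M (pq p + t) - RInt (fun x => f (ps p, x, pw p)) M (pq p)
  - t * f p) <= gr C (ps p + ps p) * Rabs t ^ 2).
rewrite (RInt_cut _ M (pq p) (pq p + t)) by now apply reg_ex_q.
assert (E : RInt (fun _ => f p) (pq p) (pq p + t) = t * f p :> R) by (rewrite RInt_constant; ring).
rewrite Rplus_minus_l.
rewrite <- E, <- RInt_sub by (apply ex_RInt_const || now apply reg_ex_q).
eapply Rle_trans.
- apply abs_RInt_le_bound with (C := gr C (ps p + ps p) * Rabs t).
  + apply ex_RInt_sub; [now apply reg_ex_q | apply ex_RInt_const].
  + intros x Hx. specialize (H (x - pq p) p Hp).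
    unfold step in H. replace (pq p + (x - pq p)) with x in H by ring.
    specialize (H Hp). rewrite pow_1 in H. unfold ps at 3 in H; simpl in H.
    fold (ps p) in H. rle H.
    apply Rmult_le_compat_l; [now apply gr_nonneg |].
    revert Hx. unfold Rmin, Rmax, Rabs. repeat destruct Rle_dec; repeat destruct Rcase_abs; lra.
- replace (pq p + t - pq p) with t by ring. right. ring.
Qed.

(** The derivative in [q] is [f] itself; in the other directions it is [Iq] of a derivative of [f],
    whose support still lies in [[-M, M]]. *)
Lemma CK_Iq (M : R) (n : nat) (f : pt -> R) : 0 <= M -> supp M f -> CK n f -> CK n (Iq M f).
Proof.
intros HM. revert f. induction n as [| n IH]; intros f Hs Hf.
all: assert (Rf := CK_reg _ _ Hf); assert (Bf := CK_bnd _ _ Hf);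
  assert (Lf := fun d => CK_Lip _ _ d Hf).
all: assert (Lip_f : forall d, Lip d (Iq M f)) by
  (intros [| |]; [now apply Lip_Iq_other | now apply Lip_Iq_q | now apply Lip_Iq_other]).
all: split; [now apply bnd_Iq | split; [easy |]].
- easy.
- assert (Hf1 := CK_down _ _ Hf). destruct Hf as (_ & _ & f' & Hf).
  exists (fun d => match d with DQ => f | _ => Iq M (f' d) end).
  intros [| |].
  + destruct (Hf DS) as [H1 H2]. split.
    * apply Tay_Iq_other; auto; [easy | now apply (CK_reg n)].
    * apply IH; [now apply (Tay_supp M DS f) | easy].
  + split; [now apply Tay_Iq_q | easy].
  + destruct (Hf DW) as [H1 H2]. split.
    * apply Tay_Iq_other; auto; [easy | now apply (CK_reg n)].
    * apply IH; [now apply (Tay_supp M DW f) | easy].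
Qed.

Lemma Js_increment (k : nat) (d : dir) (f g : pt -> R) : d <> DS -> reg f -> reg g ->
  big_O d k (fun t p => f (step d t p) - f p - t * g p) ->
  big_O d k (fun t p => Js f (step d t p) - Js f p - t * Js g p).
Proof.
intros Hd Rf Rg H.
assert (Ex : forall t p, ok p -> ex_RInt (fun r => f (step d t (r, pq p, pw p))) 0 (ps p)).
{ intros t p [H1 H2]. destruct d; [easy | |].
  - exact (reg_ex_s f (ps p, pq p + t, pw p) 0 (ps p) Rf H2 (Rle_refl 0) H1).
  - exact (reg_ex_s f (ps p, pq p, rot t (pw p)) 0 (ps p) Rf (circle_rot t _ H2) (Rle_refl 0) H1). }
assert (Ex0 : forall f p, reg f -> ok p -> ex_RInt (fun r => f (r, pq p, pw p)) 0 (ps p)).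
{ intros f0 p Rf0 [H1 H2]. apply reg_ex_s; easy || lra. }
assert (Ex2 : forall t p, ok p ->
  ex_RInt (fun r => f (step d t (r, pq p, pw p)) - f (r, pq p, pw p)) 0 (ps p)).
{ intros t p Hp. exact (ex_RInt_sub _ _ _ _ (Ex t p Hp) (Ex0 f p Rf Hp)). }
assert (Ex3 : forall t p, ok p -> ex_RInt (fun r => t * g (r, pq p, pw p)) 0 (ps p)).
{ intros t p Hp. exact (ex_RInt_mul _ _ _ _ (Ex0 g p Rg Hp)). }
assert (X := big_O_Js d k (fun t p => f (step d t p) - f p - t * g p) Hd). simpl in X.
apply (big_O_ext _ _ _ _ (X ltac:(
  intros t p Hp; exact (ex_RInt_sub _ _ _ _ (Ex2 t p Hp) (Ex3 t p Hp))) H)).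
intros t p Hp Hp'.
rewrite (RInt_sub _ _ _ _ (Ex2 t p Hp) (Ex3 t p Hp)).
rewrite (RInt_sub _ _ _ _ (Ex t p Hp) (Ex0 f p Rf Hp)).
rewrite (RInt_mul _ _ _ _ (Ex0 g p Rg Hp)).
destruct d; easy.
Qed.

Lemma Lip_Js_other (d : dir) (f : pt -> R) : d <> DS -> reg f -> Lip d f -> Lip d (Js f).
Proof.
intros Hd Rf H.
apply big_O_ext with (fun t p => Js f (step d t p) - Js f p - t * Js (fun _ => 0) p).
- apply Js_increment; auto using reg_const. apply (big_O_ext _ _ _ _ H). intros; ring.
- intros t p _ _. rewrite (Js_RInt (fun _ => 0)), RInt_constant. ring.
Qed.

Lemma Tay_Js_other (d : dir) (f g : pt -> R) : d <> DS -> reg f -> reg g ->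
  Tay d f g -> Tay d (Js f) (Js g).
Proof. apply Js_increment. Qed.

Lemma Lip_Js_s (f : pt -> R) : reg f -> bnd f -> Lip DS (Js f).
Proof.
intros Rf (C & HC & H). exists C. split; [easy |]. intros t p [H1 H2] [H3 _].
unfold step, ps in H3; simpl in H3; fold (ps p) in H3.
change (Rabs (RInt (fun r => f (r, pq p, pw p)) 0 (ps p + t) - RInt (fun r => f (r, pq p, pw p)) 0 (ps p))
  <= gr C (ps p + (ps p + t)) * Rabs t ^ 1).
rewrite (RInt_cut _ 0 (ps p) (ps p + t)) by (apply reg_ex_s; easy || lra).
rewrite Rplus_minus_l.
eapply Rle_trans.
- apply abs_RInt_le_bound with (C := gr C (ps p + (ps p + t))); [apply reg_ex_s; easy || lra |].
  intros r Hr.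
  assert (Hr' : 0 <= r <= ps p + (ps p + t)).
  { revert Hr. unfold Rmin, Rmax. repeat destruct Rle_dec; lra. }
  eapply Rle_trans; [apply H; split; [apply Hr' | easy] |]. change (ps (r, pq p, pw p)) with r.
  apply gr_le; lra.
- replace (ps p + t - ps p) with t by ring. rewrite pow_1. apply Rle_refl.
Qed.

Lemma Tay_Js_s (f : pt -> R) : reg f -> Lip DS f -> Tay DS (Js f) f.
Proof.
(* An intermediate [r] satisfies [s + r <= 2 (s + (s + t))], whence the doubled constant. *)
intros Rf (C & HC & H). exists (2 * C). split; [lra |]. intros t p Hp [H3 _].
assert (Hp' := Hp). destruct Hp' as [H1 H2].
unfold step, ps in H3; simpl in H3; fold (ps p) in H3.
change (Rabs (RInt (fun r => f (r, pq p, pw p)) 0 (ps p + t) - RInt (fun r => f (r, pq p, pw p)) 0 (ps p)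
  - t * f p) <= gr (2 * C) (ps p + (ps p + t)) * Rabs t ^ 2).
rewrite (RInt_cut _ 0 (ps p) (ps p + t)) by (apply reg_ex_s; easy || lra).
assert (E : RInt (fun _ => f p) (ps p) (ps p + t) = t * f p :> R) by (rewrite RInt_constant; ring).
rewrite Rplus_minus_l.
rewrite <- E, <- RInt_sub by (apply ex_RInt_const || (apply reg_ex_s; easy || lra)).
eapply Rle_trans.
- apply abs_RInt_le_bound with (C := gr (2 * C) (ps p + (ps p + t)) * Rabs t).
  + apply ex_RInt_sub; [apply reg_ex_s; easy || lra | apply ex_RInt_const].
  + intros r Hr.
    assert (Hr' : 0 <= r <= ps p + (ps p + t)).
    { revert Hr. unfold Rmin, Rmax. repeat destruct Rle_dec; lra. }
    specialize (H (r - ps p) p Hp).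
    unfold step in H. replace (ps p + (r - ps p)) with r in H by ring.
    specialize (H (conj (proj1 Hr') H2)). rewrite pow_1 in H.
    change (ps (r, pq p, pw p)) with r in H.
    rle H.
    apply Rmult_le_compat; [now apply gr_nonneg | apply Rabs_pos | |].
    * eapply Rle_trans; [| apply gr_double; lra]. apply gr_le; lra.
    * revert Hr. unfold Rmin, Rmax, Rabs. repeat destruct Rle_dec; repeat destruct Rcase_abs; lra.
- replace (ps p + t - ps p) with t by ring. right. ring.
Qed.

Lemma CK_Js (n : nat) (f : pt -> R) : CK n f -> CK n (Js f).
Proof.
revert f. induction n as [| n IH]; intros f Hf.
all: assert (Rf := CK_reg _ _ Hf); assert (Bf := CK_bnd _ _ Hf);
  assert (Lf := fun d => CK_Lip _ _ d Hf).
all: assert (Lip_f : forall d, Lip d (Js f)) by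
  (intros [| |]; [now apply Lip_Js_s | now apply Lip_Js_other | now apply Lip_Js_other]).
all: split; [now apply bnd_Js | split; [easy |]].
- easy.
- assert (Hf1 := CK_down _ _ Hf). destruct Hf as (_ & _ & f' & Hf).
  exists (fun d => match d with DS => f | _ => Js (f' d) end).
  intros [| |].
  + split; [now apply Tay_Js_s | easy].
  + destruct (Hf DQ) as [H1 H2]. split; [| now apply IH].
    apply Tay_Js_other; auto; [easy | now apply (CK_reg n)].
  + destruct (Hf DW) as [H1 H2]. split; [| now apply IH].
    apply Tay_Js_other; auto; [easy | now apply (CK_reg n)].
Qed.

(** * Regularity in the angular variable *)

(* A Gronwall inequality: an a priori bound [S * exp (L * s)] on [r] improves to
   [(A + S / 2) * exp (L * s)], hence by iteration to [2 * A * exp (L * s)]. *)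
Lemma perturbation (M L0 : R) (k : nat) (r F rho eps Z : R -> pt -> R) :
  0 <= M -> 0 <= L0 ->
  (forall t, reg (r t)) -> (forall t, reg (F t)) -> (forall t, reg (rho t)) ->
  (forall t, reg (eps t)) -> (forall t, supp M (F t)) ->
  (forall t p, ok p -> r t p = Js (fun p => Iq M (F t) p + rho t p) p) ->
  (forall t p, ok p -> Rabs (F t p) <= eps t p * Rabs (r t p) + Z t p) ->
  (forall t p, ok p -> 0 <= eps t p) ->
  (forall t p, ok p -> RInt (fun x => eps t (ps p, x, pw p)) (- M) M <= L0) ->
  big_O DW k Z -> big_O DW k rho -> big_O DW k r.
Proof.
intros HM HL0 Rr RF Rrho Reps HsF Hr HF Heps Hmass (C & HC & HZ) (C' & HC' & Hrho).
(* In [L], the part [2 * C1] covers growth measured at [s + s], [2 * L0] makes [L0 / L <= 1 / 2],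
   and [1] keeps [L >= 1]. In [A0], the factor [2 * M] comes from integrating [Z] over [[-M, M]] and
   [1] from [rho]. *)
set (C1 := C + C'). set (L := 2 * C1 + 2 * L0 + 1).
assert (HC1 : 0 <= C1) by (unfold C1; lra). assert (HL : 0 < L) by (unfold L; lra).
set (A0 := (2 * M + 1) * C1). assert (HA0 : 0 <= A0) by (unfold A0; nra).
assert (Hgr : forall D x, 0 <= D <= C1 -> 0 <= x -> gr D (x + x) <= C1 * exp (L * x)).
{ intros D x HD Hx. apply Rle_trans with (gr C1 (x + x)); [apply gr_le; lra |].
  unfold gr. apply Rmult_le_compat_l; [easy |]. apply exp_le. unfold L. nra. }
assert (HCC : 0 <= C <= C1 /\ 0 <= C' <= C1) by (unfold C1; lra).
assert (Hmain : forall t s w q, 0 <= s -> circle w ->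
  Rabs (r t (s, q, w)) <= 2 * (A0 * Rabs t ^ k) * exp (L * s)).
{ intros t s w q Hs Hw. set (A := A0 * Rabs t ^ k).
  assert (Htk : 0 <= Rabs t ^ k) by apply pow_le, Rabs_pos.
  assert (HA : 0 <= A) by (unfold A; nra).
  (* The bound is required only for [|x| <= M], where [F] is supported, but it is improved at every
     [x]. *)
  assert (Himp : forall S, 0 <= S ->
    (forall s' x, 0 <= s' <= s -> Rabs x <= M -> Rabs (r t (s', x, w)) <= S * exp (L * s')) ->
    forall s' x, 0 <= s' <= s -> Rabs (r t (s', x, w)) <= (A + S / 2) * exp (L * s')).
  { intros S HS H s' x Hs'. rewrite Hr by (split; [apply Hs' | easy]).
    apply Rle_trans with ((L0 * S + A) / L * exp (L * s')).
    - change (Rabs (int_s (slice (fun p => Iq M (F t) p + rho t p) w) s' x) <=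
        (L0 * S + A) / L * exp (L * s')).
      apply int_s_exp_bound; [| easy | apply Hs' |].
      { apply (reg_plus _ _ (reg_Iq M _ (RF t)) (Rrho t)). easy. }
      intros u Hu. unfold slice.
      assert (Hou : ok (u, x, w)) by (split; [apply Hu | easy]).
      rle Rabs_triang.
      assert (E1 : Rabs (rho t (u, x, w)) <= C1 * exp (L * u) * Rabs t ^ k).
      { eapply Rle_trans; [apply Hrho; [easy | now apply ok_step] |].
        apply Rmult_le_compat_r; [easy |]. apply Hgr; [lra | apply Hu]. }
      assert (E2 : Rabs (Iq M (F t) (u, x, w)) <=
        S * exp (L * u) * L0 + 2 * M * (C1 * exp (L * u) * Rabs t ^ k)).
      { assert (Ie : ex_RInt (fun x => eps t (u, x, w)) (- M) M).
        { exact (reg_ex_q _ (u, x, w) (- M) M (Reps t) Hou). }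
        eapply Rle_trans.
        - apply (Iq_bound M (F t) (fun x => S * exp (L * u) * eps t (u, x, w)
            + C1 * exp (L * u) * Rabs t ^ k)); auto.
          + apply ex_RInt_add; [| apply ex_RInt_const].
            now apply ex_RInt_mul.
          + intros y Hy. change (ps (u, x, w)) with u. change (pw (u, x, w)) with w.
            assert (Hoy : ok (u, y, w)) by easy.
            eapply Rle_trans; [now apply HF |].
            apply Rplus_le_compat.
            * rewrite (Rmult_comm _ (eps t _)). apply Rmult_le_compat_l; [now apply Heps |].
              apply H; lra.
            * rle Rle_abs.
              eapply Rle_trans; [apply HZ; [easy | now apply ok_step] |].
              apply Rmult_le_compat_r; [easy |]. apply Hgr; [lra | apply Hu].
        - rewrite RInt_add, RInt_mul, RInt_constant by
            (easy || apply ex_RInt_const || now apply ex_RInt_mul).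
          assert (X := Hmass t (u, x, w) Hou). change (ps (u, x, w)) with u in X.
          change (pw (u, x, w)) with w in X.
          assert (0 <= S * exp (L * u)) by (apply Rmult_le_pos; [easy | left; apply exp_pos]).
          nra. }
      eapply Rle_trans; [apply Rplus_le_compat; [apply E2 | apply E1] |].
      right. unfold A, A0. ring.
    - apply Rmult_le_compat_r; [left; apply exp_pos |].
      apply Rmult_le_reg_r with L; [easy |].
      unfold Rdiv. rewrite Rmult_assoc, Rinv_l, Rmult_1_r by lra. unfold L. nra. }
  (* This starting bound is mere local boundedness and may depend on [t] and [w]; the iteration
     removes it and leaves constants uniform in both. *)
  destruct (Rr t w Hw (Rmax s M)) as (S0 & HS0 & Hb & _).
  assert (HSM := Rmax_l s M). assert (HSM' := Rmax_r s M).
  assert (Hit : forall n s' x, 0 <= s' <= s -> Rabs x <= M ->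
    Rabs (r t (s', x, w)) <= (2 * A + S0 * (/ 2) ^ n) * exp (L * s')).
  { induction n as [| n IH]; intros s' x Hs' Hx.
    - rewrite pow_O, Rmult_1_r.
      assert (X := Hb s' x ltac:(lra) ltac:(lra)). unfold slice in X.
      assert (1 <= exp (L * s')) by (apply exp_ge_1; nra). nra.
    - assert (0 <= S0 * (/ 2) ^ n) by (apply Rmult_le_pos; [easy | apply pow_le; lra]).
      eapply Rle_trans; [apply (Himp (2 * A + S0 * (/ 2) ^ n)); [lra | exact IH | easy] |].
      right. simpl. field. }
  apply Rnot_lt_le. intros Hlt.
  assert (Z0 : Rabs (r t (s, q, w)) - 2 * A * exp (L * s) = 0); [| lra].
  apply (le_geometric_eq_0 _ (S0 * exp (L * s))). intros n.
  rewrite Rabs_pos_eq by lra.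
  assert (0 <= S0 * (/ 2) ^ n) by (apply Rmult_le_pos; [easy | apply pow_le; lra]).
  assert (X := Himp (2 * A + S0 * (/ 2) ^ n) ltac:(lra) (Hit n) s q ltac:(lra)).
  assert (He := exp_pos (L * s)). nra. }
exists (2 * A0 + L). split; [lra |]. intros t [[s q] w] [Hs Hw] _.
change (0 <= s) in Hs. change (circle w) in Hw.
change (Rabs (r t (s, q, w)) <= gr (2 * A0 + L) (s + s) * Rabs t ^ k).
eapply Rle_trans; [now apply Hmain |].
replace (2 * (A0 * Rabs t ^ k) * exp (L * s)) with (2 * A0 * exp (L * s) * Rabs t ^ k) by ring.
apply Rmult_le_compat_r; [apply pow_le, Rabs_pos |]. unfold gr.
assert (0 <= A0 * s) by nra. assert (0 <= L * s) by nra.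
apply Rmult_le_compat; [lra | left; apply exp_pos | lra | apply exp_le; lra].
Qed.

Lemma Js_step_w (t : R) (f : pt -> R) (p : pt) :
  Js f (step DW t p) = Js (fun p => f (step DW t p)) p.
Proof. reflexivity. Qed.

Lemma Iq_step_w (M t : R) (f : pt -> R) (p : pt) :
  Iq M f (step DW t p) = Iq M (fun p => f (step DW t p)) p.
Proof. reflexivity. Qed.

(** * Linear nonlocal equations *)

Definition mass_le (M L0 : R) (e : pt -> R) : Prop :=
  forall p, ok p -> RInt (fun x => Rabs (e (ps p, x, pw p))) (- M) M <= L0.

Definition solves_linear (M : R) (e f k : pt -> R) : Prop :=
  forall p, ok p -> k p = Js (fun p => Iq M (fun p => e p * k p) p + f p) p.

(** Different angles are not coupled, so Picard iteration is run at each [w] and the solutions are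
    collected by choice. Regularity in [w] has to come from [perturbation]. *)
Lemma linear_exists (M : R) (e f : pt -> R) : 0 <= M -> reg e -> supp M e -> reg f ->
  exists k, reg k /\ solves_linear M e f k.
Proof.
intros HM Re Hs Rf.
assert (H : forall w, exists k : R -> R -> R, circle w -> reg2 k /\
  forall s q, 0 <= s -> k s q = int_s (picard_op M (fun y => y)
    (fun s x y => slice e w s x * y) (slice f w) k) s q).
{ intros w. destruct (classic (circle w)) as [Hw | Hw].
  - destruct (picard M (fun y => y) (fun s x y => slice e w s x * y) (slice f w)) as (k & H1 & H2); auto.
    + intros; lra.
    + intros k Hk. apply reg2_mult; auto.
    + intros s x y Hs' Hx. unfold slice. rewrite Hs; [ring | now split | easy].
    + intros T. destruct (reg2_le_bound _ (Rmax T M) (Re w Hw)) as (L & HL & HL').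
      exists L. split; [easy |]. intros s x y y' Hs' Hx. rewrite <- Rmult_minus_distr_l, Rabs_mult.
      apply Rmult_le_compat_r; [apply Rabs_pos |].
      assert (X1 := Rmax_l T M). assert (X2 := Rmax_r T M). apply HL'; lra.
    + now exists k.
  - exists (fun _ _ => 0). easy. }
set (K := fun w => proj1_sig (constructive_indefinite_description _ (H w))).
assert (HK : forall w, circle w -> reg2 (K w) /\
  forall s q, 0 <= s -> K w s q = int_s (picard_op M (fun y => y)
    (fun s x y => slice e w s x * y) (slice f w) (K w)) s q).
{ intros w Hw. unfold K. destruct constructive_indefinite_description as [k Hk]. simpl. auto. }
exists (fun p => K (pw p) (ps p) (pq p)). split.
- intros w Hw. exact (proj1 (HK w Hw)).
- intros [[s q] w] [Hp Hw]. exact (proj2 (HK w Hw) s q Hp).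
Qed.

Lemma reg_Iq_plus (M : R) (g f : pt -> R) : reg g -> reg f -> reg (fun p => Iq M g p + f p).
Proof. intros Hg Hf. apply reg_plus; [now apply reg_Iq | easy]. Qed.

(** This is [perturbation] at order [0], for the family [r t = k] that does not depend on the
    increment. *)
Lemma linear_bnd (M L0 : R) (e f k : pt -> R) : 0 <= M -> 0 <= L0 -> reg e -> reg f -> reg k ->
  supp M e -> mass_le M L0 e -> bnd f -> solves_linear M e f k -> bnd k.
Proof.
intros HM HL0 Re Rf Rk Hs Hmass Bf Hk. apply bnd_of_big_O.
apply (perturbation M L0 0 (fun _ => k) (fun _ p => e p * k p) (fun _ => f)
  (fun _ p => Rabs (e p)) (fun _ _ => 0)); auto.
- intros _. now apply reg_mult.
- intros _. now apply reg_abs.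
- intros _. now apply supp_mult_l.
- intros _ p Hp. rewrite Rabs_mult. lra.
- intros; apply Rabs_pos.
- apply big_O_const.
- now apply big_O_here.
Qed.

(** The difference of [k] at two angles solves a linear equation whose coefficient is [e] at the
    rotated angle and whose sources are of order [t]. *)
Lemma linear_Lip_w (M L0 : R) (e f k : pt -> R) : 0 <= M -> 0 <= L0 -> CK 0 e -> CK 0 f -> reg k ->
  bnd k -> supp M e -> mass_le M L0 e -> solves_linear M e f k -> Lip DW k.
Proof.
intros HM HL0 He Hf Rk Bk Hs Hmass Hk.
assert (Re := CK_reg _ _ He). assert (Rf := CK_reg _ _ Hf).
assert (Rek : reg (fun p => e p * k p)) by now apply reg_mult.
apply (perturbation M L0 1 _
  (fun t p => e (step DW t p) * k (step DW t p) - e p * k p)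
  (fun t p => f (step DW t p) - f p)
  (fun t p => Rabs (e (step DW t p)))
  (fun t p => Rabs ((e (step DW t p) - e p) * k p))); auto.
- intros t. apply reg_minus; [now apply reg_step_w | easy].
- intros t. apply reg_minus; [exact (reg_step_w t _ Rek) | easy].
- intros t. apply reg_minus; [now apply reg_step_w | easy].
- intros t. apply reg_abs. now apply reg_step_w.
- intros t p Hp Hq. rewrite !Hs; auto; [ring | now apply ok_step].
- intros t p Hp. rewrite (Hk p Hp), (Hk (step DW t p)) by now apply ok_step.
  rewrite Js_step_w, <- Js_minus; auto.
  + apply Js_ext; [easy |]. intros p' Hp'. rewrite Iq_step_w, Iq_minus; auto; [ring |].
    exact (reg_step_w t _ Rek).
  + exact (reg_step_w t _ (reg_Iq_plus M _ _ Rek Rf)).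
  + now apply reg_Iq_plus.
- intros t p Hp. rewrite <- Rabs_mult.
  replace (e (step DW t p) * k (step DW t p) - e p * k p) with
    (e (step DW t p) * (k (step DW t p) - k p) + (e (step DW t p) - e p) * k p) by ring.
  apply Rabs_triang.
- intros; apply Rabs_pos.
- intros t p Hp. exact (Hmass (step DW t p) (ok_step DW t p ltac:(easy) Hp)).
- apply big_O_abs. exact (big_O_mult DW 1 0 _ _ (CK_Lip _ _ DW He) (big_O_here DW k Bk)).
- apply (CK_Lip _ _ DW Hf).
Qed.

(** Derivatives in [s] and [q] are read off the equation. For [w], the differentiated equation has
    the same coefficient [e], so the induction hypothesis puts its solution [l] in [CK n];
    [perturbation] at order [2] then shows that [l] is the derivative of [k]. *)
Lemma linear_CK (M L0 : R) (n : nat) (e f k : pt -> R) : 0 <= M -> 0 <= L0 ->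
  CK n e -> CK n f -> reg k -> supp M e -> mass_le M L0 e -> solves_linear M e f k -> CK n k.
Proof.
intros HM HL0. revert e f k. induction n as [| n IH]; intros e f k He Hf Rk Hs Hmass Hk;
assert (Re := CK_reg _ _ He); assert (Rf := CK_reg _ _ Hf);
assert (Rek : reg (fun p => e p * k p)) by (now apply reg_mult);
set (F := fun p => Iq M (fun p => e p * k p) p + f p) in *;
assert (RF : reg F) by (now apply reg_Iq_plus);
assert (Hsk : supp M (fun p => e p * k p)) by (now apply supp_mult_l);
assert (EF : forall p, ok p -> Js F p = k p) by (intros p Hp; symmetry; now apply Hk);
assert (Bk : bnd k) by (apply (linear_bnd M L0 e f k); auto; now apply (CK_bnd _ _ Hf));
assert (Bek : bnd (fun p => e p * k p)) by (apply bnd_mult; [now apply (CK_bnd _ _ He) | easy]);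
assert (BF : bnd F) by (apply bnd_plus; [now apply bnd_Iq | now apply (CK_bnd _ _ Hf)]);
assert (Lk : forall d, Lip d k) by
 (intros [| |];
  [ apply (Lip_ext DS _ _ EF); now apply Lip_Js_s
  | apply (Lip_ext DQ _ _ EF); apply Lip_Js_other; [easy | easy |];
    apply Lip_plus; [now apply Lip_Iq_q | apply (CK_Lip _ _ DQ Hf)]
  | apply (linear_Lip_w M L0 e f k); eauto using CK_0]).
- split; [easy | split; easy].
- assert (Ck : CK n k) by (apply (IH e f); auto; now apply CK_down).
  assert (He1 := CK_down _ _ He). assert (Hf1 := CK_down _ _ Hf).
  assert (Cek : CK n (fun p => e p * k p)) by now apply CK_mult.
  destruct He as (_ & _ & e' & He), Hf as (_ & _ & f' & Hf).
  (* The source obtained by formally differentiating the equation in [w] with [k] kept fixed. *)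
  set (g := fun p => Iq M (fun p => e' DW p * k p) p + f' DW p).
  assert (Hse : supp M (e' DW)) by (apply (Tay_supp M DW e); [easy | easy | apply He]).
  assert (Hsek : supp M (fun p => e' DW p * k p)) by now apply supp_mult_l.
  assert (Cek' : CK n (fun p => e' DW p * k p)) by (apply CK_mult; [apply He | easy]).
  assert (Cg : CK n g) by (apply CK_plus; [now apply CK_Iq | apply Hf]).
  destruct (linear_exists M e g) as (l & Rl & Hl); auto; [now apply (CK_reg n) |].
  assert (Cl : CK n l) by now apply (IH e g).
  split; [easy | split; [easy |]].
  exists (fun d => match d with DS => F | DQ => Js (fun p => e p * k p + f' DQ p) | DW => l end).
  intros [| |]; split.
  + apply (Tay_ext DS _ _ _ _ EF (fun p _ => eq_refl)). apply Tay_Js_s; [easy |].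
    apply Lip_plus; [| apply (CK_Lip _ _ DS Hf1)].
    apply Lip_Iq_other; auto; [easy | apply (CK_Lip _ _ DS Cek)].
  + apply CK_plus; [now apply CK_Iq | easy].
  + apply (Tay_ext DQ _ _ _ _ EF (fun p _ => eq_refl)). apply Tay_Js_other; [easy | easy | |].
    * apply reg_plus; [easy | apply (CK_reg n), Hf].
    * apply Tay_plus; [| apply Hf]. apply Tay_Iq_q; [easy | apply (CK_Lip _ _ DQ Cek)].
  + apply CK_Js, CK_plus; [easy | apply Hf].
  + assert (Rel : reg (fun p => e p * l p)) by now apply reg_mult.
    assert (Rek' := CK_reg _ _ Cek').
    assert (Rfw : reg (f' DW)) by (apply (CK_reg n), Hf).
    assert (Rg := CK_reg _ _ Cg).
    (* Writing [e1], [k1] for values at the rotated angle and [ew] for [e' DW]: [e1 k1 - e k - t (e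
       l + ew k) = e1 (k1 - k - t l) + (e1 - e - t ew) k + t (e1 - e) l]. *)
    apply (perturbation M L0 2 _
      (fun t p => e (step DW t p) * k (step DW t p) - e p * k p
         - t * (e p * l p + e' DW p * k p))
      (fun t p => f (step DW t p) - f p - t * f' DW p)
      (fun t p => Rabs (e (step DW t p)))
      (fun t p => Rabs ((e (step DW t p) - e p - t * e' DW p) * k p
         + t * (e (step DW t p) - e p) * l p))); auto.
    * intros t. apply reg_minus; [| now apply reg_scal].
      apply reg_minus; [now apply reg_step_w | easy].
    * intros t. apply reg_minus; [| now apply reg_scal, reg_plus].
      apply reg_minus; [exact (reg_step_w t _ Rek) | easy].
    * intros t. apply reg_minus; [| now apply reg_scal].
      apply reg_minus; [now apply reg_step_w | easy].
    * intros t. apply reg_abs. now apply reg_step_w.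
    * intros t p Hp Hq. rewrite !Hs, Hse; auto; [ring | now apply ok_step].
    * intros t p Hp. rewrite (Hk p Hp), (Hk (step DW t p)), (Hl p Hp) by now apply ok_step.
      rewrite Js_step_w.
      assert (Rst := reg_step_w t _ RF).
      assert (Rgl := reg_Iq_plus M _ _ Rel Rg).
      rewrite <- Js_scal, <- Js_minus, <- Js_minus; auto.
      2: now apply reg_minus.
      2: now apply reg_scal.
      apply Js_ext; [easy |]. intros p' Hp'.
      assert (Rst' := reg_step_w t _ Rek).
      rewrite Iq_minus, Iq_scal, Iq_minus, Iq_plus; auto.
      -- unfold F, g. rewrite Iq_step_w. ring.
      -- now apply reg_plus.
      -- now apply reg_minus.
      -- now apply reg_scal, reg_plus.
    * intros t p Hp. rewrite <- Rabs_mult.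
      match goal with |- Rabs ?a <= Rabs ?b + Rabs ?c => replace a with (b + c) by ring end.
      apply Rabs_triang.
    * intros; apply Rabs_pos.
    * intros t p Hp. exact (Hmass (step DW t p) (ok_step DW t p ltac:(easy) Hp)).
    * apply big_O_abs, big_O_plus.
      -- exact (big_O_mult DW 2 0 _ _ (proj1 (He DW)) (big_O_here DW k Bk)).
      -- exact (big_O_mult DW 2 0 _ _ (big_O_mult DW 1 1 _ _ (big_O_t DW) (CK_Lip _ _ DW He1))
           (big_O_here DW l (CK_bnd _ _ Cl))).
    * apply Hf.
  + easy.
Qed.

(** * Smoothness of the profile in all variables *)

Lemma mass_scal_bound (M b : R) (f h : pt -> R) (p : pt) : 0 <= M -> 0 <= b -> ok p ->
  reg f -> reg h -> (forall p, ok p -> f p <= b * h p) ->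
  RInt (fun x => h (ps p, x, pw p)) (- M) M <= 2 * M ->
  RInt (fun x => f (ps p, x, pw p)) (- M) M <= 2 * M * b.
Proof.
intros HM Hb Hp Rf Rh H Hm.
apply Rle_trans with (RInt (fun x => b * h (ps p, x, pw p)) (- M) M).
- apply RInt_le; [lra | exact (reg_ex_q f p _ _ Rf Hp) | |].
  + exact (ex_RInt_mul _ _ _ _ (reg_ex_q h p _ _ Rh Hp)).
  + intros x _. now apply H.
- rewrite (RInt_mul _ _ _ _ (reg_ex_q h p _ _ Rh Hp)). nra.
Qed.

Definition solves_profile (M : R) (B beta Phi : pt -> R) : Prop :=
  forall p, ok p -> Phi p = Js (Iq M (fun p => B p * exp (beta p * Phi p))) p.

(** Here [beta] stands for [G B]. As for linear equations, the candidate for the derivative in [w]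
    solves the linearised equation; its coefficient [B beta h] has [L^1] norm at most [2 M b ^ 2] by
    the mass bound, so [linear_CK] applies to it. *)
Lemma profile_CK (M b : R) (B beta Phi : pt -> R) : 0 <= M -> 0 <= b ->
  (forall n, CK n B) -> (forall n, CK n beta) -> supp M B ->
  (forall p, ok p -> Rabs (B p) <= b) -> (forall p, ok p -> Rabs (beta p) <= b) ->
  reg Phi -> bnd Phi -> bnd (fun p => exp (beta p * Phi p)) ->
  (forall p, ok p -> RInt (fun x => exp (beta (ps p, x, pw p) * Phi (ps p, x, pw p))) (- M) M <= 2 * M) ->
  solves_profile M B beta Phi -> forall n, CK n Phi.
Proof.
intros HM Hb CB Cbeta HsB HB Hbeta RPhi BPhi Bh Hmass HPhi.
set (h := fun p => exp (beta p * Phi p)). change (bnd h) in Bh.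
set (F := Iq M (fun p => B p * h p)). change (forall p, ok p -> Phi p = Js F p) in HPhi.
assert (hpos : forall p, 0 < h p) by (intros; apply exp_pos).
assert (BB := CK_bnd _ _ (CB O)). assert (Bbeta := CK_bnd _ _ (Cbeta O)).
assert (RB := CK_reg _ _ (CB O)). assert (Rbeta := CK_reg _ _ (Cbeta O)).
assert (Rh : reg h) by now apply reg_exp, reg_mult.
assert (RBh : reg (fun p => B p * h p)) by now apply reg_mult.
assert (BBh : bnd (fun p => B p * h p)) by now apply bnd_mult.
assert (HsBh : supp M (fun p => B p * h p)) by now apply supp_mult_l.
assert (RF : reg F) by now apply reg_Iq.
assert (BF : bnd F) by now apply bnd_Iq.
assert (EF : forall p, ok p -> Js F p = Phi p) by (intros p Hp; symmetry; now apply HPhi).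
assert (R0 := reg_const 0).
assert (Hstep : forall t p, ok p -> ok (step DW t p)) by (intros; now apply ok_step).
assert (Rbp : reg (fun p => beta p * Phi p)) by now apply reg_mult.
assert (Ehh : forall t p, Rabs (h (step DW t p) - h p) <=
  (h p + h (step DW t p)) * Rabs (beta (step DW t p) * Phi (step DW t p) - beta p * Phi p)).
{ intros t p. apply exp_increment. }
(* No linearisation is available yet: the factor [h p + h (step DW t p)] from [exp_increment] acts
   as the coefficient, and its integral is at most [4 M] by the mass bound at the two angles. *)
assert (LW : Lip DW Phi).
{ apply (perturbation M (2 * M * (2 * (b * b))) 1 _
    (fun t p => B (step DW t p) * h (step DW t p) - B p * h p) (fun _ _ => 0)
    (fun t p => b * b * (h p + h (step DW t p)))
    (fun t p => b * (h p + h (step DW t p)) * Rabs ((beta (step DW t p) - beta p) * Phi p)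
       + Rabs ((B (step DW t p) - B p) * h p))); auto.
  - assert (0 <= b * b) by nra. assert (0 <= M * (b * b)) by nra. lra.
  - intros t. apply reg_minus; [now apply reg_step_w | easy].
  - intros t. apply reg_minus; [exact (reg_step_w t _ RBh) | easy].
  - intros t. apply reg_scal, reg_plus; [easy | now apply reg_step_w].
  - intros t p Hp Hq. rewrite !HsB; auto. ring.
  - intros t p Hp. rewrite (HPhi p Hp), (HPhi (step DW t p)) by auto.
    rewrite Js_step_w, <- Js_minus; auto.
    2: exact (reg_step_w t _ RF).
    apply Js_ext; [easy |]. intros p' Hp'. rewrite Iq_minus; auto.
    2: exact (reg_step_w t _ RBh).
    unfold F. rewrite Iq_step_w. ring.
  - intros t p Hp.
    replace (B (step DW t p) * h (step DW t p) - B p * h p) with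
      (B (step DW t p) * (h (step DW t p) - h p) + (B (step DW t p) - B p) * h p) by ring.
    rle Rabs_triang. rewrite <- Rplus_assoc.
    apply Rplus_le_compat_r. rewrite Rabs_mult.
    assert (P1 := hpos p). assert (P2 := hpos (step DW t p)).
    set (H := h p + h (step DW t p)) in *. assert (PH : 0 < H) by (unfold H; lra).
    apply Rle_trans with (b * (H * (b * Rabs (Phi (step DW t p) - Phi p) + Rabs ((beta (step DW t p) - beta p) * Phi p)))).
    + apply Rmult_le_compat; [apply Rabs_pos | apply Rabs_pos | auto |].
      rle Ehh. apply Rmult_le_compat_l; [lra |].
      replace (beta (step DW t p) * Phi (step DW t p) - beta p * Phi p) with
        (beta (step DW t p) * (Phi (step DW t p) - Phi p) + (beta (step DW t p) - beta p) * Phi p) by ring.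
      rle Rabs_triang. apply Rplus_le_compat_r. rewrite Rabs_mult.
      apply Rmult_le_compat_r; [apply Rabs_pos | auto].
    + right. ring.
  - intros t p Hp. assert (P1 := hpos p). assert (P2 := hpos (step DW t p)). nra.
  - intros t p Hp.
    apply (mass_scal_bound M (2 * (b * b)) (fun p => b * b * (h p + h (step DW t p)))
      (fun p => / 2 * (h p + h (step DW t p)))); auto.
    + nra.
    + apply reg_scal, reg_plus; [easy | now apply reg_step_w].
    + apply reg_scal, reg_plus; [easy | now apply reg_step_w].
    + intros p' _. right. field.
    + assert (X1 := reg_ex_q h p (- M) M Rh Hp).
      assert (X2 := reg_ex_q h (step DW t p) (- M) M Rh (Hstep t p Hp)).
      change (RInt (fun x => / 2 * (h (ps p, x, pw p) + h (ps p, x, rot t (pw p)))) (- M) M <= 2 * M).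
      rewrite RInt_mul, RInt_add by (exact X1 || exact X2 || exact (ex_RInt_add _ _ _ _ X1 X2)).
      assert (Y1 := Hmass p Hp). assert (Y2 := Hmass (step DW t p) (Hstep t p Hp)).
      change (RInt (fun x => h (ps p, x, pw p)) (- M) M <= 2 * M) in Y1.
      change (RInt (fun x => h (ps p, x, rot t (pw p))) (- M) M <= 2 * M) in Y2. lra.
  - apply big_O_plus.
    + apply (big_O_mult DW 0 1).
      * apply big_O_scal, big_O_plus; [now apply big_O_here | now apply big_O_there].
      * apply big_O_abs. exact (big_O_mult DW 1 0 _ _ (CK_Lip _ _ DW (Cbeta O)) (big_O_here DW Phi BPhi)).
    + apply big_O_abs. exact (big_O_mult DW 1 0 _ _ (CK_Lip _ _ DW (CB O)) (big_O_here DW h Bh)).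
  - apply (big_O_ext _ _ _ _ (big_O_scal DW 1 0 _ (big_O_t DW))). intros; ring. }
assert (LPhi : forall d, Lip d Phi).
{ intros [| |]; [| | easy].
  - apply (Lip_ext DS _ _ EF). now apply Lip_Js_s.
  - apply (Lip_ext DQ _ _ EF). apply Lip_Js_other; [easy | easy |]. now apply Lip_Iq_q. }
intros n. induction n as [| n IH]; [split; [easy | split; easy] |].
assert (Cbp : CK n (fun p => beta p * Phi p)) by (apply CK_mult; auto).
assert (Ch : CK n h) by now apply CK_exp.
assert (CBh : CK n (fun p => B p * h p)) by (apply CK_mult; auto).
assert (CF : CK n F) by now apply CK_Iq.
destruct (CB (S n)) as (_ & _ & B' & HB'). destruct (Cbeta (S n)) as (_ & _ & beta' & Hbeta').
(* [e] is the derivative of [B exp (beta Phi)] with respect to [Phi], and [f0] its derivative in [w]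
   with [Phi] kept fixed. *)
set (e := fun p => B p * beta p * h p).
set (f0 := fun p => B' DW p * h p + B p * beta' DW p * Phi p * h p).
assert (HsB' : supp M (B' DW)) by (apply (Tay_supp M DW B); [easy | easy | apply HB']).
assert (Hsf0 : supp M f0).
{ apply supp_plus; [now apply supp_mult_l | now apply supp_mult_l, supp_mult_l, supp_mult_l]. }
assert (Hse : supp M e) by now apply supp_mult_l, supp_mult_l.
assert (Ce : CK n e) by (apply CK_mult; [apply CK_mult |]; auto).
assert (Cf0 : CK n f0).
{ apply CK_plus; [apply CK_mult; [apply HB' | easy] |].
  apply CK_mult; [| easy]. apply CK_mult; [| easy]. apply CK_mult; [auto | apply Hbeta']. }
assert (Re := CK_reg _ _ Ce). assert (Rf0 := CK_reg _ _ Cf0).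
assert (Cg : CK n (Iq M f0)) by now apply CK_Iq.
assert (Hme0 : forall p, ok p -> RInt (fun x => Rabs (e (ps p, x, pw p))) (- M) M <= 2 * M * (b * b)).
{ intros p Hp. apply (mass_scal_bound M (b * b) (fun p => Rabs (e p)) h); auto.
  - nra.
  - now apply reg_abs.
  - intros p' Hp'. unfold e. rewrite !Rabs_mult, (Rabs_pos_eq (h p')) by (left; auto).
    apply Rmult_le_compat_r; [left; auto |].
    apply Rmult_le_compat; auto using Rabs_pos.
  - now apply Hmass. }
assert (Hbb : 0 <= 2 * M * (b * b)).
{ assert (0 <= b * b) by nra. assert (0 <= M * (b * b)) by nra. lra. }
destruct (linear_exists M e (Iq M f0) HM Re Hse (CK_reg _ _ Cg)) as (l & Rl & Hl).
assert (Cl : CK n l) by (apply (linear_CK M (2 * M * (b * b)) n e (Iq M f0)); auto).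
split; [easy | split; [easy |]].
exists (fun d => match d with DS => F | DQ => Js (fun p => B p * h p) | DW => l end).
intros [| |]; split; auto.
- apply (Tay_ext DS _ _ _ _ EF (fun p _ => eq_refl)). apply Tay_Js_s; [easy |].
  apply (CK_Lip _ _ DS CF).
- apply (Tay_ext DQ _ _ _ _ EF (fun p _ => eq_refl)). apply Tay_Js_other; auto; [easy |].
  apply Tay_Iq_q; [easy | apply (CK_Lip _ _ DQ CBh)].
- now apply CK_Js.
- assert (Rel : reg (fun p => e p * l p)) by now apply reg_mult.
  set (D := fun t p => B (step DW t p) * h (step DW t p) - B p * h p - t * (e p * l p + f0 p)).
  assert (RD : forall t, reg (D t)).
  { intros t. apply reg_minus; [| now apply reg_scal, reg_plus].
    apply reg_minus; [exact (reg_step_w t _ RBh) | easy]. }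
  set (r := fun t p => Phi (step DW t p) - Phi p - t * l p).
  apply (perturbation M (2 * M * (b * b)) 2 _ D (fun _ _ => 0) (fun _ p => Rabs (e p))
    (fun t p => Rabs (D t p - e p * r t p))); auto.
  + intros t. apply reg_minus; [| now apply reg_scal].
    apply reg_minus; [now apply reg_step_w | easy].
  + intros _. now apply reg_abs.
  + intros t p Hp Hq. unfold D. rewrite !HsB, Hsf0, Hse; auto. ring.
  + intros t p Hp. rewrite (HPhi p Hp), (HPhi (step DW t p)), (Hl p Hp) by auto.
    assert (RFs := reg_step_w t _ RF). assert (RBhs := reg_step_w t _ RBh).
    assert (Relf : reg (fun p => Iq M (fun p => e p * l p) p + Iq M f0 p)) by
      (apply reg_plus; now apply reg_Iq).
    rewrite Js_step_w, <- Js_scal, <- Js_minus, <- Js_minus; auto.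
    2: now apply reg_minus.
    2: now apply reg_scal.
    apply Js_ext; [easy |]. intros p' Hp'. unfold D.
    rewrite Iq_minus, Iq_scal, Iq_minus, Iq_plus; auto.
    * unfold F. rewrite Iq_step_w. ring.
    * now apply reg_plus.
    * now apply reg_minus.
    * now apply reg_scal, reg_plus.
  + intros t p Hp. change (Rabs (D t p) <= Rabs (e p) * Rabs (r t p) + Rabs (D t p - e p * r t p)).
    rewrite <- Rabs_mult. replace (D t p) with (e p * r t p + (D t p - e p * r t p)) at 1 by ring.
    apply Rabs_triang.
  + intros; apply Rabs_pos.
  + apply big_O_abs.
    assert (Lbp := CK_Lip _ _ DW Cbp). assert (Lbeta := CK_Lip _ _ DW (Cbeta O)).
    assert (LB := CK_Lip _ _ DW (CB O)). assert (Lh := CK_Lip _ _ DW Ch).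
    (* [E1] is the remainder of [exp], [E2] that of the exponent without the part [beta r], and [E3]
       that of the factor [B] together with the mixed increment; [D - e r] is
       [B h E2 + B E1 + E3]. *)
    assert (E1 : big_O DW 2 (fun t p => h (step DW t p) - h p
      - h p * (beta (step DW t p) * Phi (step DW t p) - beta p * Phi p))).
    { apply (big_O_le _ _ _ _ (big_O_mult _ 0 2 _ _
        (big_O_plus _ _ _ _ (big_O_here DW _ Bh) (big_O_there DW _ Bh)) (big_O_mult _ 1 1 _ _ Lbp Lbp))).
      intros t p _ _. rewrite (Rabs_mult (_ + _)).
      assert (P1 := hpos p). assert (P2 := hpos (step DW t p)).
      rewrite (Rabs_pos_eq (_ + _)) by lra.
      rewrite (Rabs_pos_eq (_ * _)) by apply Rle_0_sqr.
      eapply Rle_trans; [apply exp_taylor | right; unfold h; ring]. }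
    assert (E2 : big_O DW 2 (fun t p =>
      (beta (step DW t p) - beta p - t * beta' DW p) * Phi p
      + (beta (step DW t p) - beta p) * (Phi (step DW t p) - Phi p))).
    { apply big_O_plus.
      - exact (big_O_mult _ 2 0 _ _ (proj1 (Hbeta' DW)) (big_O_here DW _ BPhi)).
      - exact (big_O_mult _ 1 1 _ _ Lbeta LW). }
    assert (E3 : big_O DW 2 (fun t p => (B (step DW t p) - B p - t * B' DW p) * h p
      + (B (step DW t p) - B p) * (h (step DW t p) - h p))).
    { apply big_O_plus.
      - exact (big_O_mult _ 2 0 _ _ (proj1 (HB' DW)) (big_O_here DW _ Bh)).
      - exact (big_O_mult _ 1 1 _ _ LB Lh). }
    apply (big_O_ext _ _ _ _ (big_O_plus _ _ _ _ (big_O_plus _ _ _ _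
      (big_O_mult _ 0 2 _ _ (big_O_here DW _ BBh) E2)
      (big_O_mult _ 0 2 _ _ (big_O_here DW _ BB) E1)) E3)).
    intros t p _ _. unfold D, r, e, f0. ring.
  + apply (big_O_ext _ _ _ _ (big_O_scal DW 2 0 _ (big_O_mult DW 1 1 _ _ (big_O_t DW) (big_O_t DW)))).
    intros; ring.
Qed.

(** * From Taylor bounds to families of partial derivatives *)

Definition smooth (f : pt -> R) : Prop := forall n, CK n f.

(** Each [CK (S n)] supplies its own witness; [Tay_unique] identifies them all, so that one [g] lies
    in every class. *)
Lemma smooth_deriv (d : dir) (f : pt -> R) : smooth f -> exists g, Tay d f g /\ smooth g.
Proof.
intros H. destruct (H 1%nat) as (_ & _ & g & Hg).
exists (g d). split; [apply Hg |]. intros n.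
destruct (H (S n)) as (_ & _ & g' & Hg').
apply CK_ext with (g' d); [| apply Hg'].
intros p Hp. apply (Tay_unique d f _ _ p); [apply Hg' | apply Hg | easy].
Qed.

(** Chosen as a function of [f] so that it can be iterated. It is determined only at points
    satisfying [ok], hence equalities between derivatives are stated there. *)
Definition deriv (d : dir) (f : pt -> R) : pt -> R :=
  match excluded_middle_informative (exists g, Tay d f g /\ smooth g) with
  | left H => proj1_sig (constructive_indefinite_description _ H)
  | right _ => fun _ => 0
  end.

Lemma deriv_spec (d : dir) (f : pt -> R) : smooth f -> Tay d f (deriv d f) /\ smooth (deriv d f).
Proof.
intros H. unfold deriv. destruct excluded_middle_informative as [E | E].
- destruct constructive_indefinite_description as [g Hg]. exact Hg.
- destruct E. now apply smooth_deriv.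
Qed.

Lemma deriv_unique (d : dir) (f g : pt -> R) (p : pt) : smooth f -> Tay d f g -> ok p ->
  deriv d f p = g p.
Proof. intros H Hg Hp. apply (Tay_unique d f); [now apply deriv_spec | easy | easy]. Qed.

Lemma deriv_ext (d : dir) (f g : pt -> R) : smooth f -> (forall p, ok p -> f p = g p) ->
  forall p, ok p -> deriv d f p = deriv d g p.
Proof.
intros H E p Hp. apply deriv_unique; auto.
apply (Tay_ext d g f (deriv d g) (deriv d g)); auto.
- intros; symmetry; auto.
- apply deriv_spec. intros n. now apply (CK_ext n f).
Qed.

Lemma rot_plus (x y : R) (w : R * R) : rot (x + y) w = rot x (rot y w).
Proof. unfold rot. cbn [fst snd]. rewrite cos_plus, sin_plus. f_equal; ring. Qed.

Lemma rot_0 (w : R * R) : rot 0 w = w.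
Proof. unfold rot. rewrite cos_0, sin_0. destruct w; cbn [fst snd]. f_equal; ring. Qed.

Lemma step_plus (d : dir) (x y : R) (p : pt) : step d (x + y) p = step d x (step d y p).
Proof.
destruct p as [[s q] w].
destruct d; unfold step, ps, pq, pw; cbn [fst snd]; [| | now rewrite rot_plus];
f_equal; f_equal; ring.
Qed.

Lemma step_0 (d : dir) (p : pt) : step d 0 p = p.
Proof.
destruct p as [[s q] w].
destruct d; unfold step, ps, pq, pw; cbn [fst snd]; rewrite ?Rplus_0_r, ?rot_0; easy.
Qed.

Lemma step_comm (a b : dir) (x y : R) (p : pt) : a <> b ->
  step a x (step b y p) = step b y (step a x p).
Proof. now destruct a, b. Qed.

Lemma big_O_local (d : dir) (k : nat) (F : R -> pt -> R) (T : R) : big_O d k F ->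
  exists K, 0 <= K /\ forall t p, ok p -> ok (step d t p) -> ps p <= T -> ps (step d t p) <= T ->
  Rabs (F t p) <= K * Rabs t ^ k.
Proof.
intros (C & HC & H). exists (gr C (2 * T)). split; [now apply gr_nonneg |].
intros t p Hp Hp' H1 H2. eapply Rle_trans; [now apply H |].
apply Rmult_le_compat_r; [apply pow_le, Rabs_pos |]. destruct Hp, Hp'. apply gr_le; lra.
Qed.

(** The increment [phi] over a step [t] in direction [b] has slope [t fab + O(t ^ 2)] in direction
    [a], and [quadratic_increment_nonpos] integrates this over [[0, t]]. The second difference is
    symmetric in the two directions, which makes mixed derivatives commute. *)
Lemma second_difference (a b : dir) (f fa fab : pt -> R) (p : pt) : a <> b ->
  Tay a f fa -> Tay b fa fab -> Lip a fab -> ok p ->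
  exists K, forall t, 0 < t <= 1 ->
  Rabs (f (step b t (step a t p)) - f (step a t p) - f (step b t p) + f p - t ^ 2 * fab p)
  <= K * t ^ 3.
Proof.
intros Hab H1 H2 H3 Hp. set (T := ps p + 2).
destruct (big_O_local _ _ _ T H1) as (K1 & HK1 & L1).
destruct (big_O_local _ _ _ T H2) as (K2 & HK2 & L2).
destruct (big_O_local _ _ _ T H3) as (K3 & HK3 & L3).
exists (K2 + K3). intros t Ht.
assert (Hs : forall d x p', 0 <= x <= 1 -> ps (step d x p') <= ps p' + 1) by
  (intros; now apply ps_step_le).
set (phi := fun x => f (step a x (step b t p)) - f (step a x p)).
assert (Hinc : forall x y, 0 <= x -> x <= y -> y <= t ->
  Rabs (phi y - phi x - (y - x) * (t * fab p)) <= (y - x) * ((K2 + K3) * t ^ 2) + 2 * K1 * (y - x) ^ 2).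
{ intros x y Hx Hxy Hy.
  assert (Hone : forall P, ok P -> ps P <= ps p + 1 ->
    Rabs (f (step a y P) - f (step a x P) - (y - x) * fa (step a x P)) <= K1 * (y - x) ^ 2).
  { intros P HP HP1. replace (step a y P) with (step a (y - x) (step a x P)) by
      (rewrite <- step_plus; f_equal; ring).
    rewrite <- (pow2_abs (y - x)). apply L1.
    - apply ok_step_pos; [lra | easy].
    - apply ok_step_pos; [lra |]. apply ok_step_pos; [lra | easy].
    - assert (X := Hs a x P ltac:(lra)). unfold T. lra.
    - rewrite <- step_plus. replace (y - x + x) with y by ring.
      assert (X := Hs a y P ltac:(lra)). unfold T. lra. }
  assert (A1 := Hone p Hp ltac:(lra)).
  assert (A2 := Hone (step b t p) (ok_step_pos b t p ltac:(lra) Hp) (Hs b t p ltac:(lra))).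
  assert (Hok : ok (step a x p)) by (apply ok_step_pos; [lra | easy]).
  assert (Hsx := Hs a x p ltac:(lra)).
  assert (A3 := L2 t (step a x p) Hok (ok_step_pos b t _ ltac:(lra) Hok) ltac:(unfold T; lra)
    ltac:(assert (X := Hs b t (step a x p) ltac:(lra)); unfold T; lra)).
  rewrite <- (step_comm a b) in A3 by easy.
  assert (A4 := L3 x p Hp Hok ltac:(unfold T; lra) ltac:(unfold T; lra)).
  rewrite (Rabs_pos_eq t) in A3 by lra. rewrite (Rabs_pos_eq x), pow_1 in A4 by lra.
  replace (phi y - phi x - (y - x) * (t * fab p)) with
    ((f (step a y (step b t p)) - f (step a x (step b t p)) - (y - x) * fa (step a x (step b t p)))
     - (f (step a y p) - f (step a x p) - (y - x) * fa (step a x p))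
     + (y - x) * ((fa (step a x (step b t p)) - fa (step a x p) - t * fab (step a x p))
         + t * (fab (step a x p) - fab p))) by (unfold phi; ring).
  rle Rabs_triang.
  assert (B1 : Rabs ((y - x) * ((fa (step a x (step b t p)) - fa (step a x p) - t * fab (step a x p))
         + t * (fab (step a x p) - fab p))) <= (y - x) * ((K2 + K3) * t ^ 2)).
  { rewrite Rabs_mult, (Rabs_pos_eq (y - x)) by lra. apply Rmult_le_compat_l; [lra |].
    rle Rabs_triang.
    rewrite Rmult_plus_distr_r. apply Rplus_le_compat; [exact A3 |].
    rewrite Rabs_mult, (Rabs_pos_eq t) by lra.
    replace (K3 * t ^ 2) with (t * (K3 * t)) by ring. apply Rmult_le_compat_l; [lra |].
    eapply Rle_trans; [exact A4 |]. apply Rmult_le_compat_l; lra. }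
  assert (B2 : forall u v : R, Rabs (u - v) <= Rabs u + Rabs v).
  { intros u v. unfold Rminus. eapply Rle_trans; [apply Rabs_triang | rewrite Rabs_Ropp; lra]. }
  eapply Rle_trans; [apply Rplus_le_compat; [apply B2 | exact B1] |]. lra. }
assert (E : f (step b t (step a t p)) - f (step a t p) - f (step b t p) + f p = phi t - phi 0).
{ unfold phi. rewrite !step_0, (step_comm a b) by easy. ring. }
rewrite E.
assert (U1 := quadratic_increment_nonpos
  (fun x => phi x - x * (t * fab p) - x * ((K2 + K3) * t ^ 2)) 0 t (2 * K1) ltac:(lra)
  ltac:(intros x y Hx Hxy Hy; specialize (Hinc x y Hx Hxy Hy); apply Rabs_le_between in Hinc; lra)).
assert (U2 := quadratic_increment_nonpos
  (fun x => - (phi x - x * (t * fab p)) - x * ((K2 + K3) * t ^ 2)) 0 t (2 * K1) ltac:(lra)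
  ltac:(intros x y Hx Hxy Hy; specialize (Hinc x y Hx Hxy Hy); apply Rabs_le_between in Hinc; lra)).
simpl in U1, U2. apply Rabs_le. simpl. lra.
Qed.

Lemma deriv_comm (a b : dir) (f : pt -> R) : a <> b -> smooth f ->
  forall p, ok p -> deriv a (deriv b f) p = deriv b (deriv a f) p.
Proof.
intros Hab Hf p Hp.
destruct (deriv_spec a f Hf) as [Ta Sa]. destruct (deriv_spec b f Hf) as [Tb Sb].
destruct (deriv_spec b _ Sa) as [Tab Sab]. destruct (deriv_spec a _ Sb) as [Tba Sba].
destruct (second_difference a b f _ _ p Hab Ta Tab (CK_Lip _ _ a (Sab O)) Hp) as (K & HK).
destruct (second_difference b a f _ _ p ltac:(congruence) Tb Tba (CK_Lip _ _ b (Sba O)) Hp) as (K' & HK').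
apply Rminus_diag_uniq, (le_small_t_eq_0 _ (K + K')). intros t Ht.
specialize (HK t Ht). specialize (HK' t Ht). rewrite (step_comm a b) in HK' by easy.
apply Rmult_le_reg_l with t; [lra |].
rewrite <- (Rabs_pos_eq t) at 1 by lra. rewrite <- Rabs_mult.
set (u := deriv a (deriv b f) p) in *. set (v := deriv b (deriv a f) p) in *.
set (X := f (step b t (step a t p))) in *.
replace (t * (t * (u - v))) with ((X - f (step a t p) - f (step b t p) + f p - t ^ 2 * v)
  - (X - f (step b t p) - f (step a t p) + f p - t ^ 2 * u)) by ring.
unfold Rminus at 1. rle Rabs_triang. rewrite Rabs_Ropp. lra.
Qed.

Lemma smooth_iter (d : dir) (n : nat) (f : pt -> R) : smooth f -> smooth (Nat.iter n (deriv d) f).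
Proof. intros H. induction n; [easy |]. simpl. now apply deriv_spec. Qed.

Lemma iter_deriv_ext (d : dir) (n : nat) (f g : pt -> R) : smooth f ->
  (forall p, ok p -> f p = g p) ->
  forall p, ok p -> Nat.iter n (deriv d) f p = Nat.iter n (deriv d) g p.
Proof.
intros Hf E. induction n; [easy |]. simpl. apply deriv_ext; [now apply smooth_iter | easy].
Qed.

Lemma deriv_iter_comm (a b : dir) (n : nat) (f : pt -> R) : a <> b -> smooth f ->
  forall p, ok p -> deriv a (Nat.iter n (deriv b) f) p = Nat.iter n (deriv b) (deriv a f) p.
Proof.
intros Hab Hf. induction n as [| n IH]; [easy |]. intros p Hp. simpl.
rewrite deriv_comm; auto; [| now apply smooth_iter].
apply deriv_ext; auto. apply deriv_spec. now apply smooth_iter.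
Qed.

(** The order of differentiation is fixed; a further derivative in [q] or [w] is moved to its place
    by commutation. *)
Definition partial (f : pt -> R) (a b c : nat) : pt -> R :=
  Nat.iter a (deriv DS) (Nat.iter b (deriv DQ) (Nat.iter c (deriv DW) f)).

Lemma smooth_partial (f : pt -> R) (a b c : nat) : smooth f -> smooth (partial f a b c).
Proof. intros H. unfold partial. now repeat apply smooth_iter. Qed.

Lemma partial_S_s (f : pt -> R) (a b c : nat) :
  partial f (S a) b c = deriv DS (partial f a b c).
Proof. reflexivity. Qed.

Lemma partial_S_q (f : pt -> R) (a b c : nat) (p : pt) : smooth f -> ok p ->
  partial f a (S b) c p = deriv DQ (partial f a b c) p.
Proof.
intros H Hp. unfold partial. rewrite deriv_iter_comm; auto; [easy |].
now repeat apply smooth_iter.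
Qed.

Lemma partial_S_w (f : pt -> R) (a b c : nat) (p : pt) : smooth f -> ok p ->
  partial f a b (S c) p = deriv DW (partial f a b c) p.
Proof.
intros H Hp. unfold partial. rewrite deriv_iter_comm; auto; [| easy | now repeat apply smooth_iter].
apply iter_deriv_ext; auto.
- apply smooth_iter. now apply (smooth_iter DW (S c)).
- intros p' Hp'. rewrite deriv_iter_comm; auto; [easy |]. now apply smooth_iter.
Qed.

(** * From quadratic bounds to derivatives and continuity *)

Lemma is_domin_quadratic (F : (R -> Prop) -> Prop) (f : R -> R) (x l K : R) :
  (forall d : posreal, F (fun y => Rabs (y - x) < d ->
    Rabs (f y - f x - (y - x) * l) <= K * (y - x) ^ 2)) ->
  (forall d : posreal, F (fun y => Rabs (y - x) < d)) -> Filter F ->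
  is_domin (U := R_NormedModule) (V := R_NormedModule) F (fun y : R => minus y x)
    (fun y : R => minus (minus (f y) (f x)) (scal (minus y x) l)).
Proof.
intros H H' FF eps.
assert (Hd : 0 < eps / (Rabs K + 1)).
{ apply Rdiv_lt_0_compat; [apply cond_pos |]. assert (X := Rabs_pos K). lra. }
generalize (filter_and _ _ (H (mkposreal _ Hd)) (H' (mkposreal _ Hd))).
apply filter_imp. intros y [H1 H2]. specialize (H1 H2). simpl in H2.
change (Rabs (f y - f x - (y - x) * l) <= eps * Rabs (y - x)).
rle H1. rewrite <- pow2_abs.
assert (X := Rabs_pos K). assert (Y := Rabs_pos (y - x)).
apply Rle_trans with (Rabs K * Rabs (y - x) * Rabs (y - x)).
- assert (Z := Rle_abs K). assert (0 <= Rabs (y - x) ^ 2) by apply pow2_ge_0. nra.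
- apply Rmult_le_compat_r; [easy |].
  apply Rmult_lt_compat_l with (r := Rabs K + 1) in H2; [| lra].
  replace ((Rabs K + 1) * (eps / (Rabs K + 1))) with (pos eps) in H2 by (field; lra). lra.
Qed.

Lemma locally_abs (x : R) (d : posreal) : locally x (fun y => Rabs (y - x) < d).
Proof. now exists d. Qed.

Lemma is_derive_halfline_quadratic (f : R -> R) (s l K : R) : 0 <= s ->
  (forall s', 0 <= s' -> Rabs (s' - s) <= 1 -> Rabs (f s' - f s - (s' - s) * l) <= K * (s' - s) ^ 2) ->
  is_derive_halfline f s l.
Proof.
intros Hs H. split; [exact (@is_linear_scal_l R_AbsRing R_NormedModule l) |].
intros x Hx.
(* The differential is required at every limit of the filter; [s] is the only one, since [s] itself
   belongs to the half-line. *)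
assert (E : x = s).
{ apply NNPP. intros Hne.
  assert (Hpos : 0 < Rabs (x - s) / 2).
  { assert (X := Rabs_pos_lt (x - s) ltac:(lra)). lra. }
  destruct (Hx _ (locally_abs x (mkposreal _ Hpos))) as [e He].
  specialize (He s (ball_center s e) Hs). simpl in He. rewrite Rabs_minus_sym in He. lra. }
subst x. apply is_domin_quadratic with K.
- intros d. exists (mkposreal 1 Rlt_0_1). intros y Hy Hy0 _. apply H; [easy |]. left. exact Hy.
- intros d. exists d. intros y Hy _. exact Hy.
- apply within_filter, locally_filter.
Qed.

Lemma is_derive_quadratic (f : R -> R) (x l K : R) :
  (forall y, Rabs (f y - f x - (y - x) * l) <= K * (y - x) ^ 2) -> is_derive f x l.
Proof.
intros H. split; [exact (@is_linear_scal_l R_AbsRing R_NormedModule l) |].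
intros z Hz. apply (is_filter_lim_locally_unique (V := R_NormedModule)) in Hz. subst z.
apply is_domin_quadratic with K.
- intros d. apply filter_forall. intros y _. apply H.
- apply locally_abs.
- apply locally_filter.
Qed.

Lemma Tay_local (d : dir) (f g : pt -> R) (p : pt) : Tay d f g -> ok p ->
  exists K, forall t, ok (step d t p) -> (d <> DS \/ Rabs t <= 1) ->
  Rabs (f (step d t p) - f p - t * g p) <= K * t ^ 2.
Proof.
intros H Hp. destruct (big_O_local _ _ _ (ps p + 1) H) as (K & HK & L).
exists K. intros t Ht Hd. rewrite <- pow2_abs. apply L; auto; [lra |].
destruct Hd as [Hd | Hd]; [rewrite ps_step; auto; lra |].
assert (X := Rle_abs t). destruct d; unfold step, ps in *; cbn [fst snd]; lra.
Qed.

(** With [c] and [d] the sine and cosine of the angle from [w] to [w'], the half-angle formula gives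
    this angle as [2 atan (c / (1 + d))]. Closeness ensures [d >= 0], and [|atan z| <= |z|] makes
    the angle linear in the distance. *)
Lemma circle_near (w w' : R * R) : circle w -> circle w' ->
  Rabs (fst w' - fst w) <= 1 -> Rabs (snd w' - snd w) <= 1 ->
  exists t, w' = rot t w /\ Rabs t <= 2 * (Rabs (fst w' - fst w) + Rabs (snd w' - snd w)).
Proof.
destruct w as [x y], w' as [x' y']. unfold circle. cbn [fst snd]. intros H H' Hx Hy.
set (c := x * y' - y * x'). set (d := x * x' + y * y').
assert (Hcd : c ^ 2 + d ^ 2 = 1).
{ replace (c ^ 2 + d ^ 2) with ((x ^ 2 + y ^ 2) * (x' ^ 2 + y' ^ 2)) by (unfold c, d; ring).
  rewrite H, H'. ring. }
assert (Hd : 0 <= d).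
{ assert (E : 2 * d = 2 - (x' - x) ^ 2 - (y' - y) ^ 2).
  { replace 2 with ((x ^ 2 + y ^ 2) + (x' ^ 2 + y' ^ 2)) at 2 by lra. unfold d. ring. }
  assert (A1 : (x' - x) ^ 2 <= 1).
  { rewrite <- pow2_abs. replace 1 with (1 ^ 2) by ring. apply pow_incr. split; [apply Rabs_pos | easy]. }
  assert (A2 : (y' - y) ^ 2 <= 1).
  { rewrite <- pow2_abs. replace 1 with (1 ^ 2) by ring. apply pow_incr. split; [apply Rabs_pos | easy]. }
  lra. }
set (z := c / (1 + d)).
assert (Hz : 1 + z ^ 2 = 2 / (1 + d)).
{ transitivity (((1 + d) ^ 2 + c ^ 2) / (1 + d) ^ 2); [unfold z; field; lra |].
  replace ((1 + d) ^ 2 + c ^ 2) with (2 * (1 + d)) by lra. field. lra. }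
assert (Hz0 : 0 < 1 + z ^ 2) by (assert (X := pow2_ge_0 z); lra).
assert (Hsq : sqrt (1 + z²) * sqrt (1 + z²) = 1 + z ^ 2).
{ rewrite sqrt_sqrt; [unfold Rsqr; ring |]. unfold Rsqr. lra. }
assert (Hs0 : sqrt (1 + z²) <> 0) by (intros E; rewrite E in Hsq; lra).
assert (Hc : cos (2 * atan z) = d).
{ rewrite cos_2a, cos_atan, sin_atan.
  replace (1 / sqrt (1 + z²) * (1 / sqrt (1 + z²)) - z / sqrt (1 + z²) * (z / sqrt (1 + z²)))
    with ((1 - z ^ 2) / (sqrt (1 + z²) * sqrt (1 + z²))) by (field; easy).
  rewrite Hsq. replace (1 - z ^ 2) with (2 - (1 + z ^ 2)) by ring. rewrite Hz. field. lra. }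
assert (Hsn : sin (2 * atan z) = c).
{ rewrite sin_2a, cos_atan, sin_atan.
  replace (2 * (z / sqrt (1 + z²)) * (1 / sqrt (1 + z²)))
    with (2 * z / (sqrt (1 + z²) * sqrt (1 + z²))) by (field; easy).
  rewrite Hsq, Hz. unfold z. field. lra. }
exists (2 * atan z). split.
- unfold rot. cbn [fst snd]. rewrite Hc, Hsn. unfold c, d. f_equal.
  + transitivity (x' * (x ^ 2 + y ^ 2)); [rewrite H; ring | ring].
  + transitivity (y' * (x ^ 2 + y ^ 2)); [rewrite H; ring | ring].
- rewrite Rabs_mult, (Rabs_pos_eq 2) by lra. apply Rmult_le_compat_l; [lra |].
  assert (Ha : Rabs (atan z) <= Rabs z).
  { destruct (MVT_gen atan 0 z (fun x => / (1 + x ^ 2))) as (u & _ & Hu).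
    - intros v _. auto_derive; [easy |]. unfold Rsqr. field. nra.
    - intros v _. apply derivable_continuous_pt. apply derivable_pt_atan.
    - rewrite atan_0, !Rminus_0_r in Hu. rewrite Hu, Rabs_mult.
      assert (0 <= u ^ 2) by apply pow2_ge_0.
      assert (0 < / (1 + u ^ 2) <= 1).
      { split; [apply Rinv_0_lt_compat; lra |]. rewrite <- Rinv_1. apply Rinv_le_contravar; lra. }
      rewrite (Rabs_pos_eq (/ _)) by lra. assert (X := Rabs_pos z). nra. }
  eapply Rle_trans; [exact Ha |].
  apply Rle_trans with (Rabs c).
  + unfold z, Rdiv. rewrite Rabs_mult, (Rabs_pos_eq (/ (1 + d))) by (left; apply Rinv_0_lt_compat; lra).
    assert (/ (1 + d) <= 1) by (rewrite <- Rinv_1; apply Rinv_le_contravar; lra).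
    assert (X := Rabs_pos c). nra.
  + assert (Bx : Rabs x <= 1) by (apply Rabs_le; nra).
    assert (By : Rabs y <= 1) by (apply Rabs_le; nra).
    replace c with (x * (y' - y) - y * (x' - x)) by (unfold c; ring).
    unfold Rminus at 1. rle Rabs_triang.
    rewrite Rabs_Ropp, !Rabs_mult.
    assert (X := Rabs_pos (x' - x)). assert (Y := Rabs_pos (y' - y)). nra.
Qed.

Lemma smooth_near (f : pt -> R) (s q x y eps : R) : smooth f -> ok (s, q, (x, y)) -> 0 < eps ->
  exists dl, 0 < dl /\ forall s' q' x' y', ok (s', q', (x', y')) ->
  Rabs (s' - s) < dl -> Rabs (q' - q) < dl -> Rabs (x' - x) < dl -> Rabs (y' - y) < dl ->
  Rabs (f (s', q', (x', y')) - f (s, q, (x, y))) < eps.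
Proof.
intros Hf [Hs Hw] Heps. change (0 <= s) in Hs. change (circle (x, y)) in Hw.
destruct (big_O_local _ _ _ (s + 1) (CK_Lip _ _ DS (Hf O))) as (K1 & HK1 & L1).
destruct (big_O_local _ _ _ (s + 1) (CK_Lip _ _ DQ (Hf O))) as (K2 & HK2 & L2).
destruct (big_O_local _ _ _ (s + 1) (CK_Lip _ _ DW (Hf O))) as (K3 & HK3 & L3).
(* The points are joined by moves in [s], [q] and [w] in turn; [4] appears because the angle is at
   most [2 (dl + dl)]. *)
set (K := K1 + K2 + 4 * K3 + 1).
assert (HK : 0 < K) by (unfold K; lra).
set (dl := Rmin 1 (eps / K)). exists dl.
assert (D1 : dl <= 1) by apply Rmin_l. assert (D2 : dl <= eps / K) by apply Rmin_r.
assert (Hdl : 0 < dl) by (apply Rmin_pos; [lra | now apply Rdiv_lt_0_compat]).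
split; [easy |].
intros s' q' x' y' [Hs' Hw'] B1 B2 B3 B4. change (0 <= s') in Hs'. change (circle (x', y')) in Hw'.
destruct (circle_near (x, y) (x', y') Hw Hw') as (t & Et & Ht); cbn [fst snd] in *; try lra.
assert (S1 : s' <= s + 1) by (assert (X := Rle_abs (s' - s)); lra).
assert (A1 := L1 (s' - s) (s, q, (x, y))). unfold step, ps, pq, pw in A1. cbn [fst snd] in A1.
replace (s + (s' - s)) with s' in A1 by ring.
assert (A2 := L2 (q' - q) (s', q, (x, y))). unfold step, ps, pq, pw in A2. cbn [fst snd] in A2.
replace (q + (q' - q)) with q' in A2 by ring.
assert (A3 := L3 t (s', q', (x, y))). unfold step, ps, pq, pw in A3. cbn [fst snd] in A3.
rewrite <- Et in A3.
specialize (A1 (conj Hs Hw) (conj Hs' Hw) ltac:(lra) S1).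
specialize (A2 (conj Hs' Hw) (conj Hs' Hw) S1 S1).
specialize (A3 (conj Hs' Hw) (conj Hs' Hw') S1 S1).
rewrite pow_1 in A1, A2, A3.
replace (f (s', q', (x', y')) - f (s, q, (x, y))) with
  ((f (s', q', (x', y')) - f (s', q', (x, y))) + (f (s', q', (x, y)) - f (s', q, (x, y)))
   + (f (s', q, (x, y)) - f (s, q, (x, y)))) by ring.
eapply Rle_lt_trans; [apply Rabs_triang |].
eapply Rle_lt_trans; [apply Rplus_le_compat_r, Rabs_triang |].
assert (K1 * Rabs (s' - s) <= K1 * dl) by (apply Rmult_le_compat_l; lra).
assert (K2 * Rabs (q' - q) <= K2 * dl) by (apply Rmult_le_compat_l; lra).
assert (K3 * Rabs t <= K3 * (4 * dl)) by (apply Rmult_le_compat_l; lra).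
apply Rlt_le_trans with (K * dl); [unfold K; lra |].
apply Rmult_le_compat_l with (r := K) in D2; [| lra].
replace (K * (eps / K)) with eps in D2 by (field; lra). easy.
Qed.

Lemma smooth_continuous_on (f : pt -> R) : smooth f ->
  continuous_on (fun p : R * R * (R * R) => 0 <= fst (fst p) /\ circle (snd p)) f.
Proof.
intros Hf [[s q] [x y]] Hp.
apply (proj2 (filterlim_locally f (f (s, q, (x, y))))). intros eps.
destruct (smooth_near f s q x y eps Hf Hp (cond_pos eps)) as (dl & Hd & H).
exists (mkposreal _ Hd). intros [[s' q'] [x' y']] [[B1 B2] [B3 B4]] Hp'.
exact (H s' q' x' y' Hp' B1 B2 B3 B4).
Qed.

Lemma smooth_smooth_with_partials (f : pt -> R) : smooth f ->
  smooth_with_partials (fun s q w => f (s, q, w)) (fun a b c s q w => partial f a b c (s, q, w)).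
Proof.
intros Hf. split.
- easy.
- intros a b c s q w Hs Hw. assert (Ho : ok (s, q, w)) by now split.
  rewrite partial_S_s.
  destruct (deriv_spec DS _ (smooth_partial f a b c Hf)) as [T _].
  destruct (Tay_local _ _ _ _ T Ho) as (K & HK).
  apply is_derive_halfline_quadratic with K; [easy |]. intros s' Hs' H1.
  specialize (HK (s' - s)). unfold step, ps, pq, pw in HK. cbn [fst snd] in HK.
  replace (s + (s' - s)) with s' in HK by ring. apply HK; [now split | now right].
- intros a b c s q w Hs Hw. assert (Ho : ok (s, q, w)) by now split.
  rewrite partial_S_q by easy.
  destruct (deriv_spec DQ _ (smooth_partial f a b c Hf)) as [T _].
  destruct (Tay_local _ _ _ _ T Ho) as (K & HK).
  apply is_derive_quadratic with K. intros q'.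
  specialize (HK (q' - q)). unfold step, ps, pq, pw in HK. cbn [fst snd] in HK.
  replace (q + (q' - q)) with q' in HK by ring. apply HK; [now split | now left].
- intros a b c s q w Hs Hw. assert (Ho : ok (s, q, w)) by now split.
  rewrite partial_S_w by easy.
  destruct (deriv_spec DW _ (smooth_partial f a b c Hf)) as [T _].
  destruct (Tay_local _ _ _ _ T Ho) as (K & HK).
  apply is_derive_quadratic with K. intros t. rewrite rot_0, Rminus_0_r.
  specialize (HK t). apply HK; [now apply ok_step | now left].
- intros a b c.
  assert (X := smooth_continuous_on _ (smooth_partial f a b c Hf)).
  intros [[s q] w] Hp. apply filterlim_ext with (partial f a b c); [now intros [[s' q'] w'] |].
  exact (X (s, q, w) Hp).
Qed.

(** * Initial data *)

Lemma Lipschitz_of_derive (f f' : R -> R) (K a b : R) :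
  (forall x, Rmin a b <= x <= Rmax a b -> is_derive f x (f' x)) ->
  (forall x, Rmin a b <= x <= Rmax a b -> Rabs (f' x) <= K) ->
  Rabs (f b - f a) <= K * Rabs (b - a).
Proof.
intros H HK.
destruct (MVT_gen f a b f') as (c & Hc & E).
- intros x Hx. apply H. lra.
- intros x Hx. apply continuity_pt_filterlim.
  apply (ex_derive_continuous f x). exists (f' x). now apply H.
- rewrite E, Rabs_mult. apply Rmult_le_compat_r; [apply Rabs_pos | now apply HK].
Qed.

Lemma Taylor_of_derive (f f' f'' : R -> R) (K a b : R) :
  (forall x, is_derive f x (f' x)) -> (forall x, is_derive f' x (f'' x)) ->
  (forall x, Rabs (f'' x) <= K) ->
  Rabs (f b - f a - (b - a) * f' a) <= K * Rabs (b - a) ^ 2.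
Proof.
intros H H' HK.
replace (f b - f a - (b - a) * f' a) with ((f b - b * f' a) - (f a - a * f' a)) by ring.
replace (K * Rabs (b - a) ^ 2) with ((K * Rabs (b - a)) * Rabs (b - a)) by ring.
assert (HK0 : 0 <= K) by (eapply Rle_trans; [apply Rabs_pos | apply (HK 0)]).
apply (Lipschitz_of_derive (fun x => f x - x * f' a) (fun x => f' x - f' a)).
- intros x _. apply (is_derive_minus (V := R_NormedModule) f (fun x => x * f' a)); [apply H |].
  auto_derive; [easy | ring].
- intros x Hx. apply Rle_trans with (K * Rabs (x - a)).
  + now apply (Lipschitz_of_derive f' f'').
  + apply Rmult_le_compat_l; [easy |].
    revert Hx. unfold Rmin, Rmax, Rabs. repeat destruct Rle_dec; repeat destruct Rcase_abs; lra.
Qed.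

Lemma circle_angle (w : R * R) : circle w -> exists v, - PI <= v <= PI /\ w = (cos v, sin v).
Proof.
destruct w as [x y]. unfold circle. cbn [fst snd]. intros H.
assert (Hx : -1 <= x <= 1) by nra.
assert (Hb := acos_bound x). assert (HP := PI_RGT_0).
assert (Hs : sqrt (1 - x²) = Rabs y).
{ rewrite <- sqrt_Rsqr_abs. f_equal. unfold Rsqr. lra. }
destruct (Rle_dec 0 y) as [Hy | Hy].
- exists (acos x). split; [lra |]. rewrite cos_acos, sin_acos, Hs, Rabs_pos_eq; easy.
- exists (- acos x). split; [lra |].
  rewrite cos_neg, sin_neg, cos_acos, sin_acos, Hs, Rabs_left by lra. f_equal. ring.
Qed.

Lemma cos_Lip (x y : R) : Rabs (cos y - cos x) <= Rabs (y - x).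
Proof.
rewrite <- (Rmult_1_l (Rabs (y - x))).
apply (Lipschitz_of_derive cos (fun x => - sin x)).
- intros z _. auto_derive; [easy | ring].
- intros z _. rewrite Rabs_Ropp. apply Rabs_le. apply SIN_bound.
Qed.

Lemma sin_Lip (x y : R) : Rabs (sin y - sin x) <= Rabs (y - x).
Proof.
rewrite <- (Rmult_1_l (Rabs (y - x))).
apply (Lipschitz_of_derive sin (fun x => cos x)).
- intros z _. auto_derive; [easy | ring].
- intros z _. apply Rabs_le. apply COS_bound.
Qed.

Lemma circle_cos_sin (v : R) : circle (cos v, sin v).
Proof. unfold circle. cbn [fst snd]. assert (X := sin2_cos2 v). unfold Rsqr in X. lra. Qed.

(** In the coordinates [(q, v)] with [w = (cos v, sin v)] the set becomes the rectangle [[-M, M] x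
    [-PI, PI]]. A finite cover by cells on which [f] stays within [1] of its value at the centre
    gives the bound. *)
Lemma cylinder_bounded (f : R * (R * R) -> R) (M : R) :
  continuous_on (fun p : R * (R * R) => circle (snd p)) f ->
  exists K, 0 <= K /\ forall q w, circle w -> Rabs q <= M -> Rabs (f (q, w)) <= K.
Proof.
intros Hf.
assert (H : forall z : Compactness.Tn 2 R, exists d : posreal, forall q v,
  Rabs (q - fst z) < d -> Rabs (v - fst (snd z)) < d ->
  Rabs (f (q, (cos v, sin v)) - f (fst z, (cos (fst (snd z)), sin (fst (snd z))))) < 1).
{ intros [u [v []]]. cbn [fst snd].
  assert (Hc := Hf (u, (cos v, sin v)) (circle_cos_sin v)).
  destruct (proj1 (filterlim_locally f _) Hc (mkposreal 1 Rlt_0_1)) as [d Hd].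
  exists d. intros q v' Hq Hv.
  refine (Hd (q, (cos v', sin v')) (conj Hq (conj _ _)) (circle_cos_sin v')).
  - eapply Rle_lt_trans; [apply cos_Lip | exact Hv].
  - eapply Rle_lt_trans; [apply sin_Lip | exact Hv]. }
set (delta := fun z => proj1_sig (constructive_indefinite_description _ (H z))).
assert (Hdelta : forall z q v, Rabs (q - fst z) < delta z -> Rabs (v - fst (snd z)) < delta z ->
  Rabs (f (q, (cos v, sin v)) - f (fst z, (cos (fst (snd z)), sin (fst (snd z))))) < 1).
{ intros z. unfold delta. destruct constructive_indefinite_description as [d Hd]. exact Hd. }
assert (Hl := NNPP _ (compactness_list 2 (- M, (- PI, tt)) (M, (PI, tt)) delta)).
destruct Hl as [l Hl].
set (g := fun z : Compactness.Tn 2 R => f (fst z, (cos (fst (snd z)), sin (fst (snd z))))).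
assert (Hm : exists K, 0 <= K /\ forall z, List.In z l -> Rabs (g z) <= K).
{ clear Hl. induction l as [| z l (K & HK & IH)].
  - exists 0. split; [lra | intros z []].
  - exists (K + Rabs (g z)). assert (X := Rabs_pos (g z)). split; [lra |].
    intros z' [<- | Hz]; [lra |]. specialize (IH z' Hz). lra. }
destruct Hm as (K & HK & Hm). exists (K + 1). split; [lra |].
intros q w Hw Hq. destruct (circle_angle w Hw) as (v & Hv & ->).
apply Rabs_le_between in Hq.
destruct (Hl (q, (v, tt))) as (z & Hz & _ & Hc).
{ split; [easy | split; easy]. }
specialize (Hm z Hz). destruct z as [a [b []]]. destruct Hc as [C1 [C2 _]]. cbn in C1, C2.
assert (X := Hdelta (a, (b, tt)) q v C1 C2). unfold g in Hm. cbn [fst snd] in *.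
assert (Y := Rabs_triang_inv (f (q, (cos v, sin v))) (f (a, (cos b, sin b)))). lra.
Qed.

Lemma is_derive_ang_rot (f : R * R -> R) (w : R * R) (t l : R) : is_derive_ang f (rot t w) l ->
  is_derive (fun x => f (rot x w)) t l.
Proof.
intros H. unfold is_derive_ang in H.
apply is_derive_ext with (fun x => (fun u => f (rot u (rot t w))) (x - t)).
- intros x. rewrite <- rot_plus. f_equal. f_equal. ring.
- replace l with (scal 1 l) by apply Rmult_1_l.
  apply (is_derive_comp (V := R_NormedModule) (fun u => f (rot u (rot t w))) (fun x => x - t)).
  + replace (t - t) with 0 by ring. exact H.
  + auto_derive; [easy | ring].
Qed.

Lemma is_derive_locally_0 (f : R -> R) (x l : R) : locally x (fun y => f y = 0) ->
  is_derive f x l -> l = 0.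
Proof.
intros H0 H. apply is_derive_unique in H. rewrite <- H.
rewrite (Derive_ext_loc f (fun _ => 0)) by exact H0. apply Derive_const.
Qed.

Lemma data_partials_supp (U0 : R -> R * R -> R) (D : nat -> nat -> R -> R * R -> R) (M : R) :
  smooth_data_with_partials U0 D ->
  (forall q w, circle w -> M < Rabs q -> U0 q w = 0) ->
  forall b c q w, circle w -> M < Rabs q -> D b c q w = 0.
Proof.
intros HD HM b. induction b as [| b IHb].
- induction c as [| c IHc]; intros q w Hw Hq.
  + rewrite (data_partials_0 _ _ HD) by easy. now apply HM.
  + apply (is_derive_locally_0 (fun t => D O c q (rot t w)) 0).
    * apply filter_forall. intros t. apply IHc; [now apply circle_rot | easy].
    * now apply (data_partials_w _ _ HD).
- intros c q w Hw Hq. apply (is_derive_locally_0 (fun q' => D b c q' w) q).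
  + assert (Hd : 0 < Rabs q - M) by lra. exists (mkposreal _ Hd). intros q' Hq'.
    change (Rabs (q' - q) < Rabs q - M) in Hq'. apply IHb; [easy |].
    assert (X := Rabs_triang_inv q q'). rewrite Rabs_minus_sym in X. lra.
  + now apply (data_partials_q _ _ HD).
Qed.

Lemma data_bounded (U0 : R -> R * R -> R) (D : nat -> nat -> R -> R * R -> R) (M : R) :
  smooth_data_with_partials U0 D ->
  (forall q w, circle w -> M < Rabs q -> U0 q w = 0) ->
  forall b c, exists K, 0 <= K /\ forall q w, circle w -> Rabs (D b c q w) <= K.
Proof.
intros HD HM b c.
destruct (cylinder_bounded (fun p => D b c (fst p) (snd p)) M (data_partials_cont _ _ HD b c))
  as (K & HK & H).
exists K. split; [easy |]. intros q w Hw.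
destruct (Rle_dec (Rabs q) M) as [Hq | Hq].
- now apply (H q w).
- rewrite (data_partials_supp U0 D M HD HM) by (easy || lra). now rewrite Rabs_R0.
Qed.

Lemma big_O_of_bound (d : dir) (k : nat) (K : R) (F : R -> pt -> R) :
  (forall t p, ok p -> ok (step d t p) -> Rabs (F t p) <= K * Rabs t ^ k) -> big_O d k F.
Proof.
intros H. destruct (big_O_const d K) as (C & HC & HK). exists C. split; [easy |].
intros t p Hp Hp'. eapply Rle_trans; [now apply H |].
apply Rmult_le_compat_r; [apply pow_le, Rabs_pos |].
specialize (HK t p Hp Hp'). rewrite pow_O, Rmult_1_r in HK.
eapply Rle_trans; [apply Rle_abs | exact HK].
Qed.

Lemma bnd_of_bound (K : R) (f : pt -> R) : (forall p, ok p -> Rabs (f p) <= K) -> bnd f.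
Proof.
intros H. apply (bnd_le f (fun _ => K)); [apply bnd_const |].
intros p Hp. eapply Rle_trans; [now apply H | apply Rle_abs].
Qed.

Definition bounded_family (D : nat -> nat -> R -> R * R -> R) : Prop :=
  (forall b c, exists K, 0 <= K /\ forall q w, circle w -> Rabs (D b c q w) <= K) /\
  (forall b c q w, circle w -> is_derive (fun q' => D b c q' w) q (D (S b) c q w)) /\
  (forall b c q w, circle w -> is_derive_ang (fun w' => D b c q w') w (D b (S c) q w)).

Lemma bounded_family_smooth (D : nat -> nat -> R -> R * R -> R) (b c : nat) :
  bounded_family D -> smooth (fun p => D b c (pq p) (pw p)).
Proof.
intros (HB & HDq & HDw) n. revert b c.
assert (H0 : forall b c, bnd (fun p => D b c (pq p) (pw p)) /\
  (forall d, Lip d (fun p => D b c (pq p) (pw p)))).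
{ intros b c. destruct (HB b c) as (K & HK & H). split.
  - apply (bnd_of_bound K). intros p [_ Hw]. now apply H.
  - intros [| |].
    + apply big_O_of_bound with 0. intros t p _ _. unfold step, pq, pw. cbn [fst snd].
      rewrite Rminus_diag, Rabs_R0. lra.
    + destruct (HB (S b) c) as (K' & HK' & H'). apply big_O_of_bound with K'.
      intros t p [_ Hw] _. rewrite pow_1.
      change (Rabs (D b c (pq p + t) (pw p) - D b c (pq p) (pw p)) <= K' * Rabs t).
      replace t with (pq p + t - pq p) at 2 by ring.
      apply (Lipschitz_of_derive (fun q => D b c q (pw p)) (fun q => D (S b) c q (pw p))); auto.
    + destruct (HB b (S c)) as (K' & HK' & H'). apply big_O_of_bound with K'.
      intros t p [_ Hw] _. rewrite pow_1.
      change (Rabs (D b c (pq p) (rot t (pw p)) - D b c (pq p) (pw p)) <= K' * Rabs t).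
      rewrite <- (rot_0 (pw p)) at 2.
      replace t with (t - 0) at 2 by ring.
      apply (Lipschitz_of_derive (fun x => D b c (pq p) (rot x (pw p)))
        (fun x => D b (S c) (pq p) (rot x (pw p)))); auto using circle_rot.
      intros x _. apply (is_derive_ang_rot (D b c (pq p))). auto using circle_rot. }
induction n as [| n IH]; intros b c; destruct (H0 b c) as [Hb Hl]; [now split |].
split; [easy | split; [easy |]].
exists (fun d p => match d with DS => 0 | DQ => D (S b) c (pq p) (pw p) | DW => D b (S c) (pq p) (pw p) end).
intros [| |]; split; auto.
- apply big_O_of_bound with 0. intros t p _ _. unfold step, pq, pw. cbn [fst snd].
  rewrite Rminus_diag, Rmult_0_r, Rminus_0_r, Rabs_R0. lra.
- apply CK_const.
- destruct (HB (S (S b)) c) as (K' & HK' & H'). apply big_O_of_bound with K'.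
  intros t p [_ Hw] _.
  change (Rabs (D b c (pq p + t) (pw p) - D b c (pq p) (pw p) - t * D (S b) c (pq p) (pw p)) <= K' * Rabs t ^ 2).
  assert (X := Taylor_of_derive (fun q => D b c q (pw p)) (fun q => D (S b) c q (pw p))
    (fun q => D (S (S b)) c q (pw p)) K' (pq p) (pq p + t)).
  replace (pq p + t - pq p) with t in X by ring. apply X; auto.
- destruct (HB b (S (S c))) as (K' & HK' & H'). apply big_O_of_bound with K'.
  intros t p [_ Hw] _.
  assert (X := Taylor_of_derive (fun x => D b c (pq p) (rot x (pw p)))
    (fun x => D b (S c) (pq p) (rot x (pw p)))
    (fun x => D b (S (S c)) (pq p) (rot x (pw p))) K' 0 t).
  cbv beta in X. rewrite rot_0, Rminus_0_r in X. apply X.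
  + intros x. apply (is_derive_ang_rot (D b c (pq p))). auto using circle_rot.
  + intros x. apply (is_derive_ang_rot (D b (S c) (pq p))). auto using circle_rot.
  + auto using circle_rot.
Qed.

(** * Smoothness and boundedness of [G] on the circle *)

Lemma circle_bound (w : R * R) : circle w -> Rabs (fst w) <= 1 /\ Rabs (snd w) <= 1.
Proof. unfold circle. intros H. split; apply Rabs_le; nra. Qed.

(* The angular derivatives of a linear form [a w_1 + b w_2] are again linear forms. *)
Lemma smooth_linear_form (a b : R) : smooth (fun p => a * fst (pw p) + b * snd (pw p)).
Proof.
set (J := fun ab : R * R => (snd ab, - fst ab)).
set (D := fun k c (q : R) (w : R * R) => let ab := Nat.iter c J (a, b) in
  match k with O => fst ab * fst w + snd ab * snd w | S _ => 0 end).
apply (bounded_family_smooth D 0 0). split; [| split].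
- intros [| k] c; [| exists 0; split; [lra | intros; simpl; rewrite Rabs_R0; lra]].
  exists (Rabs (fst (Nat.iter c J (a, b))) + Rabs (snd (Nat.iter c J (a, b)))).
  assert (X := Rabs_pos (fst (Nat.iter c J (a, b)))).
  assert (Y := Rabs_pos (snd (Nat.iter c J (a, b)))).
  split; [lra |]. intros q w Hw. apply circle_bound in Hw. unfold D.
  rle Rabs_triang. rewrite !Rabs_mult. nra.
- intros [| k] c q w _.
  + exact (@is_derive_const R_AbsRing R_NormedModule (D O c 0 w) q).
  + exact (@is_derive_const R_AbsRing R_NormedModule 0 q).
- intros [| k] c q w _; [| exact (@is_derive_const R_AbsRing R_NormedModule 0 0)].
  unfold is_derive_ang, D, rot. simpl Nat.iter. cbn [fst snd].
  set (u := Nat.iter c J (a, b)).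
  auto_derive; [easy |]. unfold J. cbn [fst snd]. rewrite sin_0, cos_0. ring.
Qed.

Lemma smooth_const (c : R) : smooth (fun _ => c).
Proof. intros n. apply CK_const. Qed.

Lemma smooth_ext (f g : pt -> R) : (forall p, ok p -> f p = g p) -> smooth f -> smooth g.
Proof. intros E H n. now apply (CK_ext n f). Qed.

Lemma smooth_plus (f g : pt -> R) : smooth f -> smooth g -> smooth (fun p => f p + g p).
Proof. intros Hf Hg n. now apply CK_plus. Qed.

Lemma smooth_mult (f g : pt -> R) : smooth f -> smooth g -> smooth (fun p => f p * g p).
Proof. intros Hf Hg n. now apply CK_mult. Qed.

Lemma smooth_sum (F : nat -> pt -> R) (n : nat) : (forall k, smooth (F k)) ->
  smooth (fun p => sum_f_R0 (fun k => F k p) n).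
Proof. intros H. induction n; simpl; [apply H | now apply smooth_plus]. Qed.

Lemma smooth_hat (a : nat) : smooth (fun p => hat (pw p) a).
Proof.
destruct a as [| [| a]].
- exact (smooth_const (-1)).
- apply smooth_ext with (2 := smooth_linear_form 1 0). intros p _. unfold hat. ring.
- apply smooth_ext with (2 := smooth_linear_form 0 1). intros p _. unfold hat. ring.
Qed.

Lemma smooth_G (g0 : nat -> nat -> R) : smooth (fun p => G g0 (pw p)).
Proof.
apply (smooth_sum (fun a p => sum_f_R0 (fun b => g0 a b * hat (pw p) a * hat (pw p) b) 2)).
intros a. apply (smooth_sum (fun b p => g0 a b * hat (pw p) a * hat (pw p) b)).
intros b. apply smooth_mult; [apply smooth_mult |]; auto using smooth_const, smooth_hat.
Qed.

Lemma G_bounded (g0 : nat -> nat -> R) : exists K, 0 <= K /\ forall w, circle w -> Rabs (G g0 w) <= K.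
Proof.
exists (sum_f_R0 (fun a => sum_f_R0 (fun b => Rabs (g0 a b)) 2) 2). split.
- apply cond_pos_sum. intros a. apply cond_pos_sum. intros b. apply Rabs_pos.
- intros w Hw.
  assert (Hh : forall a, Rabs (hat w a) <= 1).
  { apply circle_bound in Hw. intros [| [| a]]; simpl; [apply Rabs_le; lra | apply Hw | apply Hw]. }
  unfold G. rle (Rsum_abs (fun a => sum_f_R0 (fun b => g0 a b * hat w a * hat w b) 2)).
  apply sum_Rle. intros a _.
  rle (Rsum_abs (fun b => g0 a b * hat w a * hat w b)).
  apply sum_Rle. intros b _. rewrite !Rabs_mult.
  assert (X := Hh a). assert (Y := Hh b).
  assert (P0 := Rabs_pos (g0 a b)). assert (P1 := Rabs_pos (hat w a)). assert (P2 := Rabs_pos (hat w b)).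
  assert (Rabs (g0 a b) * Rabs (hat w a) <= Rabs (g0 a b)) by nra.
  assert (0 <= Rabs (g0 a b) * Rabs (hat w a)) by nra. nra.
Qed.

(** * Global solutions when [G >= 0] *)

Lemma bnd_abs (f : pt -> R) : bnd f -> bnd (fun p => Rabs (f p)).
Proof. intros H. apply (bnd_le _ f H). intros. rewrite Rabs_Rabsolu. lra. Qed.

Lemma bnd_sum (F : nat -> pt -> R) (n : nat) : (forall k, bnd (F k)) ->
  bnd (fun p => sum_f_R0 (fun k => F k p) n).
Proof. intros H. induction n; simpl; [apply H | now apply bnd_plus]. Qed.

Lemma bnd_sum_orders (lo N : nat) (f : pt -> R) : smooth f ->
  bnd (fun p => sum_orders lo N (fun a b c => Rabs (partial f a b c p))).
Proof.
intros Hf. unfold sum_orders.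
apply (bnd_sum (fun a p => sum_f_R0 (fun b => sum_f_R0 (fun c =>
    if andb (Nat.leb lo (a + b + c)) (Nat.leb (a + b + c) N)
    then Rabs (partial f a b c p) else 0) N) N)). intros a.
apply (bnd_sum (fun b p => sum_f_R0 (fun c =>
    if andb (Nat.leb lo (a + b + c)) (Nat.leb (a + b + c) N)
    then Rabs (partial f a b c p) else 0) N)). intros b.
apply (bnd_sum (fun c p =>
    if andb (Nat.leb lo (a + b + c)) (Nat.leb (a + b + c) N)
    then Rabs (partial f a b c p) else 0)). intros c.
destruct (_ && _)%bool; [| apply bnd_const].
apply bnd_abs, (CK_bnd O), smooth_partial, Hf.
Qed.

Lemma bnd_exp_linear (K : R) (f : pt -> R) : (forall p, ok p -> f p <= K * ps p) ->
  bnd (fun p => exp (f p)).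
Proof.
intros H. exists (Rabs K + 1). assert (X := Rabs_pos K). split; [lra |]. intros p Hp.
rewrite Rabs_pos_eq by (left; apply exp_pos). unfold gr.
rewrite <- (Rmult_1_l (exp (f p))).
apply Rmult_le_compat; [lra | left; apply exp_pos | lra |].
apply exp_le. specialize (H p Hp). assert (Y := Rle_abs K). destruct Hp as [Hp _]. nra.
Qed.

Lemma bnd_linear (K : R) (f : pt -> R) : 0 <= K -> (forall p, ok p -> Rabs (f p) <= K * ps p) -> bnd f.
Proof.
intros HK H. exists (K + 1). split; [lra |]. intros p Hp. eapply Rle_trans; [now apply H |].
unfold gr. apply Rmult_le_compat; [easy | apply Hp | lra |].
rle s_le_exp. apply exp_le. destruct Hp. nra.
Qed.

Lemma smooth_scal (c : R) (f : pt -> R) : smooth f -> smooth (fun p => c * f p).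
Proof. intros Hf n. now apply CK_scal. Qed.

Lemma Tay_scal (d : dir) (c : R) (f g : pt -> R) : Tay d f g ->
  Tay d (fun p => c * f p) (fun p => c * g p).
Proof. intros H. apply (big_O_ext _ _ _ _ (big_O_scal d 2 c _ H)). intros. ring. Qed.

Lemma Tay_s_const (f : R -> R * R -> R) : Tay DS (fun p => f (pq p) (pw p)) (fun _ => 0).
Proof.
apply big_O_of_bound with 0. intros t p _ _. unfold step, pq, pw. cbn [fst snd].
rewrite Rminus_diag, Rmult_0_r, Rminus_0_r, Rabs_R0. lra.
Qed.

(** The profile of each angle is taken with [g = G g0 w], which is where the sign of [G] enters. The
    last clause, linear growth of the exponent, keeps both [h] and [1 / h] exponentially bounded. *)
Lemma smooth_profile (g0 : nat -> nat -> R) (B : R -> R * R -> R) (M b : R) :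
  (forall w, circle w -> 0 <= G g0 w) -> 0 <= M -> 0 <= b ->
  smooth (fun p => B (pq p) (pw p)) ->
  (forall q w, circle w -> Rabs (B q w) <= b) ->
  (forall q q' w, circle w -> Rabs (B q w - B q' w) <= b * Rabs (q - q')) ->
  (forall q w, circle w -> M < Rabs q -> B q w = 0) ->
  exists Phi, smooth Phi /\
    solves_profile M (fun p => B (pq p) (pw p)) (fun p => G g0 (pw p) * B (pq p) (pw p)) Phi /\
    exists K, 0 <= K /\ forall p, ok p ->
      Rabs (G g0 (pw p) * B (pq p) (pw p) * Phi p) <= K * ps p.
Proof.
intros HG HM Hb SB HB HBL Hsupp.
destruct (G_bounded g0) as (KG & HKG & HKG').
assert (H : forall w, exists k, circle w -> reg2 k /\ forall s, 0 <= s ->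
    (forall q, k s q = int_s (int_q M (fun s x => B x w * weight (G g0 w) (fun x => B x w) k s x)) s q) /\
    RInt (weight (G g0 w) (fun x => B x w) k s) (- M) M <= 2 * M /\
    (forall q, Rabs (k s q) <= 2 * M * b * s)).
{ intros w. destruct (classic (circle w)) as [Hw | Hw].
  - destruct (profile_exists M b (G g0 w) (fun x => B x w)) as (k & Hk); auto. now exists k.
  - exists (fun _ _ => 0). easy. }
set (k := fun w => proj1_sig (constructive_indefinite_description _ (H w))).
assert (Hk : forall w, circle w -> reg2 (k w) /\ forall s, 0 <= s ->
    (forall q, k w s q = int_s (int_q M (fun s x => B x w * weight (G g0 w) (fun x => B x w) (k w) s x)) s q) /\
    RInt (weight (G g0 w) (fun x => B x w) (k w) s) (- M) M <= 2 * M /\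
    (forall q, Rabs (k w s q) <= 2 * M * b * s)).
{ intros w Hw. unfold k. destruct constructive_indefinite_description as [k0 Hk0]. simpl. auto. }
clearbody k.
set (Phi := fun p => k (pw p) (ps p) (pq p)).
set (Bp := fun p => B (pq p) (pw p)).
set (beta := fun p => G g0 (pw p) * B (pq p) (pw p)).
assert (HMb : 0 <= M * b) by nra.
assert (HPhi : forall p, ok p -> Rabs (Phi p) <= 2 * M * b * ps p).
{ intros p [Hs Hw]. apply (proj2 (Hk _ Hw) _ Hs). }
assert (Hbeta : forall p, ok p -> Rabs (beta p) <= KG * b).
{ intros p [_ Hw]. unfold beta. rewrite Rabs_mult.
  apply Rmult_le_compat; auto using Rabs_pos. }
set (K := KG * b * (2 * M * b)).
assert (HK : 0 <= K) by (unfold K; apply Rmult_le_pos; [nra | lra]).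
assert (Hlam : forall p, ok p -> Rabs (beta p * Phi p) <= K * ps p).
{ intros p Hp. rewrite Rabs_mult. unfold K.
  rewrite Rmult_assoc. apply Rmult_le_compat; auto using Rabs_pos. }
assert (Sol : solves_profile M Bp beta Phi).
{ intros [[s q] w] [Hs Hw]. exact (proj1 (proj2 (Hk w Hw) s Hs) q). }
exists Phi. split; [| split; [exact Sol | now exists K]].
(* A single constant has to bound both [B] and [beta = G B]. *)
intros n. apply (profile_CK M (b + KG * b) Bp beta); auto.
- nra.
- intros m. apply CK_mult; [apply smooth_G | apply SB].
- intros p [_ Hw] Hq. now apply Hsupp.
- intros p [_ Hw]. specialize (HB (pq p) (pw p) Hw). change (Rabs (Bp p) <= b) in HB. nra.
- intros p Hp. specialize (Hbeta p Hp). lra.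
- intros w Hw. apply (Hk w Hw).
- apply (bnd_linear (2 * M * b)); [lra | easy].
- apply (bnd_exp_linear K). intros p Hp. eapply Rle_trans; [apply Rle_abs | auto].
- intros [[s q] w] [Hs Hw]. apply (proj2 (Hk w Hw) s Hs).
Qed.

Lemma sufficiency (g0 : nat -> nat -> R) :
  (forall w, circle w -> 0 <= G g0 w) -> geometric_weak_null_condition g0.
Proof.
intros HG U0 [[D HD] [M0 HM0]].
(* The added [1] puts [q = M] strictly outside the support, so [U0 M w = 0] when [U0] is recovered
   by integrating from [M]. *)
set (M := Rmax M0 0 + 1).
assert (HM0' := Rmax_l M0 0). assert (HM1 := Rmax_r M0 0).
assert (HM : 0 <= M) by (unfold M; lra).
assert (HM2 : forall q w, circle w -> M < Rabs q -> U0 q w = 0).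
{ intros q w Hw Hq. apply HM0; [easy | unfold M in Hq; lra]. }
assert (HDb := data_bounded U0 D M HD HM2).
assert (HDs := data_partials_supp U0 D M HD HM2).
assert (FD : bounded_family D).
{ split; [easy | split]; [apply HD | apply HD]. }
destruct (HDb 1%nat O) as (b1 & Hb1 & Hb1'). destruct (HDb 2%nat O) as (b2 & Hb2 & Hb2').
set (B := D 1%nat O).
assert (SB : smooth (fun p => B (pq p) (pw p))) by now apply bounded_family_smooth.
destruct (smooth_profile g0 B M (b1 + b2)) as (Phi & SPhi & Sol & K & HK & Hlam); auto.
{ lra. }
{ intros q w Hw. specialize (Hb1' q w Hw). unfold B. lra. }
{ intros q q' w Hw. apply Rle_trans with (b2 * Rabs (q - q')).
  - apply (Lipschitz_of_derive (fun q => B q w) (fun q => D 2%nat O q w)); auto.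
    intros x _. now apply (data_partials_q _ _ HD).
  - apply Rmult_le_compat_r; [apply Rabs_pos | lra]. }
{ intros q w Hw Hq. now apply HDs. }
set (Bp := fun p => B (pq p) (pw p)) in *.
set (lam := fun p => G g0 (pw p) * B (pq p) (pw p) * Phi p) in *.
(* This is [- lam], written as a product with [Phi] so that [Tay_mult] yields the derivative of [mu]
   in [s]. *)
set (nlam := fun p => -1 * (G g0 (pw p) * B (pq p) (pw p)) * Phi p).
assert (Enlam : forall p, nlam p = - lam p) by (intros; unfold nlam, lam; ring).
assert (Slam : smooth lam).
{ apply smooth_mult; [apply smooth_mult |]; auto using smooth_G. }
assert (Snlam : smooth nlam).
{ apply smooth_mult; [apply smooth_scal, smooth_mult |]; auto using smooth_G. }
assert (Bh : bnd (fun p => exp (lam p))).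
{ apply (bnd_exp_linear K). intros p Hp. eapply Rle_trans; [apply Rle_abs | now apply Hlam]. }
assert (Bnh : bnd (fun p => exp (nlam p))).
{ apply (bnd_exp_linear K). intros p Hp. rewrite Enlam.
  rle Rle_abs. rewrite Rabs_Ropp. now apply Hlam. }
assert (Sh : smooth (fun p => exp (lam p))) by (intros n; now apply CK_exp).
assert (Snh : smooth (fun p => exp (nlam p))) by (intros n; now apply CK_exp).
set (mu := fun p => -2 * exp (nlam p)).
assert (Smu : smooth mu) by now apply smooth_scal.
assert (SBh : smooth (fun p => Bp p * exp (lam p))) by now apply smooth_mult.
assert (HsBh : supp M (fun p => Bp p * exp (lam p))).
{ apply supp_mult_l. intros p [_ Hw] Hq. now apply HDs. }
set (U := Iq M (fun p => Bp p * exp (lam p))).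
assert (SU : smooth U) by (intros n; now apply CK_Iq).
change (forall p, ok p -> Phi p = Js U p) in Sol.
assert (TPhi : Tay DS Phi U).
{ apply Tay_ext with (Js U) U; [intros; symmetry; auto | easy |].
  apply Tay_Js_s; [apply (CK_reg O), SU | apply (CK_Lip O _ DS), SU]. }
assert (DUq : forall p, ok p -> deriv DQ U p = Bp p * exp (lam p)).
{ intros p Hp. apply (deriv_unique DQ U (fun p => Bp p * exp (lam p))); auto.
  apply Tay_Iq_q; [apply (CK_reg O), SBh | apply (CK_Lip O _ DQ), SBh]. }
assert (Dmus : forall p, ok p -> deriv DS mu p = 2 * (G g0 (pw p) * Bp p * U p * exp (nlam p))).
{ intros p Hp.
  set (nb := fun q w => -1 * (G g0 w * B q w)).
  assert (Snb : smooth (fun p => nb (pq p) (pw p))).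
  { apply smooth_scal, smooth_mult; [apply smooth_G | easy]. }
  rewrite (deriv_unique DS mu (fun p => -2 * ((0 * Phi p + nb (pq p) (pw p) * U p) * exp (nlam p)))); auto.
  - unfold nb, Bp. ring.
  - apply Tay_scal, Tay_exp; [easy | apply (CK_Lip O _ DS), Snlam |].
    apply (Tay_mult DS (fun p => nb (pq p) (pw p)) Phi (fun _ => 0) U); auto.
    + apply (CK_bnd O), Snb.
    + apply (CK_bnd O), SPhi.
    + apply (CK_Lip O _ DS), Snb.
    + apply (CK_Lip O _ DS), SPhi.
    + apply Tay_s_const. }
assert (Hexp : forall p, exp (nlam p) * exp (lam p) = 1).
{ intros p. rewrite <- exp_plus, Enlam, Rplus_opp_l. apply exp_0. }
assert (Hlam0 : forall q w, circle w -> lam (0, q, w) = 0).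
{ intros q w Hw. unfold lam. rewrite Sol by (split; [apply Rle_refl | easy]).
  replace (Js U (0, q, w)) with 0; [ring |]. symmetry. exact (RInt_point 0 _). }
exists (fun s q w => mu (s, q, w)), (fun s q w => U (s, q, w)),
  (fun a b c s q w => partial mu a b c (s, q, w)), (fun a b c s q w => partial U a b c (s, q, w)).
split; [now apply smooth_smooth_with_partials |].
split; [now apply smooth_smooth_with_partials |].
split; [| split; [| split; [| split]]].
- intros s q w Hs Hw. split.
  + apply is_derive_halfline_quadratic with 0; [easy |]. intros s' Hs' _.
    change (Rabs (mu (s', q, w) * deriv DQ U (s', q, w) - mu (s, q, w) * deriv DQ U (s, q, w)
      - (s' - s) * 0) <= 0 * (s' - s) ^ 2).
    rewrite !DUq by now split.
    assert (E : forall r, mu (r, q, w) * (Bp (r, q, w) * exp (lam (r, q, w))) = -2 * B q w).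
    { intros r. transitivity (-2 * B q w * (exp (nlam (r, q, w)) * exp (lam (r, q, w)))).
      - unfold mu, Bp, pq, pw. cbn [fst snd]. ring.
      - rewrite Hexp. ring. }
    rewrite !E. replace (-2 * B q w - -2 * B q w - (s' - s) * 0) with 0 by ring.
    rewrite Rabs_R0. lra.
  + change (deriv DS mu (s, q, w) = / 2 * G g0 w * mu (s, q, w) ^ 2 * U (s, q, w) * deriv DQ U (s, q, w)).
    rewrite DUq, Dmus by now split. unfold pw at 1. cbn [snd].
    transitivity (2 * (G g0 w * Bp (s, q, w) * U (s, q, w) * exp (nlam (s, q, w)))
      * (exp (nlam (s, q, w)) * exp (lam (s, q, w)))).
    * rewrite Hexp. ring.
    * unfold mu. field.
- intros q w Hw. unfold mu. rewrite Enlam, Hlam0, Ropp_0, exp_0 by easy. ring.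
- intros q w Hw. change (RInt (fun x => B x w * exp (lam (0, x, w))) M q = U0 q w).
  rewrite (RInt_ext _ (fun x => B x w)).
  2: { intros x _. rewrite Hlam0, exp_0 by easy. apply Rmult_1_r. }
  assert (HI : is_RInt (fun x => B x w) M q (minus (D O O q w) (D O O M w))).
  { apply (is_RInt_derive (V := R_CompleteNormedModule) (fun x => D O O x w)).
    - intros x _. now apply (data_partials_q _ _ HD).
    - intros x _. apply (ex_derive_continuous (fun x => B x w)).
      exists (D 2%nat O x w). now apply (data_partials_q _ _ HD). }
  rewrite (is_RInt_unique _ _ _ _ HI).
  rewrite !(data_partials_0 _ _ HD) by easy.
  rewrite (HM0 M w Hw); [apply Rminus_0_r |].
  rewrite Rabs_pos_eq by easy. unfold M. lra.
- intros s w Hs Hw. apply (is_lim_ext_loc (fun _ => 0)).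
  + exists M. intros q Hq. symmetry.
    change (RInt (fun x => Bp (s, x, w) * exp (lam (s, x, w))) M q = 0).
    apply RInt_vanish. intros x Hx. rewrite Rmin_left, Rmax_right in Hx by lra.
    apply (HsBh (s, x, w)); [now split |]. unfold pq; cbn [fst snd].
    rewrite Rabs_pos_eq; lra.
  + apply is_lim_const.
- intros N _.
  (* The summand [/ 2 * exp (lam p)] is the reciprocal of [|mu|]. *)
  assert (Bt : bnd (fun p => Rabs (mu p) + / 2 * exp (lam p)
      + sum_orders 1 N (fun a b c => Rabs (partial mu a b c p))
      + sum_orders 0 N (fun a b c => Rabs (partial U a b c p)))).
  { apply bnd_plus; [apply bnd_plus; [apply bnd_plus |] |].
    - apply bnd_abs, (CK_bnd O), Smu.
    - apply bnd_mult; [apply bnd_const | easy].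
    - now apply bnd_sum_orders.
    - now apply bnd_sum_orders. }
  destruct Bt as (C & HC & Hb). exists C, C. intros s q w Hs Hw.
  assert (He := exp_pos (nlam (s, q, w))).
  split; [unfold mu; lra |].
  specialize (Hb (s, q, w) (conj Hs Hw)).
  eapply Rle_trans; [| exact Hb]. eapply Rle_trans; [| apply Rle_abs].
  right. do 3 f_equal.
  unfold mu. rewrite Rabs_left by lra.
  assert (He' := Hexp (s, q, w)).
  apply Rmult_eq_reg_l with (exp (nlam (s, q, w))); [| lra].
  rewrite <- (Rmult_assoc _ (/ 2)), (Rmult_comm _ (/ 2)), Rmult_assoc, He'. field. lra.
Qed.

(** * A bump function *)

Fixpoint CR (n : nat) (f : R -> R) : Prop :=
  match n with
  | O => True
  | S n => exists f' : R -> R, (forall x, is_derive f x (f' x)) /\ CR n f'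
  end.

Lemma CR_down (n : nat) (f : R -> R) : CR (S n) f -> CR n f.
Proof.
revert f. induction n as [| n IH]; intros f H; [exact I |].
destruct H as (f' & H & H'). exists f'. split; [exact H | now apply IH].
Qed.

Lemma CR_plus (n : nat) (f g : R -> R) : CR n f -> CR n g -> CR n (fun x => f x + g x).
Proof.
revert f g. induction n as [| n IH]; intros f g Hf Hg; [exact I |].
destruct Hf as (f' & Hf & Hf'), Hg as (g' & Hg & Hg').
exists (fun x => f' x + g' x). split; [| now apply IH].
intros x. now apply (is_derive_plus (V := R_NormedModule)).
Qed.

Lemma CR_scal (n : nat) (c : R) (f : R -> R) : CR n f -> CR n (fun x => c * f x).
Proof.
revert f. induction n as [| n IH]; intros f Hf; [exact I |].
destruct Hf as (f' & Hf & Hf'). exists (fun x => c * f' x). split; [| now apply IH].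
intros x. now apply is_derive_scal.
Qed.

Lemma CR_mult (n : nat) (f g : R -> R) : CR n f -> CR n g -> CR n (fun x => f x * g x).
Proof.
revert f g. induction n as [| n IH]; intros f g Hf Hg; [exact I |].
assert (Hf0 := CR_down _ _ Hf). assert (Hg0 := CR_down _ _ Hg).
destruct Hf as (f' & Hf & Hf'), Hg as (g' & Hg & Hg').
exists (fun x => f' x * g x + f x * g' x). split; [| apply CR_plus; now apply IH].
intros x. apply (is_derive_mult (K := R_AbsRing) f g x (f' x) (g' x)); auto. exact Rmult_comm.
Qed.

Lemma is_derive_affine (f : R -> R) (a b x l : R) : is_derive f (b + a * x) l ->
  is_derive (fun x => f (b + a * x)) x (a * l).
Proof.
intros H. apply (is_derive_comp (V := R_NormedModule) f (fun x => b + a * x)); [easy |].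
auto_derive; [easy | ring].
Qed.

Lemma CR_affine (n : nat) (a b : R) (f : R -> R) : CR n f -> CR n (fun x => f (b + a * x)).
Proof.
revert f. induction n as [| n IH]; intros f Hf; [exact I |].
destruct Hf as (f' & Hf & Hf'). exists (fun x => a * f' (b + a * x)).
split; [intros x; now apply is_derive_affine |]. apply CR_scal. now apply IH.
Qed.

(** The function [exp (-1 / x)] extended by zero, with powers of [1 / x] included so that
    derivatives are linear combinations of members of the family. *)
Definition flat (k : nat) (x : R) : R :=
  if Rlt_dec 0 x then (/ x) ^ k * exp (- / x) else 0.

Lemma flat_pos (k : nat) (x : R) : 0 < x -> flat k x = (/ x) ^ k * exp (- / x).
Proof. intros H. unfold flat. destruct Rlt_dec; [easy | lra]. Qed.

Lemma flat_neg (k : nat) (x : R) : x <= 0 -> flat k x = 0.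
Proof. intros H. unfold flat. destruct Rlt_dec; [lra | easy]. Qed.

Lemma exp_pow (n : nat) (x : R) : exp x ^ n = exp (INR n * x).
Proof.
induction n as [| n IH]; [simpl; now rewrite Rmult_0_l, exp_0 |].
rewrite S_INR. simpl. rewrite IH, <- exp_plus. f_equal. ring.
Qed.

(** The inequality [u / m <= exp (u / m)], raised to the power [m]. *)
Lemma pow_exp_neg_bound (m : nat) (u : R) : (0 < m)%nat -> 0 <= u ->
  u ^ m * exp (- u) <= INR m ^ m.
Proof.
intros Hm Hu. assert (Hm' : 0 < INR m) by now apply lt_0_INR.
assert (H : (u / INR m) ^ m <= exp u).
{ replace u with (INR m * (u / INR m)) at 2 by (field; lra). rewrite <- exp_pow.
  assert (0 <= u / INR m) by (apply Rdiv_le_0_compat; lra).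
  apply pow_incr. split; [easy |]. assert (X := exp_tangent (u / INR m)). lra. }
replace (u ^ m) with (INR m ^ m * (u / INR m) ^ m).
- rewrite Rmult_assoc. rewrite <- (Rmult_1_r (INR m ^ m)) at 2.
  apply Rmult_le_compat_l; [apply pow_le; lra |].
  rewrite exp_Ropp. assert (X := exp_pos u).
  apply Rmult_le_reg_r with (exp u); [easy |].
  rewrite Rmult_assoc, Rinv_l by lra. lra.
- rewrite <- Rpow_mult_distr. f_equal. field. lra.
Qed.

(** Two additional powers of [1 / y], still dominated by the exponential, are traded for [y ^ 2];
    this gives the zero derivative at the origin. *)
Lemma flat_quadratic (k : nat) (y : R) : Rabs (flat k y) <= INR (k + 2) ^ (k + 2) * y ^ 2.
Proof.
assert (Hc : 0 <= INR (k + 2) ^ (k + 2)) by apply pow_le, pos_INR.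
destruct (Rlt_dec 0 y) as [Hy | Hy].
- rewrite flat_pos by easy.
  assert (Hi : 0 < / y) by now apply Rinv_0_lt_compat.
  rewrite Rabs_pos_eq by (apply Rmult_le_pos; [apply pow_le; lra | left; apply exp_pos]).
  assert (X := pow_exp_neg_bound (k + 2) (/ y) ltac:(lia) ltac:(lra)).
  replace ((/ y) ^ k * exp (- / y)) with ((/ y) ^ (k + 2) * exp (- / y) * y ^ 2).
  + apply Rmult_le_compat_r; [apply pow2_ge_0 | easy].
  + rewrite pow_add. field. lra.
- rewrite flat_neg, Rabs_R0 by lra. apply Rmult_le_pos; [easy | apply pow2_ge_0].
Qed.

Lemma flat_derive (k : nat) (x : R) :
  is_derive (flat k) x (flat (k + 2) x - INR k * flat (k + 1) x).
Proof.
destruct (Rtotal_order x 0) as [Hx | [-> | Hx]].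
- rewrite !flat_neg by lra. replace (0 - INR k * 0) with 0 by ring.
  apply is_derive_ext_loc with (fun _ => 0).
  + assert (Hd : 0 < - x) by lra. exists (mkposreal _ Hd). intros y Hy.
    change (Rabs (y - x) < - x) in Hy. apply Rabs_lt_between in Hy.
    symmetry. apply flat_neg. lra.
  + apply (is_derive_const (V := R_NormedModule) 0).
- rewrite !flat_neg by lra. replace (0 - INR k * 0) with 0 by ring.
  apply is_derive_quadratic with (INR (k + 2) ^ (k + 2)). intros y.
  rewrite (flat_neg k 0), !Rminus_0_r, Rmult_0_r, Rminus_0_r by lra. apply flat_quadratic.
- rewrite !flat_pos by lra.
  apply is_derive_ext_loc with (fun x => (/ x) ^ k * exp (- / x)).
  + exists (mkposreal _ Hx). intros y Hy.
    change (Rabs (y - x) < x) in Hy. apply Rabs_lt_between in Hy.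
    symmetry. apply flat_pos. lra.
  + auto_derive; [split; [lra | split; [lra | easy]] |].
    rewrite !pow_add. destruct k as [| k]; [simpl; field; lra |].
    replace (Init.Nat.pred (S k)) with k by easy. rewrite <- (tech_pow_Rmult (/ x) k).
    field. lra.
Qed.

Lemma CR_flat (n k : nat) : CR n (flat k).
Proof.
revert k. induction n as [| n IH]; intros k; [exact I |].
exists (fun x => flat (k + 2) x + (- INR k) * flat (k + 1) x). split.
- intros x. replace (flat (k + 2) x + - INR k * flat (k + 1) x)
    with (flat (k + 2) x - INR k * flat (k + 1) x) by ring. apply flat_derive.
- apply CR_plus; [apply IH | apply CR_scal, IH].
Qed.

(** Equal to [exp (- 2 / (1 - q ^ 2))] for [|q| < 1]; the arguments are written in the form that
    [CR_affine] expects. *)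
Definition bump (q : R) : R := flat 0 (1 + -1 * q) * flat 0 (1 + 1 * q).

Definition bump' (q : R) : R :=
  -1 * flat 2 (1 + -1 * q) * flat 0 (1 + 1 * q) + flat 0 (1 + -1 * q) * (1 * flat 2 (1 + 1 * q)).

Lemma CR_bump (n : nat) : CR n bump.
Proof. apply CR_mult; apply CR_affine, CR_flat. Qed.

Lemma bump_derive (q : R) : is_derive bump q (bump' q).
Proof.
assert (H : forall x, is_derive (flat 0) x (flat 2 x)).
{ intros x. replace (flat 2 x) with (flat (0 + 2) x - INR 0 * flat (0 + 1) x) by (simpl; ring).
  apply flat_derive. }
apply (is_derive_mult (K := R_AbsRing) (fun q => flat 0 (1 + -1 * q)) (fun q => flat 0 (1 + 1 * q))).
- apply is_derive_affine, H.
- apply is_derive_affine, H.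
- exact Rmult_comm.
Qed.

Lemma bump'_pos (q : R) : 0 <= q < 1 ->
  bump' q = - (4 * q / (1 - q ^ 2) ^ 2) * exp (- (2 / (1 - q ^ 2))).
Proof.
intros Hq. unfold bump'. rewrite !flat_pos by lra.
replace (- (2 / (1 - q ^ 2))) with (- / (1 + -1 * q) + - / (1 + 1 * q)) by (field; nra).
rewrite exp_plus. field. nra.
Qed.

Lemma bump'_nonpos (q : R) : 0 <= q -> bump' q <= 0.
Proof.
intros Hq. destruct (Rlt_dec q 1) as [H | H].
- rewrite bump'_pos by lra. assert (X := exp_pos (- (2 / (1 - q ^ 2)))).
  assert (0 <= 4 * q / (1 - q ^ 2) ^ 2).
  { apply Rdiv_le_0_compat; [lra |]. apply pow_lt. nra. }
  nra.
- unfold bump'. rewrite !(flat_neg _ (1 + -1 * q)) by lra. lra.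
Qed.

(** The interval avoids [0] and [1], where the derivative vanishes. On it [z = 1 - q ^ 2] is at
    least [3 / 4], so [2 / z <= 8 / 3 <= 3], while [4 q >= 1 >= z ^ 2]. *)
Lemma bump'_neg (q : R) : / 4 <= q <= / 2 -> bump' q <= - exp (- 3).
Proof.
intros Hq. rewrite bump'_pos by lra.
assert (Hq2 : 0 <= q ^ 2 <= / 4) by nra.
set (z := 1 - q ^ 2). assert (Hz : 3 / 4 <= z <= 1) by (unfold z; lra).
assert (H1 : exp (- 3) <= exp (- (2 / z))).
{ apply exp_le. assert (2 / z <= 3); [| lra].
  apply Rmult_le_reg_r with z; [lra |]. unfold Rdiv. rewrite Rmult_assoc, Rinv_l by lra. lra. }
assert (H2 : 1 <= 4 * q / z ^ 2).
{ assert (0 < z ^ 2 <= 1) by nra.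
  apply Rmult_le_reg_r with (z ^ 2); [lra |]. unfold Rdiv. rewrite Rmult_assoc, Rinv_l by lra. lra. }
assert (X := exp_pos (- 3)). nra.
Qed.

Lemma bump_supp (q : R) : 1 < Rabs q -> bump q = 0.
Proof.
intros H. unfold bump. destruct (Rle_dec 0 q) as [Hq | Hq].
- rewrite Rabs_pos_eq in H by lra. rewrite (flat_neg _ (1 + -1 * q)) by lra. ring.
- rewrite Rabs_left in H by lra. rewrite (flat_neg _ (1 + 1 * q)) by lra. ring.
Qed.

Lemma CR_Derive (f : R -> R) : (forall n, CR n f) ->
  (forall x, is_derive f x (Derive f x)) /\ forall n, CR n (Derive f).
Proof.
intros H. split.
- intros x. apply Derive_correct. destruct (H 1%nat) as (f' & Hf & _). exists (f' x). apply Hf.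
- intros n. destruct (H (S n)) as (f' & Hf & Hf').
  replace (Derive f) with f'; [easy |].
  apply functional_extensionality. intros x. symmetry. now apply is_derive_unique.
Qed.

Lemma test_function_of_CR (f : R -> R) (M : R) : (forall n, CR n f) ->
  (forall q, M < Rabs q -> f q = 0) -> test_function (fun q _ => f q).
Proof.
intros Hf HM. split; [| exists M; intros; now apply HM].
assert (Hit : forall b n, CR n (Nat.iter b Derive f)).
{ induction b as [| b IH]; [easy |]. simpl. now apply CR_Derive. }
exists (fun b c q _ => match c with O => Nat.iter b Derive f q | S _ => 0 end). split.
- easy.
- intros b [| c] q w _.
  + apply (CR_Derive _ (Hit b)).
  + exact (@is_derive_const R_AbsRing R_NormedModule 0 q).
- intros b [| c] q w _.
  + exact (@is_derive_const R_AbsRing R_NormedModule (Nat.iter b Derive f q) 0).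
  + exact (@is_derive_const R_AbsRing R_NormedModule 0 0).
- intros b [| c] p _.
  + assert (C : continuous (fun p : R * (R * R) => Nat.iter b Derive f (fst p)) p).
    { apply (continuous_comp (fun p : R * (R * R) => fst p) (Nat.iter b Derive f)).
      - destruct p as [q w]. apply continuous_fst.
      - apply (ex_derive_continuous (Nat.iter b Derive f)).
        exists (Derive (Nat.iter b Derive f) (fst p)). apply (CR_Derive _ (Hit b)). }
    intros P HP. destruct (C P HP) as [d Hd]. exists d. intros y Hy _. now apply Hd.
  + apply filterlim_const.
Qed.

(** * Blow-up when [G < 0] somewhere *)

Lemma halfline_filter (s : R) : Filter (within (fun t => 0 <= t) (locally s)).
Proof. apply within_filter, locally_filter. Qed.

Lemma halfline_filter_lim (s : R) : is_filter_lim (within (fun t => 0 <= t) (locally s)) s.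
Proof. intros P HP. now apply filter_imp with (2 := HP). Qed.

Lemma is_derive_of_halfline (f : R -> R) (s l : R) : 0 < s -> is_derive_halfline f s l ->
  is_derive f s l.
Proof.
intros Hs [H1 H2]. split; [exact H1 |].
intros x Hx. apply (is_filter_lim_locally_unique (V := R_NormedModule)) in Hx. subst x.
intros eps. specialize (H2 s (halfline_filter_lim s) eps).
assert (Hpos : locally s (fun t => 0 <= t)).
{ exists (mkposreal _ Hs). intros y Hy. change (Rabs (y - s) < s) in Hy.
  apply Rabs_lt_between in Hy. lra. }
unfold within in H2. generalize (filter_and _ _ H2 Hpos). apply filter_imp. intros y [A B]. now apply A.
Qed.

(** Freezing the function at [f 0] to the left of [0] gives continuity on all of [R], so the mean
    and intermediate value theorems reach the end point [s = 0]. *)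
Lemma continuous_halfline_extension (f : R -> R) :
  (forall s, 0 <= s -> exists l, is_derive_halfline f s l) ->
  forall s, continuous (fun s => f (Rmax 0 s)) s.
Proof.
intros H s.
assert (Hm : 0 <= Rmax 0 s) by apply Rmax_l.
destruct (H _ Hm) as [l Hl].
assert (E : ex_filterdiff (U := R_NormedModule) (V := R_NormedModule) f
  (within (fun t => 0 <= t) (locally (Rmax 0 s)))).
{ exists (fun h => scal h l). exact Hl. }
assert (C := filterdiff_continuous_aux (U := R_NormedModule) (V := R_NormedModule) f
  (FF := halfline_filter _) E (Rmax 0 s) (halfline_filter_lim _)).
intros P HP. destruct (C P HP) as [d Hd]. exists d. intros y Hy.
apply Hd; [| apply Rmax_l].
change (Rabs (y - s) < d) in Hy. change (Rabs (Rmax 0 y - Rmax 0 s) < d).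
eapply Rle_lt_trans; [| exact Hy].
unfold Rmax, Rabs. repeat destruct Rle_dec; repeat destruct Rcase_abs; lra.
Qed.

Lemma halfline_nondecreasing (f f' : R -> R) (s : R) : 0 <= s ->
  (forall s, 0 <= s -> is_derive_halfline f s (f' s)) ->
  (forall s, 0 < s -> 0 <= f' s) -> f 0 <= f s.
Proof.
intros Hs Hf Hpos.
assert (Hc := continuous_halfline_extension f (fun s Hs => ex_intro _ _ (Hf s Hs))).
(* The intermediate point may be [0], where no sign of [f'] is assumed; the value [0] is put
   there. *)
destruct (MVT_gen (fun s => f (Rmax 0 s)) 0 s (fun x => if Rlt_dec 0 x then f' x else 0))
  as (c & _ & E).
- intros x Hx. rewrite Rmin_left in Hx by easy. destruct Rlt_dec as [Hx0 | Hx0]; [| lra].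
  apply is_derive_ext_loc with f.
  + exists (mkposreal _ Hx0). intros y Hy. change (Rabs (y - x) < x) in Hy.
    apply Rabs_lt_between in Hy. now rewrite Rmax_right by lra.
  + apply is_derive_of_halfline; [easy |]. apply Hf. lra.
- intros x _. apply continuity_pt_filterlim. apply Hc.
- rewrite !Rmax_right in E by lra. assert (0 <= (if Rlt_dec 0 c then f' c else 0)).
  { destruct Rlt_dec; [now apply Hpos | lra]. }
  rewrite Rminus_0_r in E. nra.
Qed.

Lemma halfline_minus (f g : R -> R) (s l m : R) : is_derive_halfline f s l ->
  is_derive_halfline g s m -> is_derive_halfline (fun s => f s - g s) s (l - m).
Proof.
intros Hf Hg.
apply (filterdiff_ext_lin (U := R_NormedModule) (V := R_NormedModule) (fun s => f s - g s)
  (fun h => minus (scal h l) (scal h m))).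
- exact (filterdiff_minus_fct (FF := halfline_filter _) _ _ _ _ Hf Hg).
- intros y. change (y * l - y * m = y * (l - m)). ring.
Qed.

Lemma halfline_constant (f : R -> R) (s : R) : 0 <= s ->
  (forall s, 0 <= s -> is_derive_halfline f s 0) -> f s = f 0.
Proof.
intros Hs Hf. apply Rle_antisym.
- assert (X := halfline_nondecreasing (fun s => 0 - f s) (fun _ => 0 - 0) s Hs).
  cut (0 - f 0 <= 0 - f s); [lra |]. apply X; [| intros; lra].
  intros r Hr. apply halfline_minus; [| now apply Hf].
  apply is_derive_halfline_quadratic with 0; [easy |]. intros s' _ _.
  replace (0 - 0 - (s' - r) * 0) with 0 by ring. rewrite Rabs_R0. lra.
- apply (halfline_nondecreasing f (fun _ => 0)); auto. intros; lra.
Qed.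

Lemma halfline_no_zero_neg (f : R -> R) (s : R) : 0 <= s ->
  (forall s, 0 <= s -> exists l, is_derive_halfline f s l) ->
  (forall s, 0 <= s -> f s <> 0) -> f 0 < 0 -> f s < 0.
Proof.
intros Hs Hf Hn H0.
assert (Hc := continuous_halfline_extension f Hf).
apply Rnot_le_lt. intros Hp.
destruct (IVT_gen (fun s => f (Rmax 0 s)) 0 s 0) as (x & _ & Hx).
- intros y. apply continuity_pt_filterlim. apply Hc.
- rewrite !Rmax_right by lra. rewrite Rmin_left by lra. lra.
- apply (Hn (Rmax 0 x)); [apply Rmax_l | easy].
Qed.

Lemma decreasing_lim_nonneg (f f' : R -> R) (a : R) :
  (forall x, a <= x -> is_derive f x (f' x)) -> (forall x, a <= x -> f' x <= 0) ->
  is_lim f p_infty 0 ->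
  (forall x y, a <= x -> x <= y -> f y <= f x) /\ forall x, a <= x -> 0 <= f x.
Proof.
intros Hf Hneg Hl.
assert (Hd : forall x y, a <= x -> x <= y -> f y <= f x).
{ intros x y Hx Hxy. destruct (MVT_gen f x y f') as (c & Hc & E).
  - intros z Hz. rewrite Rmin_left in Hz by lra. apply Hf. lra.
  - intros z Hz. rewrite Rmin_left in Hz by lra. apply continuity_pt_filterlim.
    apply (ex_derive_continuous f z). exists (f' z). apply Hf. lra.
  - rewrite Rmin_left in Hc by lra. specialize (Hneg c ltac:(lra)). nra. }
split; [easy |]. intros x Hx. apply Rnot_lt_le. intros Hlt.
apply is_lim_spec in Hl. assert (He : 0 < - f x) by lra.
destruct (Hl (mkposreal _ He)) as [A HA]. simpl in HA.
set (y := Rmax x (A + 1)).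
assert (Y1 : x <= y) by apply Rmax_l. assert (Y2 : A + 1 <= y) by apply Rmax_r.
specialize (HA y ltac:(lra)). specialize (Hd x y Hx Y1).
apply Rabs_lt_between in HA. lra.
Qed.

(** The function [- 1 / Y] has slope at least [c], starts no lower than [- 1 / Y 0] and has to stay
    negative, which fails after a time [1 / (c Y 0)]. *)
Lemma riccati_blowup (Y Y' : R -> R) (c : R) : 0 < c ->
  (forall s, 0 <= s -> is_derive_halfline Y s (Y' s)) ->
  (forall s, 0 < s -> c * Y s ^ 2 <= Y' s) -> 0 < Y 0 -> False.
Proof.
intros Hc HY HY' H0.
assert (Hmon : forall s, 0 <= s -> Y 0 <= Y s).
{ intros s Hs. apply (halfline_nondecreasing Y Y'); auto.
  intros r Hr. specialize (HY' r Hr). assert (X := pow2_ge_0 (Y r)). nra. }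
(* The comparison starts at [s = 1], inside the half-line, where two-sided derivatives exist;
   monotonicity gives [Y 1 >= Y 0]. *)
set (T := 1 + / (c * Y 0)).
assert (Hi : 0 < / (c * Y 0)) by (apply Rinv_0_lt_compat; nra).
destruct (MVT_gen (fun s => - / Y s) 1 T (fun s => Y' s / Y s ^ 2)) as (x & Hx & E).
- intros x Hx. rewrite Rmin_left in Hx by (unfold T; lra).
  assert (Hxp : 0 < Y x) by (specialize (Hmon x ltac:(lra)); lra).
  assert (D := is_derive_of_halfline Y x (Y' x) ltac:(lra) (HY x ltac:(lra))).
  replace (Y' x / Y x ^ 2) with (- (- Y' x / Y x ^ 2)) by (field; lra).
  apply (is_derive_opp (V := R_NormedModule) (fun s => / Y s)).
  apply is_derive_inv; [easy | lra].
- intros x Hx. rewrite Rmin_left in Hx by (unfold T; lra).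
  assert (Hxp : 0 < Y x) by (specialize (Hmon x ltac:(lra)); lra).
  assert (D := is_derive_of_halfline Y x (Y' x) ltac:(lra) (HY x ltac:(lra))).
  apply continuity_pt_filterlim. apply (ex_derive_continuous (fun s => - / Y s)).
  exists (- (- Y' x / Y x ^ 2)). apply (is_derive_opp (V := R_NormedModule) (fun s => / Y s)).
  apply is_derive_inv; [easy | lra].
- rewrite Rmin_left in Hx by (unfold T; lra).
  assert (Hxp : 0 < Y x) by (specialize (Hmon x ltac:(lra)); lra).
  assert (Hq : c <= Y' x / Y x ^ 2).
  { apply Rmult_le_reg_r with (Y x ^ 2); [nra |]. unfold Rdiv. rewrite Rmult_assoc, Rinv_l by nra.
    rewrite Rmult_1_r. apply HY'. lra. }
  assert (H1 := Hmon 1 ltac:(lra)). assert (HT := Hmon T ltac:(unfold T; lra)).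
  assert (I1 : / Y 1 <= / Y 0) by (apply Rinv_le_contravar; lra).
  assert (I2 : 0 < / Y T) by (apply Rinv_0_lt_compat; lra).
  replace (T - 1) with (/ (c * Y 0)) in E by (unfold T; ring).
  assert (c * / (c * Y 0) <= Y' x / Y x ^ 2 * / (c * Y 0)) by (apply Rmult_le_compat_r; lra).
  replace (c * / (c * Y 0)) with (/ Y 0) in H by (field; lra). lra.
Qed.

Lemma necessity (g0 : nat -> nat -> R) : geometric_weak_null_condition g0 ->
  forall w, circle w -> 0 <= G g0 w.
Proof.
intros H w Hw. apply Rnot_lt_le. intros HG.
destruct (H (fun q _ => bump q)) as (mu & U & Dmu & DU & Smu & SU & Sol & Hmu0 & HU0 & Hlim & Hexp).
{ apply test_function_of_CR with 1; [apply CR_bump | apply bump_supp]. }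
assert (Dq : forall s q, 0 <= s -> is_derive (fun q => U s q w) q ((DU 0 1 0)%nat s q w)).
{ intros s q Hs. apply is_derive_ext with (fun q => (DU 0 0 0)%nat s q w).
  - intros x. now apply (partials_0 _ _ SU).
  - now apply (partials_q _ _ SU). }
assert (Ds : forall s q, 0 <= s -> is_derive_halfline (fun s => (DU 0 0 0)%nat s q w) s ((DU 1 0 0)%nat s q w)).
{ intros s q Hs. now apply (partials_s _ _ SU). }
assert (Dmus : forall s q, 0 <= s -> is_derive_halfline (fun s => (Dmu 0 0 0)%nat s q w) s ((Dmu 1 0 0)%nat s q w)).
{ intros s q Hs. now apply (partials_s _ _ Smu). }
assert (E0 : forall s q, 0 <= s -> (Dmu 0 0 0)%nat s q w = mu s q w).
{ intros s q Hs. now apply (partials_0 _ _ Smu). }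
(* The growth condition excludes zeros of [mu], so by continuity [mu] keeps its initial sign. *)
assert (Hneg : forall s q, 0 <= s -> mu s q w < 0).
{ intros s q Hs. rewrite <- E0 by easy.
  apply (halfline_no_zero_neg (fun s => (Dmu 0 0 0)%nat s q w)); [easy | | |].
  - intros r Hr. exists ((Dmu 1 0 0)%nat r q w). now apply Dmus.
  - intros r Hr. rewrite E0 by easy. destruct (Hexp 1%nat (le_n 1)) as (C & C' & HC).
    now apply (HC r q w).
  - rewrite E0, Hmu0 by (easy || lra). lra. }
assert (Hcons : forall s q, 0 <= s -> mu s q w * (DU 0 1 0)%nat s q w = -2 * bump' q).
{ intros s q Hs.
  rewrite (halfline_constant (fun s => mu s q w * (DU 0 1 0)%nat s q w) s Hs).
  - rewrite Hmu0 by easy. f_equal.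
    rewrite <- (is_derive_unique _ _ _ (Dq 0 q (Rle_refl 0))).
    rewrite <- (is_derive_unique _ _ _ (bump_derive q)).
    apply Derive_ext. intros x. now apply HU0.
  - intros r Hr. now apply Sol. }
assert (Hq0 : forall s q, 0 <= s -> 0 <= q -> (DU 0 1 0)%nat s q w <= 0).
{ intros s q Hs Hq. assert (X := Hcons s q Hs). assert (Y := Hneg s q Hs).
  assert (Z := bump'_nonpos q Hq). nra. }
assert (HU : forall s, 0 <= s -> (forall x y, 0 <= x -> x <= y -> U s y w <= U s x w) /\
  forall x, 0 <= x -> 0 <= U s x w).
{ intros s Hs. apply (decreasing_lim_nonneg (fun q => U s q w) (fun q => (DU 0 1 0)%nat s q w)); auto. }
(* Differentiating the conserved [mu U_q] in [s] gives [U_sq = - G mu U U_q ^ 2 / 2], and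
   [mu U_q = -2 bump'] eliminates [mu]. *)
assert (Hsq : forall s q, 0 < s -> (DU 1 1 0)%nat s q w =
  G g0 w * bump' q * U s q w * (DU 0 1 0)%nat s q w).
{ intros s q Hs.
  assert (A1 := is_derive_of_halfline _ _ _ Hs (proj1 (Sol s q w (Rlt_le _ _ Hs) Hw))).
  assert (A2 := is_derive_of_halfline _ _ _ Hs (partials_s _ _ SU 0%nat 1%nat 0%nat s q w (Rlt_le _ _ Hs) Hw)).
  assert (A3 : is_derive (fun s => mu s q w) s ((Dmu 1 0 0)%nat s q w)).
  { apply is_derive_ext_loc with (fun s => (Dmu 0 0 0)%nat s q w).
    - exists (mkposreal _ Hs). intros y Hy. change (Rabs (y - s) < s) in Hy.
      apply Rabs_lt_between in Hy. apply E0. lra.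
    - apply is_derive_of_halfline; [easy |]. apply Dmus. lra. }
  assert (A4 := is_derive_mult (K := R_AbsRing) _ _ s _ _ A3 A2 Rmult_comm).
  assert (E := eq_trans (eq_sym (is_derive_unique _ _ _ A4)) (is_derive_unique _ _ _ A1)).
  change ((Dmu 1 0 0)%nat s q w * (DU 0 1 0)%nat s q w
    + mu s q w * (DU 1 1 0)%nat s q w = 0) in E.
  rewrite (proj2 (Sol s q w (Rlt_le _ _ Hs) Hw)) in E.
  assert (X := Hcons s q (Rlt_le _ _ Hs)). assert (Y := Hneg s q (Rlt_le _ _ Hs)).
  set (D := (DU 0 1 0)%nat s q w) in *.
  apply Rmult_eq_reg_l with (mu s q w); [| lra].
  replace (bump' q) with (- / 2 * (mu s q w * D)) by (rewrite X; field).
  lra. }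
set (b0 := exp (- 3)). assert (Hb0 : 0 < b0) by apply exp_pos.
(* On [[1/4, 1/2]] the factor [G bump'] is at least [- G b0 = 2 c]; the half accounts for
   [(U ^ 2)_q = 2 U U_q]. *)
set (c := - G g0 w * b0 / 2). assert (Hc : 0 < c) by (unfold c; nra).
(* A difference of two values in [q] is used because the limit of [U] as [q -> oo] gives no direct
   information on [U_s] there. *)
apply (riccati_blowup (fun s => (DU 0 0 0)%nat s (/ 4) w - (DU 0 0 0)%nat s (/ 2) w)
  (fun s => (DU 1 0 0)%nat s (/ 4) w - (DU 1 0 0)%nat s (/ 2) w) c Hc).
- intros s Hs. apply halfline_minus; now apply Ds.
- intros s Hs. rewrite !(partials_0 _ _ SU) by (easy || lra).
  destruct (HU s (Rlt_le _ _ Hs)) as [Hd Hp].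
  set (W := fun q => (DU 1 0 0)%nat s q w - c * (U s q w * U s q w)).
  assert (HW : W (/ 2) <= W (/ 4)).
  { assert (D : forall q, is_derive W q ((DU 1 1 0)%nat s q w
      - c * ((DU 0 1 0)%nat s q w * U s q w + U s q w * (DU 0 1 0)%nat s q w))).
    { intros q. apply (is_derive_minus (V := R_NormedModule)).
      - apply (partials_q _ _ SU); easy || lra.
      - apply is_derive_scal.
        assert (A := Dq s q (Rlt_le _ _ Hs)).
        exact (is_derive_mult (K := R_AbsRing) _ _ q _ _ A A Rmult_comm). }
    destruct (MVT_gen W (/ 4) (/ 2) (fun q => (DU 1 1 0)%nat s q w
      - c * ((DU 0 1 0)%nat s q w * U s q w + U s q w * (DU 0 1 0)%nat s q w)))
      as (q & Hq & E).
    - intros q _. apply D.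
    - intros q _. apply continuity_pt_filterlim.
      apply (ex_derive_continuous W q). eexists. apply D.
    - rewrite Rmin_left, Rmax_right in Hq by lra.
      rewrite Hsq in E by easy.
      assert (B1 := bump'_neg q Hq). fold b0 in B1.
      assert (B2 := Hq0 s q (Rlt_le _ _ Hs) ltac:(lra)). assert (B3 := Hp q ltac:(lra)).
      set (x := U s q w) in *. set (y := (DU 0 1 0)%nat s q w) in *.
      assert (F : G g0 w * bump' q * x * y - c * (y * x + x * y)
        = (- G g0 w) * (- bump' q - b0) * (x * y)) by (unfold c; field).
      rewrite F in E.
      assert (x * y <= 0) by nra. assert (0 <= (- G g0 w) * (- bump' q - b0)) by nra. nra. }
  unfold W in HW.
  assert (P1 := Hp (/ 4) ltac:(lra)). assert (P2 := Hp (/ 2) ltac:(lra)).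
  assert (P3 := Hd (/ 4) (/ 2) ltac:(lra) ltac:(lra)).
  set (u := U s (/ 4) w) in *. set (v := U s (/ 2) w) in *.
  assert ((u - v) ^ 2 <= u * u - v * v) by nra. nra.
- rewrite !(partials_0 _ _ SU) by (easy || lra). rewrite !HU0 by easy.
  destruct (MVT_gen bump (/ 4) (/ 2) bump') as (q & Hq & E).
  + intros q _. apply bump_derive.
  + intros q _. apply continuity_pt_filterlim. apply (ex_derive_continuous bump q).
    eexists. apply bump_derive.
  + rewrite Rmin_left, Rmax_right in Hq by lra. assert (B1 := bump'_neg q Hq). fold b0 in B1. lra.
Qed.

Theorem mainTheorem3 (g : nat -> nat -> R -> R) (g0 : nat -> nat -> R)
  (Hg : wave_coefficients g g0) :
  geometric_weak_null_condition g0 <->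
  (forall w : R * R, circle w -> 0 <= G g0 w).
Proof. split; [apply necessity | apply sufficiency]. Qed.
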